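(* Let $\varepsilon>0$ and $a=1/10$. For any sequence $(h(d))_{d\ge3}$ of real numbers such that \[ \limsup_{d\to\infty}d^{2+3a}\,\mathbb{P}\big[(G_0^{h(d)+\varepsilon})^c\big]=0, \] one has $h_*(d)\ge h(d)$ for all sufficiently large $d$.
   Context: Under $\mathbb{P}$, $\varphi$ is the Gaussian free field on $\mathbb{Z}^d$ ($d\ge3$): centered Gaussian with covariance the Green function $g(x,y)=\sum_{n\ge0}P_x[X_n=y]$ of simple random walk. $E_\varphi^{\ge h}=\{x:\varphi_x\ge h\}$, and $h_*(d)=\inf\{h:\mathbb{P}[0$ lies in an infinite nearest-neighbour connected component of $E_\varphi^{\ge h}]=0\}$. Identify $\mathbb{Z}^2$ with $\mathbb{Z}^2\times\{0\}^{d-2}\subset\mathbb{Z}^d$ and set $\mathbb{H}_x=2x+\{0,1\}^d$ for $x\in\mathbb{Z}^2$. For $C\subset\mathbb{H}_x$, $\overline{C}^{\mathbb{H}_x}$ denotes the set of points of $\mathbb{H}_x$ that are in $C$ or at $\ell^1$-distance $1$ from $C$. For $h\in\mathbb{R}$ and $x\in\mathbb{Z}^2$, $G^h_x$ is the event that for every $x'\in\mathbb{Z}^2$ with $|x'-x|_1\le1$, the set $\mathbb{H}_{x'}\cap E_\varphi^{\ge h}$ contains a (nearest-neighbour) connected component $C_{x'}$ with $|\overline{C_{x'}}^{\mathbb{H}_{x'}}|\ge(1-d^{-2})|\mathbb{H}_{x'}|$, and the sets $C_{x'}$, $|x'-x|_1\le1$, are all connected to each other by nearest-neighbour paths inside $E_\varphi^{\ge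 h}\cap\bigcup_{|x'-x|_1\le1}\mathbb{H}_{x'}$. *)

(* Defs.v *)
From HB Require Import structures.
From mathcomp Require Import all_boot all_order all_algebra.
From mathcomp Require Import all_classical all_reals all_analysis.
Set Implicit Arguments. Unset Strict Implicit. Unset Printing Implicit Defensive.
Import Order.TTheory GRing.Theory Num.Theory.
Import numFieldNormedType.Exports.
Local Open Scope classical_set_scope.
Local Open Scope ring_scope.

Definition pt (d : nat) := {ffun 'I_d -> int}.

Definition l1dist d (x y : pt d) : nat := \sum_(i < d) `|x i - y i|%N.

Definition adj d (x y : pt d) : Prop := l1dist x y = 1%N.

Definition path_in d (A : set (pt d)) (x y : pt d) : Prop :=
  exists s : seq (pt d),
    (forall z, z \in x :: s -> A z) /\
    (forall k, (k < size s)%N -> adj (nth x (x :: s) k) (nth x s k)) /\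
    last x s = y.

Definition is_component d (A C : set (pt d)) : Prop :=
  exists c0, A c0 /\ C = [set y | path_in A c0 y].

Definition level_set d (R : realType) (phi : pt d -> R) (h : R) : set (pt d) :=
  [set x | h <= phi x].

Definition origin d : pt d := [ffun => 0%R].

Definition embed2 d (x : int * int) : pt d :=
  [ffun i : 'I_d => if nat_of_ord i == 0%N then x.1
                    else if nat_of_ord i == 1%N then x.2 else 0%R].

Definition box_pt d (x : int * int) (b : {ffun 'I_d -> bool}) : pt d :=
  [ffun i => 2 * @embed2 d x i + (b i)%:Z].

Definition box d (x : int * int) : set (pt d) := range (@box_pt d x).

Definition box_closure d (x : int * int) (C : set (pt d)) : set (pt d) :=
  [set y | @box d x y /\ (C y \/ exists c, C c /\ adj c y)].

Definition l1dist2 (x y : int * int) : nat := (`|x.1 - y.1| + `|x.2 - y.2|)%N.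

Definition G_event d (R : realType) (h : R) (x : int * int) (phi : pt d -> R) : Prop :=
  let E := level_set phi h in
  exists C : int * int -> set (pt d),
    (forall x', (l1dist2 x' x <= 1)%N ->
       C x' `<=` @box d x' `&` E /\
       is_component (@box d x' `&` E) (C x') /\
       ((#|[set b : {ffun 'I_d -> bool} | `[< box_closure x' (C x') (@box_pt d x' b) >]]|%:R : R)
          >= (1 - (d%:R ^- 2)) * (#|{ffun 'I_d -> bool}|%:R))) /\
    (forall x' x'', (l1dist2 x' x <= 1)%N -> (l1dist2 x'' x <= 1)%N ->
       exists y z, C x' y /\ C x'' z /\
         path_in (E `&` [set w | exists x0, (l1dist2 x0 x <= 1)%N /\ @box d x0 w]) y z).

Definition shift d (x : pt d) (i : 'I_d) (s : int) : pt d :=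
  [ffun j => x j + (if j == i then s else 0%R)].

Fixpoint srw_prob (R : realType) d (n : nat) (x y : pt d) : R :=
  match n with
  | 0%N => (x == y)%:R
  | n'.+1 => (d.*2)%:R^-1 *
      \sum_(i < d) (srw_prob R n' (shift x i 1) y + srw_prob R n' (shift x i (-1)) y)
  end.

Definition green (R : realType) d (x y : pt d) : R :=
  limn (fun N => \sum_(n < N) srw_prob R n x y).

Definition centered_gaussian (dsp : measure_display) (T : measurableType dsp)
    (R : realType) (P : probability T R) (X : T -> R) (v : R) : Prop :=
  measurable_fun setT X /\
  if v == 0 then P (X @^-1` [set 0]) = 1%E
  else forall A : set R, measurable A ->
         P (X @^-1` A) = normal_prob 0 (Num.sqrt v) A.

(** phi is the Gaussian free field on Z^d under P: a centered Gaussian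
    field with covariance g, i.e. every finite linear combination
    sum_i c_i phi_{x_i} is centered Gaussian with variance
    sum_{i,j} c_i c_j g(x_i, x_j) *)
Definition is_GFF (dsp : measure_display) (T : measurableType dsp)
    (R : realType) (P : probability T R) d (phi : T -> pt d -> R) : Prop :=
  forall (c : seq (R * pt d)),
    centered_gaussian P (fun w => \sum_(p <- c) p.1 * phi w p.2)
      (\sum_(p <- c) \sum_(q <- c) p.1 * q.1 * green R p.2 q.2).

Definition perc_from_origin d (R : realType) (h : R) (phi : pt d -> R) : Prop :=
  level_set phi h (@origin d) /\
  ~ finite_set [set y | path_in (level_set phi h) (@origin d) y].

Definition h_star (dsp : measure_display) (T : measurableType dsp)
    (R : realType) (P : probability T R) d (phi : T -> pt d -> R) : \bar R :=
  ereal_inf [set (h%:E)%E | h in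
    [set h : R | P [set w | perc_from_origin h (phi w)] = 0%E]].

(* Main.v *)
Require Import Defs.
From HB Require Import structures.
From mathcomp Require Import all_boot all_order all_algebra.
From mathcomp Require Import all_classical all_reals all_analysis.
From mathcomp Require Import measurable_realfun.
From mathcomp Require Import ring lra zify.
Set Implicit Arguments. Unset Strict Implicit. Unset Printing Implicit Defensive.
Import Order.TTheory GRing.Theory Num.Theory.
Import numFieldNormedType.Exports.
Local Open Scope classical_set_scope.
Local Open Scope ring_scope.

(** Call a vertex of Z^2 bad when [G_event] fails there.  Two large components of
    the same box coincide, so a nearest-neighbour path of good vertices yields a
    path of the level set, and an infinite good cluster yields percolation.  By
    planar duality in a quadrant, the good cluster of the origin is infinite
    unless, for some k, a star-path of bad vertices joins (k, 0) to distance k.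

    Such arms are controlled by renormalization along the scales L_n = m^(11 n),
    where m ~ d^(1/20): a long arm from u contains a shorter arm from u and one
    from a vertex z at distance L_(n+1) of u, and there are O(L_(n+1)^2) choices
    of z.  The two short arms decouple after lowering the level slightly, because
    the projection of the field near z onto the field near u has variance at most
    the maximum of the Green function between the two regions (the projection is
    an average against a sub-probability, the harmonic measure).  This maximum is
    estimated with the superharmonic function x |-> (d + |x|^2)^(-s).

    The law of the field is only known through its linear combinations; that the
    joint laws of finitely many coordinates are determined (hence translation
    invariance, and independence of uncorrelated families) follows by
    approximating indicators of orthants by trigonometric polynomials. *)

(** * Gaussian laws *)

(** The constants hang together as follows. Decoupling is a union bound over boxes of 2^d vertices
    each, so the Gaussian error exp(- dl^2 / (2 s2)) must beat e^d, where d is of order m^20. This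
    forces a very small Green function. With Y = m^(n+1), two regions are at distance Y^11, and the
    power s = 23 yields a bound of order Y^20 (Y^20 / Y^22)^23 = Y^-26; the exponent is then at
    least Y^23, once eps and the shrinking level gaps are paid for. The scale ratio m^11 exceeds
    sqrt d, about m^10, by a factor m, which is what makes d / |x|^2 small. The recursion squares
    the probability and multiplies it by the square of the scale, so it has to start below a
    fraction of m^-44. The hypothesis supplies d^-2.3 <= m^-46, and the spare m^-2 absorbs numerical
    constants. The levels h + eps / 2^n decrease to h, so all the lowering fits within eps.
    Percolation is obtained with a positive probability only, of order 2^-d. This suffices: [h_star]
    is an infimum over levels of percolation probability zero, and percolation is monotone in the
    level. *)

Section normal_convolution.
Context {R : realType}.
Notation mu := (@lebesgue_measure R).

Lemma integral_normal_prob (m s : R) (f : R -> \bar R) :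
  (normal_prob m s).-integrable [set: R] f ->
  (\int[normal_prob m s]_x f x = \int[mu]_x (f x * (normal_pdf m s x)%:E))%E.
Proof.
move=> fint; have mf := measurable_int _ fint.
have dom := normal_prob_dominates m s.
rewrite -(Radon_Nikodym_change_of_variables dom)//=.
apply: ae_eq_integral => //.
- by apply: emeasurable_funM => //; exact: (measurable_int mu (Radon_Nikodym_integrable dom)).
- apply: emeasurable_funM => //; apply/measurable_EFinP.
  exact: measurable_normal_pdf.
- apply: ae_eqe_mul2l => /=.
  rewrite Radon_NikodymE//=.
  case: cid => /= g [g1 g2 g3].
  apply: integral_ae_eq => //=.
  by apply/measurable_EFinP; exact: measurable_normal_pdf.
  by move=> E _ mE; rewrite -g3.
Qed.

Lemma integral_normal_shift (m s : R) (G : R -> R) : s != 0 -> continuous G ->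
  (forall x, 0 <= G x) ->
  (\int[mu]_z (G z * normal_pdf m s z)%:E =
   \int[mu]_y (G (m + y)%R * normal_pdf 0 s y)%:E)%E.
Proof.
move=> s0 cG G0; pose F (z : R^o) := z - m.
have F'E : F^`()%classic = cst 1.
  apply/funext => z; rewrite /F derive1E deriveD// derive_id derive_cst addr0//.
rewrite [RHS](@increasing_ge0_integration_by_substitutionT _ F)//.
- apply: eq_integral => z _; rewrite F'E /= !fctE mulr1 /F subrKC.
  by congr (_ * _)%:E; rewrite !normal_pdfE// /normal_fun subr0.
- by move=> x y xy; rewrite /F ltrD2r.
- by rewrite F'E => ?; exact: cvg_cst.
- by rewrite F'E; exact: is_cvg_cst.
- by rewrite F'E; exact: is_cvg_cst.
- exact: cvg_addrr_Ny.
- exact: cvg_addrr.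
- move=> y; apply: cvgM; last exact: continuous_normal_pdf.
  apply: (continuous_comp (f := fun y => m + y)); last exact: cG.
  by apply: cvgD; [exact: cvg_cst|exact: cvg_id].
- by move=> y; rewrite mulr_ge0// normal_pdf_ge0.
Qed.

(** Completion of the square, as in Bayes' rule: the joint density of x ~ N(0, a^2) and of z ~ N(x,
    b^2) given x is the density of z times that of x given z. *)
Lemma normal_pdf_mul (a b x z : R) : 0 < a -> 0 < b ->
  let c := Num.sqrt (a ^+ 2 + b ^+ 2) in
  normal_pdf 0 a x * normal_pdf x b z =
  normal_pdf 0 c z * normal_pdf (a ^+ 2 / c ^+ 2 * z) (a * b / c) x.
Proof.
move=> a0 b0 c.
have c2 : c ^+ 2 = a ^+ 2 + b ^+ 2 by rewrite sqr_sqrtr// addr_ge0// sqr_ge0.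
have c0 : 0 < c by rewrite sqrtr_gt0 addr_gt0// exprn_gt0.
have abc0 : 0 < a * b / c by rewrite divr_gt0// mulr_gt0.
rewrite !normal_pdfE ?gt_eqF// /normal_fun.
rewrite mulrACA [RHS]mulrACA -!expRD; congr (_ * expR _).
  rewrite /normal_peak -!invfM -!sqrtrM; last 2 first.
  - by rewrite mulrn_wge0// mulr_ge0 ?sqr_ge0// pi_ge0.
  - by rewrite mulrn_wge0// mulr_ge0 ?sqr_ge0// pi_ge0.
  congr (Num.sqrt _)^-1; field; exact: lt0r_neq0.
rewrite !subr0 -!(mulr_natr (_ ^+ 2)) !exprMn exprVn c2.
have ? : a ^+ 2 + b ^+ 2 != 0 by rewrite -c2 expf_neq0// gt_eqF.
have a0' : a != 0 by rewrite gt_eqF.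
have b0' : b != 0 by rewrite gt_eqF.
by field; apply/and3P; split.
Qed.


Lemma ge0_integral_opp (f : R -> R) : (forall x, 0 <= f x) -> continuous f ->
  (\int[mu]_x (f x)%:E = \int[mu]_x (f (- x))%:E)%E.
Proof.
have half (g : R -> R) : (forall x, 0 <= g x) -> continuous g ->
    (\int[mu]_x (g x)%:E = \int[mu]_(x in [set x | (0 <= x)%R]) (g x)%:E +
      \int[mu]_(x in [set x | (0 <= x)%R]) (g (- x))%:E)%E.
  move=> g0 cg.
  have mg : measurable_fun [set: R] g by exact: continuous_measurable_fun.
  have mposnums : measurable [set x : R | 0 <= x] by rewrite -set_itvcy.
  rewrite -(setUv [set x : R | 0 <= x]) ge0_integral_setU//=; last 4 first.
    exact: measurableC.
    by apply/measurable_EFinP; rewrite setUv.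
    by move=> x _; rewrite lee_fin.
    exact/disj_setPCl.
  congr +%E.
  rewrite -set_itvcy// setCitvr.
  rewrite integral_itv_bndo_bndc; last exact/measurable_EFinP/measurable_funTS.
  rewrite -{1}oppr0 ge0_integration_by_substitutionNy//.
  exact: continuous_subspaceT.
move=> f0 cf; rewrite half// [RHS]half//; last first.
  by move=> x; apply: (continuous_comp (f := -%R)); [exact: opp_continuous|exact: cf].
by rewrite addeC; congr +%E; apply: eq_integral => x _; rewrite opprK.
Qed.

Lemma normal_convolution (a b : R) (G : R -> R) : 0 < a -> 0 < b ->
  continuous G -> (forall x, 0 <= G x) ->
  (\int[mu]_x ((\int[mu]_z (G z * normal_pdf x b z)%:E) * (normal_pdf 0 a x)%:E)
   = \int[mu]_z (G z * normal_pdf 0 (Num.sqrt (a ^+ 2 + b ^+ 2)) z)%:E)%E.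
Proof.
move=> a0 b0 cG G0.
have mG : measurable_fun [set: R] G by exact: continuous_measurable_fun.
pose f (xz : R * R) := (G xz.2 * normal_pdf xz.1 b xz.2 * normal_pdf 0 a xz.1)%:E.
have pdfC x z : normal_pdf x b z = normal_pdf 0 b (z - x).
  by rewrite !normal_pdfE ?gt_eqF// /normal_fun subr0.
transitivity (\int[mu]_x \int[mu]_z f (x, z))%E.
  apply: eq_integral => x _; rewrite -ge0_integralZr//=.
  - apply/measurable_EFinP; apply: measurable_funM => //.
    exact: measurable_normal_pdf.
  - by move=> z _; rewrite lee_fin mulr_ge0// normal_pdf_ge0.
  - by rewrite lee_fin normal_pdf_ge0.
rewrite fubini_tonelli; last 2 first.
- apply/measurable_EFinP; apply: measurable_funM; last first.
    apply: (measurableT_comp (f := normal_pdf 0 a)) => //.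
    exact: measurable_normal_pdf.
  apply: measurable_funM; first exact: measurableT_comp.
  under eq_fun do rewrite pdfC.
  apply: (measurableT_comp (f := normal_pdf 0 b)).
    exact: measurable_normal_pdf.
  exact: measurable_funB.
- by move=> xz; rewrite lee_fin !mulr_ge0// normal_pdf_ge0.
apply: eq_integral => z _; rewrite /f /=.
under eq_integral => x _.
  rewrite -mulrA [_ * normal_pdf 0 a x]mulrC normal_pdf_mul// mulrA EFinM.
  over.
rewrite ge0_integralZl//=.
- by rewrite integral_normal_pdf mule1.
- by apply/measurable_EFinP; exact: measurable_normal_pdf.
- by move=> x _; rewrite lee_fin normal_pdf_ge0.
- by rewrite lee_fin mulr_ge0// normal_pdf_ge0.
Qed.

Definition bounded_mfun d (T : measurableType d) (f : T -> R) : Prop :=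
  measurable_fun setT f /\ exists M, forall x, `|f x| <= M.

Lemma bounded_mfun_integrable d (T : measurableType d) (P : probability T R)
    (f : T -> R) : bounded_mfun f -> P.-integrable setT (EFin \o f).
Proof.
move=> [mf [M fM]]; apply: measurable_bounded_integrable => //.
  by rewrite -ge0_fin_numE// fin_num_measure.
by exists M; split; [exact: num_real|move=> y My x _; exact: le_trans (fM x) (ltW My)].
Qed.

Lemma bounded_mfun_cst d (T : measurableType d) (k : R) : bounded_mfun (fun _ : T => k).
Proof. by split; [exact: measurable_cst|exists `|k|]. Qed.

Lemma bounded_mfunD d (T : measurableType d) (f g : T -> R) : bounded_mfun f -> bounded_mfun g ->
  bounded_mfun (fun x => f x + g x).
Proof.
move=> [mf [M fM]] [mg [N gN]]; split; first exact: measurable_funD.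
by exists (M + N) => x; rewrite (le_trans (ler_normD _ _))// lerD.
Qed.

Lemma bounded_mfunM d (T : measurableType d) (f g : T -> R) : bounded_mfun f -> bounded_mfun g ->
  bounded_mfun (fun x => f x * g x).
Proof.
move=> [mf [M fM]] [mg [N gN]]; split; first exact: measurable_funM.
by exists (M * N) => x; rewrite normrM ler_pM.
Qed.

Lemma bounded_mfun_cos d (T : measurableType d) (f : T -> R) : measurable_fun setT f ->
  bounded_mfun (fun x => cos (f x)).
Proof.
move=> mf; split.
  by apply: measurableT_comp => //; apply: continuous_measurable_fun; exact: continuous_cos.
by exists 1 => x; rewrite ler_norml cos_geN1 cos_le1.
Qed.

Lemma bounded_mfun_sin d (T : measurableType d) (f : T -> R) : measurable_fun setT f ->
  bounded_mfun (fun x => sin (f x)).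
Proof.
move=> mf; split.
  by apply: measurableT_comp => //; apply: continuous_measurable_fun; exact: continuous_sin.
by exists 1 => x; rewrite ler_norml sin_geN1 sin_le1.
Qed.

Section bounded_expectation.
Context d (T : measurableType d) (P : probability T R).

Lemma expect_cst (k : R) : \int[P]_x k = k.
Proof.
rewrite Rintegral_cst// -[RHS]mulr1; congr (_ * _).
exact: (congr1 fine (probability_setT P)).
Qed.

Lemma expectD (f g : T -> R) : bounded_mfun f -> bounded_mfun g ->
  \int[P]_x (f x + g x) = \int[P]_x f x + \int[P]_x g x.
Proof. by move=> bf bg; rewrite RintegralD//; exact: bounded_mfun_integrable. Qed.

Lemma expectZ (k : R) (f : T -> R) : bounded_mfun f ->
  \int[P]_x (k * f x) = k * \int[P]_x f x.
Proof. by move=> bf; rewrite RintegralZl//; exact: bounded_mfun_integrable. Qed.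

Lemma expect_EFin (f : T -> R) : bounded_mfun f ->
  (\int[P]_x (f x)%:E = (\int[P]_x f x)%R%:E)%E.
Proof.
move=> bf; rewrite /Rintegral fineK//.
exact: integrable_fin_num (bounded_mfun_integrable P bf).
Qed.

End bounded_expectation.

(** The characteristic function of N(0, s^2) at 1. Its closed form is never computed: [normal_cosD]
    is enough. *)
Definition normal_cos (s : R) : R := \int[normal_prob 0 s]_x cos x.

Lemma normal_sin0 (s : R) : s != 0 -> \int[normal_prob 0 s]_x sin x = 0.
Proof.
move=> s0.
have bs : bounded_mfun (fun x : R => sin x) by exact: bounded_mfun_sin.
have bNs : bounded_mfun (fun x : R => -1 * sin x).
  by apply: bounded_mfunM => //; exact: bounded_mfun_cst.
(* Adding 1 makes the integrand nonnegative, as the reflection [ge0_integral_opp] requires. *)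
have : \int[normal_prob 0 s]_x (1 + sin x) = \int[normal_prob 0 s]_x (1 + -1 * sin x).
  congr fine.
  rewrite (@integral_normal_prob _ _ (fun x => (1 + sin x)%:E)); last first.
    by apply: bounded_mfun_integrable; apply: bounded_mfunD => //; exact: bounded_mfun_cst.
  rewrite (@integral_normal_prob _ _ (fun x => (1 + -1 * sin x)%:E)); last first.
    by apply: bounded_mfun_integrable; apply: bounded_mfunD => //; exact: bounded_mfun_cst.
  rewrite (ge0_integral_opp (f := fun x => (1 + sin x) * normal_pdf 0 s x)) => [|x|x].
  - apply: eq_integral => x _; rewrite sinN mulN1r; congr (_ * _)%:E.
    by rewrite !normal_pdfE// /normal_fun !subr0 sqrrN.
  - by rewrite mulr_ge0 ?normal_pdf_ge0// -lerBlDl sub0r sin_geN1.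
  - apply: cvgM; last exact: continuous_normal_pdf.
    by apply: cvgD; [exact: cvg_cst|exact: continuous_sin].
rewrite !expectD// ?expectZ//; try exact: bounded_mfun_cst.
by move=> /addrI /esym/eqP; rewrite mulN1r eqNr => /eqP.
Qed.

(** The convolution of two centered Gaussians is tested on 1 + cos, which is nonnegative.
    Integrating cos (x + y) over y leaves [cos x * normal_cos b], since the sine term vanishes by
    symmetry. *)
Lemma normal_cosD (a b : R) : 0 < a -> 0 < b ->
  normal_cos (Num.sqrt (a ^+ 2 + b ^+ 2)) = normal_cos a * normal_cos b.
Proof.
move=> a0 b0; set c := Num.sqrt _.
have bc : bounded_mfun (fun x : R => cos x) by exact: bounded_mfun_cos.
have bs : bounded_mfun (fun x : R => sin x) by exact: bounded_mfun_sin.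
have affine s k : \int[normal_prob 0 s]_x (1 + k * cos x) = 1 + k * normal_cos s.
  rewrite expectD ?expectZ ?expect_cst//; first exact: bounded_mfun_cst.
  by apply: bounded_mfunM => //; exact: bounded_mfun_cst.
have bk k : bounded_mfun (fun x : R => 1 + k * cos x).
  apply: bounded_mfunD; first exact: bounded_mfun_cst.
  by apply: bounded_mfunM => //; exact: bounded_mfun_cst.
have cG : continuous (fun z : R => 1 + cos z).
  by move=> x; apply: cvgD; [exact: cvg_cst|exact: continuous_cos].
have G0 (z : R) : 0 <= 1 + cos z by rewrite -lerBlDl sub0r cos_geN1.
have := normal_convolution a0 b0 cG G0.
under eq_integral => x _.
  rewrite integral_normal_shift ?gt_eqF//.
  have -> : (\int[mu]_y ((1 + cos (x + y)) * normal_pdf 0 b y)%:E =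
      (1 + cos x * normal_cos b)%:E)%E.
    have bxy : bounded_mfun (fun y : R => cos x * cos y + - sin x * sin y).
      by apply: bounded_mfunD; apply: bounded_mfunM => //; exact: bounded_mfun_cst.
    rewrite -(@integral_normal_prob 0 b (fun y => (1 + cos (x + y))%:E)); last first.
      apply: bounded_mfun_integrable; apply: bounded_mfunD; first exact: bounded_mfun_cst.
      by apply: bounded_mfun_cos; exact: measurable_funD.
    under eq_integral do rewrite cosD -mulNr.
    rewrite expect_EFin; last by apply: bounded_mfunD => //; exact: bounded_mfun_cst.
    rewrite expectD//; last exact: bounded_mfun_cst.
    rewrite expectD; try by apply: bounded_mfunM => //; exact: bounded_mfun_cst.
    by rewrite !expectZ// expect_cst normal_sin0 ?gt_eqF// mulr0 addr0.
  over.
under eq_integral do rewrite [cos _ * _]mulrC.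
rewrite -(@integral_normal_prob 0 a (fun x => (1 + normal_cos b * cos x)%:E)); last first.
  by apply: bounded_mfun_integrable; exact: bk.
rewrite -/c.
rewrite -(@integral_normal_prob 0 c (fun x => (1 + cos x)%:E)); last first.
  by apply: bounded_mfun_integrable; apply: bounded_mfunD => //; exact: bounded_mfun_cst.
have -> := expect_EFin (normal_prob 0 a) (bk (normal_cos b)).
have -> := expect_EFin (normal_prob 0 c) (bounded_mfunD (bounded_mfun_cst _ 1) bc).
rewrite affine => -[].
under eq_Rintegral do rewrite -[cos _]mul1r.
rewrite affine mul1r => /addrI E.
exact: etrans (esym E) (mulrC _ _).
Qed.

End normal_convolution.

(** * Real-valued probabilities and union bounds *)

Section prob.
Context {R : realType} d (T : measurableType d) (P : probability T R).

Definition pr (A : set T) : R := fine (P A).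

Lemma prE (A : set T) : measurable A -> P A = (pr A)%:E.
Proof. by move=> mA; rewrite /pr fineK// fin_num_measure. Qed.

Lemma pr_ge0 (A : set T) : 0 <= pr A.
Proof. exact: fine_ge0. Qed.

Lemma pr_le (A B : set T) : measurable A -> measurable B -> A `<=` B ->
  pr A <= pr B.
Proof.
move=> mA mB AB; rewrite -lee_fin -!prE//.
by apply: le_measure; rewrite ?inE.
Qed.

Lemma pr_setT : pr setT = 1.
Proof. exact: (congr1 fine (probability_setT P)). Qed.

Lemma pr_set0 : pr set0 = 0.
Proof. by rewrite /pr measure0. Qed.

Lemma pr_le1 (A : set T) : measurable A -> pr A <= 1.
Proof. by move=> mA; rewrite -pr_setT pr_le. Qed.

Lemma pr_setU (A B : set T) : measurable A -> measurable B ->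
  pr (A `|` B) <= pr A + pr B.
Proof.
move=> mA mB; rewrite -lee_fin EFinD -!prE//; last exact: measurableU.
exact: measureU2.
Qed.

Lemma pr_setC (A : set T) : measurable A -> pr (~` A) = 1 - pr A.
Proof.
move=> mA; have := probability_setC P mA.
rewrite !prE//; last exact: measurableC.
by move=> /= [].
Qed.

Lemma measurable_ex (I : eqType) (s : seq I) (A : I -> set T) :
  (forall i, i \in s -> measurable (A i)) ->
  measurable [set w | exists2 i, i \in s & A i w].
Proof.
elim: s => [|i s IH] mA.
  by rewrite (_ : mkset _ = set0)//; apply/seteqP; split => // w [].
rewrite (_ : mkset _ = A i `|` [set w | exists2 i, i \in s & A i w]).
  apply: measurableU; first by apply: mA; rewrite mem_head.
  by apply: IH => j js; apply: mA; rewrite inE js orbT.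
apply/seteqP; split => w /=.
  by case=> j; rewrite inE => /predU1P[->|js]; [left|right; exists j].
by case=> [|[j js]] Aw; [exists i; rewrite ?mem_head|exists j; rewrite // inE js orbT].
Qed.

Lemma pr_ex (I : eqType) (s : seq I) (A : I -> set T) :
  (forall i, i \in s -> measurable (A i)) ->
  pr [set w | exists2 i, i \in s & A i w] <= \sum_(i <- s) pr (A i).
Proof.
elim: s => [|i s IH] mA.
  by rewrite big_nil (_ : mkset _ = set0) ?pr_set0//; apply/seteqP; split => // w [].
have mAs j : j \in s -> measurable (A j) by move=> js; apply: mA; rewrite inE js orbT.
rewrite (_ : mkset _ = A i `|` [set w | exists2 i, i \in s & A i w]).
  rewrite big_cons (le_trans (pr_setU _ _))//.
  - by apply: mA; rewrite mem_head.
  - exact: measurable_ex.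
  - by rewrite lerD2l IH.
apply/seteqP; split => w /=.
  by case=> j; rewrite inE => /predU1P[->|js]; [left|right; exists j].
by case=> [|[j js]] Aw; [exists i; rewrite ?mem_head|exists j; rewrite // inE js orbT].
Qed.

End prob.

(** * Gaussian variables: cosine transform and tails *)

Section gaussian_law.
Context {R : realType}.
Notation mu := (@lebesgue_measure R).

(** The case 0 mirrors that of [centered_gaussian], where a null variance means the point mass at
    0. *)
Definition gauss_cos (v : R) : R := if v == 0 then 1 else normal_cos (Num.sqrt v).

Lemma gauss_cosD (s t : R) : 0 <= s -> 0 <= t ->
  gauss_cos (s + t) = gauss_cos s * gauss_cos t.
Proof.
rewrite /gauss_cos !le0r; case: eqP => [-> _|_ /= s0].
  by rewrite add0r mul1r.
case: eqP => [-> _|_ /= t0]; first by rewrite addr0 gt_eqF// mulr1.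
have st0 : 0 < s + t by rewrite addr_gt0.
have a0 : 0 < Num.sqrt s by rewrite sqrtr_gt0.
have b0 : 0 < Num.sqrt t by rewrite sqrtr_gt0.
rewrite (gt_eqF st0) -(normal_cosD a0 b0).
by rewrite !sqr_sqrtr// ltW.
Qed.

Context d (T : measurableType d) (P : probability T R) (X : T -> R).

Lemma gaussian_integral (v : R) (f : R -> R) : centered_gaussian P X v ->
  v != 0 -> bounded_mfun f -> \int[P]_w f (X w) = \int[normal_prob 0 (Num.sqrt v)]_x f x.
Proof.
move=> [mX + v0 bf]; rewrite (negbTE v0) => XN; congr fine.
have mX' : @measurable_fun _ _ T (measurableTypeR R) setT X by exact: mX.
have mf : @measurable_fun _ _ (measurableTypeR R) _ setT (EFin \o f).
  by apply/measurable_EFinP; case: bf.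
have fX : P.-integrable (X @^-1` setT) ((EFin \o f) \o X).
  rewrite preimage_setT; apply: (@bounded_mfun_integrable _ _ _ _ (f \o X)).
  case: bf => mf' [M fM]; split; [exact: measurableT_comp|by exists M => w; exact: fM].
have := integral_pushforward mX' mf fX (@measurableT _ _).
rewrite preimage_setT => <-; apply: eq_measure_integral => A mA _.
exact: XN.
Qed.

Lemma gaussian_cos (v th : R) : centered_gaussian P X v -> 0 <= v ->
  \int[P]_w cos (X w + th) = gauss_cos v * cos th.
Proof.
move=> Xv; rewrite le0r /gauss_cos; case: eqP => [v0 _|/eqP v0 /= vgt0].
  case: Xv => mX; rewrite v0 eqxx => X0.
  rewrite mul1r -[RHS](expect_cst P); congr fine.
  apply: ae_eq_integral => //.
    apply/measurable_EFinP; apply: measurableT_comp => //; last exact: measurable_funD.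
    by apply: continuous_measurable_fun; exact: continuous_cos.
  have mX0 : measurable (X @^-1` [set 0]) by rewrite -[_ @^-1` _]setTI; exact: mX.
  exists (~` (X @^-1` [set 0])); split.
  - exact: measurableC.
  - by have := probability_setC P mX0; rewrite X0 subee.
  - by move=> w /=; apply: contra_not => /= -> _; rewrite add0r.
rewrite (gaussian_integral (f := fun x => cos (x + th)) Xv v0); last first.
  by apply: bounded_mfun_cos; exact: measurable_funD.
have bc : bounded_mfun (fun x : R => cos th * cos x).
  by apply: bounded_mfunM; [exact: bounded_mfun_cst|exact: bounded_mfun_cos].
have bs : bounded_mfun (fun x : R => - sin th * sin x).
  by apply: bounded_mfunM; [exact: bounded_mfun_cst|exact: bounded_mfun_sin].
transitivity (\int[normal_prob 0 (Num.sqrt v)]_x (cos th * cos x + - sin th * sin x)).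
  by apply: eq_Rintegral => x _; rewrite cosD mulNr [cos th * _]mulrC [sin th * _]mulrC.
rewrite expectD// !expectZ; [|exact: bounded_mfun_sin|exact: bounded_mfun_cos].
rewrite normal_sin0 ?mulr0 ?addr0 1?mulrC//.
by rewrite gt_eqF// sqrtr_gt0.
Qed.

(* [normal_prob 0 0] is the uniform law on [0, 1], so a negative [v] has to be
   excluded: this law is not symmetric. *)
Lemma gaussian_var_ge0 (v : R) : centered_gaussian P X v ->
  centered_gaussian P (fun w => - X w) v -> 0 <= v.
Proof.
move=> [mX Xv] [mX' Xv']; rewrite leNgt; apply/negP => v0; move: Xv Xv'.
rewrite lt_eqF// (_ : Num.sqrt v = 0); last by apply/eqP; rewrite sqrtr_eq0 ltW.
have N0 : normal_prob 0 0 `]-oo, (0:R)] = 0%E.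
  rewrite /normal_prob /normal_pdf eqxx integral_indic//=.
  have -> : `[0, 1]%classic `&` `]-oo, (0:R)]%classic = [set 0].
    apply/seteqP; split => x /=; rewrite !in_itv/=.
      by move=> [/andP[x0 _] x0']; apply/eqP; rewrite eq_le x0 x0'.
    by move=> ->; rewrite lexx ler01.
  exact: lebesgue_measure_set1.
have m0 : measurable `]-oo, (0:R)]%classic by [].
move=> /(_ _ m0); rewrite N0 => X1 /(_ _ m0); rewrite N0 => X2.
have mX1 : measurable (X @^-1` `]-oo, 0]) by rewrite -[_ @^-1` _]setTI; exact: mX.
have mX2 : measurable ((fun w => - X w) @^-1` `]-oo, 0]).
  by rewrite -[_ @^-1` _]setTI; exact: mX'.
have := pr_setU P mX1 mX2.
rewrite (_ : _ `|` _ = setT).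
  rewrite pr_setT /pr X1 X2/= addr0; apply/negP; rewrite -ltNge; exact: ltr01.
apply/seteqP; split => // w _ /=; rewrite !in_itv/= oppr_le0.
by apply/orP; rewrite le_total.
Qed.

(** For x > e one has x^2 >= e^2 + (x - e)^2, so the density at x is at most the stated exponential
    times the density centered at e, whose mass is 1. *)
Lemma gaussian_upper_tail (v e : R) : centered_gaussian P X v -> 0 < v -> 0 < e ->
  pr P [set w | e < X w] <= expR (- (e ^+ 2 / (v *+ 2))).
Proof.
move=> [mX Xv] v0 e0; move: Xv; rewrite gt_eqF// => Xv.
have me : measurable `]e, +oo[%classic by [].
have := Xv _ me; rewrite (_ : _ @^-1` _ = [set w | e < X w]); last first.
  by apply/seteqP; split => w /=; rewrite in_itv/= andbT.
rewrite -lee_fin -prE => [->|]; last first.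
  rewrite (_ : mkset _ = X @^-1` `]e, +oo[).
    by rewrite -[_ @^-1` _]setTI; exact: mX.
  by apply/seteqP; split => w /=; rewrite in_itv/= andbT.
set s := Num.sqrt v; have s0 : 0 < s by rewrite sqrtr_gt0.
have s2 : s ^+ 2 = v by rewrite sqr_sqrtr// ltW.
apply: (@le_trans _ _ (\int[mu]_(x in `]e, +oo[)
    (expR (- (e ^+ 2 / (v *+ 2))) * normal_pdf e s x)%:E)%E).
  apply: ge0_le_integral => //=.
  - by move=> x _; rewrite lee_fin normal_pdf_ge0.
  - by apply: measurable_funTS; apply/measurable_EFinP; exact: measurable_normal_pdf.
  - apply: measurable_funTS; apply/measurable_EFinP; apply: measurable_funM => //.
    exact: measurable_normal_pdf.
  - move=> x; rewrite in_itv/= andbT => ex; rewrite lee_fin !normal_pdfE ?gt_eqF//.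
    rewrite mulrCA ler_wpM2l ?normal_peak_ge0// /normal_fun subr0 s2 -expRD ler_expR.
    set k := (v *+ 2)^-1.
    have : 0 < k * (e * (x - e)) by rewrite !mulr_gt0 ?subr_gt0// invr_gt0 mulrn_wgt0.
    by move=> ?; lra.
apply: (@le_trans _ _ (\int[mu]_x
    (expR (- (e ^+ 2 / (v *+ 2))) * normal_pdf e s x)%:E)%E).
  apply: ge0_subset_integral => //=.
  - by apply/measurable_EFinP; apply: measurable_funM => //; exact: measurable_normal_pdf.
  - by move=> x _; rewrite lee_fin mulr_ge0 ?normal_pdf_ge0 ?expR_ge0.
under eq_integral do rewrite EFinM.
rewrite ge0_integralZl//=.
- by rewrite integral_normal_pdf mule1.
- by apply/measurable_EFinP; exact: measurable_normal_pdf.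
- by move=> x _; rewrite lee_fin normal_pdf_ge0.
Qed.

End gaussian_law.

Lemma gaussian_tail {R : realType} d (T : measurableType d) (P : probability T R)
    (X : T -> R) (v s2 e : R) : centered_gaussian P X v ->
  centered_gaussian P (fun w => - X w) v -> v <= s2 -> 0 < s2 -> 0 < e ->
  pr P [set w | e < `|X w|] <= 2 * expR (- (e ^+ 2 / (s2 *+ 2))).
Proof.
move=> Xv Xv' vs s0 e0.
have v0 := gaussian_var_ge0 Xv Xv'.
have mXe (Y : T -> R) : measurable_fun setT Y -> measurable [set w | e < Y w].
  move=> mY; rewrite (_ : mkset _ = Y @^-1` `]e, +oo[).
    by rewrite -[_ @^-1` _]setTI; exact: mY.
  by apply/seteqP; split => w /=; rewrite in_itv/= andbT.
have mX := proj1 Xv; have mX' := proj1 Xv'.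
have -> : [set w | e < `|X w|] = [set w | e < X w] `|` [set w | e < - X w].
  by apply/seteqP; split => w /=; rewrite real_lter_normr ?num_real//; move/orP.
rewrite (le_trans (pr_setU _ _ _))//; try exact: mXe.
have half (Y : T -> R) : centered_gaussian P Y v ->
    pr P [set w | e < Y w] <= expR (- (e ^+ 2 / (s2 *+ 2))).
  move=> Yv; move: v0; rewrite le0r => /predU1P[v0|v0].
    case: Yv => mY; rewrite v0 eqxx => Y0.
    have mY0 : measurable (Y @^-1` [set 0]) by rewrite -[_ @^-1` _]setTI; exact: mY.
    rewrite (le_trans _ (expR_ge0 _))//.
    rewrite (@le_trans _ _ (pr P (~` (Y @^-1` [set 0]))))//.
      apply: pr_le; [exact: mXe|exact: measurableC|].
      by move=> w /=; apply: contraPnot => -> ; apply/negP; rewrite -leNgt ltW.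
    by rewrite pr_setC// /pr Y0 subrr.
  rewrite (le_trans (gaussian_upper_tail Yv v0 e0))// ler_expR lerN2.
  rewrite ler_wpM2l ?sqr_ge0// lef_pV2 ?posrE ?mulrn_wgt0//.
  by rewrite lerMn2r vs.
by rewrite mulr_natl mulr2n lerD// half.
Qed.
(** * Joint laws from linear combinations *)

Section steps.
Context {R : realType}.

(** In (1 - s) (1 + s + ... + s^(n-1)) = 1 - s^n, each of the n terms is at least (1 - s) s^n. *)
Lemma mul_expr_le (s : R) (n : nat) : 0 <= s <= 1 ->
  n%:R * (1 - s) * s ^+ n <= 1 - s ^+ n.
Proof.
move=> /andP[s0 s1]; elim: n => [|n IH]; first by rewrite !mul0r expr0 subrr.
rewrite exprS -natr1; set p := s ^+ n in IH *.
have p0 : 0 <= p by rewrite exprn_ge0.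
have p1 : p <= 1 by rewrite exprn_ile1.
have h1 : s * (n%:R * (1 - s) * p) <= s * (1 - p) by rewrite ler_wpM2l.
have h2 : 0 <= (1 - s) * (1 - s * p).
  by rewrite mulr_ge0 ?subr_ge0// mulr_ile1.
by lra.
Qed.

Lemma cvg_natmul_expr (r : R) : 0 <= r < 1 -> n%:R * r ^+ n @[n --> \oo] --> (0 : R).
Proof.
(* One of the two factors s^n of r^n tames n through [mul_expr_le], the other one tends to 0. *)
move=> /andP[r0 r1]; pose s := Num.sqrt r.
have sr : s ^+ 2 = r by rewrite sqr_sqrtr.
have s0 : 0 <= s by rewrite sqrtr_ge0.
have s1 : s < 1 by rewrite -[ltRHS]sqrtr1 ltr_sqrt.
apply: (@squeeze_cvgr _ _ _ _ (fun=> 0) (fun n => (1 - s)^-1 * s ^+ n)).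
- near=> n; rewrite mulr_ge0 ?exprn_ge0//=.
  rewrite -sr exprAC expr2 mulrA ler_wpM2r ?exprn_ge0//.
  rewrite -div1r ler_pdivlMr ?subr_gt0// mulrAC.
  apply: (le_trans (mul_expr_le n _)); first by rewrite s0 ltW.
  by rewrite gerBl exprn_ge0.
- exact: cvg_cst.
- rewrite -[X in _ --> X](mulr0 (1 - s)^-1); apply: cvgM; first exact: cvg_cst.
  by apply: cvg_expr; rewrite ger0_norm.
Unshelve. all: by end_near. Qed.

(* The exponent makes the limit at [u = 1/2] equal to 1, so that no threshold has
   to be assumed to have probability zero. *)
Definition step_poly (n : nat) (u : R) : R := 1 - (1 - u ^+ n) ^+ (n * 2 ^ n).

Lemma step_poly_ge0 n (u : R) : 0 <= u <= 1 -> 0 <= step_poly n u <= 1.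
Proof.
move=> /andP[u0 u1]; rewrite /step_poly subr_ge0 gerBl.
have h0 : 0 <= 1 - u ^+ n by rewrite subr_ge0 exprn_ile1.
by rewrite exprn_ile1 ?exprn_ge0// gerBl exprn_ge0.
Qed.

Lemma bernoulli (y : R) k : 0 <= y <= 1 -> 1 - k%:R * y <= (1 - y) ^+ k.
Proof.
move=> /andP[y0 y1]; elim: k => [|k IH]; first by rewrite mul0r subr0.
rewrite exprS -natr1.
have h : (1 - y) * (1 - k%:R * y) <= (1 - y) * (1 - y) ^+ k.
  by rewrite ler_wpM2l// subr_ge0.
have h2 : 0 <= k%:R * y ^+ 2 by rewrite mulr_ge0// sqr_ge0.
by lra.
Qed.

(** The exponent times u^n is n (2u)^n. If u >= 1/2 this is at least n, and 1 - y <= e^-y makes the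
    power at most e^-n; if u < 1/2 it tends to 0 and Bernoulli's inequality applies. *)
Lemma cvg_step_poly (u : R) : 0 <= u <= 1 ->
  step_poly n u @[n --> \oo] --> ((2^-1 <= u :> R)%R%:R : R).
Proof.
move=> u01; have /andP[u0 u1] := u01; case: leP => [hu|uh].
  rewrite -[X in _ --> X]subr0; apply: cvgB; first exact: cvg_cst.
  apply: (@squeeze_cvgr _ _ _ _ (fun=> 0) (fun n => n.+1%:R^-1)).
  - near=> n.
    have h0 : 0 <= 1 - u ^+ n by rewrite subr_ge0 exprn_ile1.
    rewrite exprn_ge0//=.
    have -> : n.+1%:R^-1 = (1 + n%:R)^-1 :> R by rewrite nat1r.
    have h1 : 1 - u ^+ n <= expR (- u ^+ n) by exact: expR_ge1Dx.
    rewrite (@le_trans _ _ (expR (- u ^+ n) ^+ (n * 2 ^ n)))//.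
      by rewrite lerXn2r// nnegrE ?expR_ge0.
    rewrite -expRM_natl.
    rewrite (@le_trans _ _ (expR (- n%:R)))//.
      rewrite ler_expR mulrN lerN2 natrM -mulrA -[leLHS]mulr1 ler_wpM2l//.
      rewrite natrX -exprMn exprn_ege1//.
      by rewrite mulrC -ler_pdivrMr// div1r.
    have p1 : 0 < 1 + n%:R :> R by rewrite ltr_pwDl.
    rewrite expRN lef_pV2 ?posrE ?expR_gt0//; exact: expR_ge1Dx.
  - exact: cvg_cst.
  - exact: cvg_harmonic.
apply: (@squeeze_cvgr _ _ _ _ (fun=> 0) (fun n => n%:R * (2 * u) ^+ n)).
- near=> n; have /andP[-> _] /= := step_poly_ge0 n u01.
  rewrite /step_poly lerBlDr -lerBlDl.
  apply: le_trans (bernoulli _ _); last by rewrite exprn_ge0// exprn_ile1.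
  by rewrite exprMn natrM natrX mulrA.
- exact: cvg_cst.
- by apply: cvg_natmul_expr; lra.
Unshelve. all: by end_near. Qed.

(** Trigonometric polynomials see a threshold only modulo a period; this lemma removes the period by
    letting it grow. *)
Lemma sin_eventually (x : R) :
  \forall M \near \oo, (0 <= sin (x / M.+1%:R)) = (0 <= x).
Proof.
near=> M.
have M0 : 0 < M.+1%:R :> R by [].
have xM : `|x / M.+1%:R| < pi.
  rewrite normrM normfV [`|_.+1%:R|]ger0_norm// ltr_pdivrMr//.
  rewrite -ltr_pdivrMl ?pi_gt0// (@lt_trans _ _ M%:R) ?ltr_nat//.
  near: M; exact: nbhs_infty_gtr.
case: (leP 0 x) => x0.
  by rewrite sin_ge0_pi// divr_ge0//= ltW//; apply: le_lt_trans xM; rewrite ler_norm.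
apply/negbTE; rewrite -ltNge -oppr_gt0 -sinN sin_gt0_pi//.
rewrite -mulNr divr_gt0 ?oppr_gt0//= mulNr.
by apply: le_lt_trans xM; rewrite -normrN ler_norm.
Unshelve. all: by end_near. Qed.

End steps.

(** * Trigonometric polynomials in finitely many coordinates *)

Section trig.
Context {R : realType} (I : finType).

(** The phase [th] provides the sines. A generator depends on the coordinates through one linear
    combination only, which for a Gaussian field is a Gaussian variable of known variance. *)
Inductive trig : ((I -> R) -> R) -> Prop :=
| trig_cos c th : trig (fun u => cos (\sum_i c i * u i + th))
| trigZ k F : trig F -> trig (fun u => k * F u)
| trigD F G : trig F -> trig G -> trig (fun u => F u + G u).

Lemma trig_cst k : trig (fun=> k).
Proof.
have := trigZ k (trig_cos (fun=> 0) 0).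
congr trig; apply/funext => u; rewrite big1 => [|i _]; last by rewrite mul0r.
by rewrite addr0 cos0 mulr1.
Qed.

Lemma trigM F G : trig F -> trig G -> trig (fun u => F u * G u).
Proof.
move=> tF tG; elim: tF => [c th|k F1 _ IH|F1 F2 _ IH1 _ IH2]; last 2 first.
- by have := trigZ k IH; congr trig; apply/funext => u; rewrite mulrA.
- by have := trigD IH1 IH2; congr trig; apply/funext => u; rewrite mulrDl.
elim: tG => [c' th'|k F1 _ IH|F1 F2 _ IH1 _ IH2]; last 2 first.
- by have := trigZ k IH; congr trig; apply/funext => u; rewrite mulrCA.
- by have := trigD IH1 IH2; congr trig; apply/funext => u; rewrite mulrDr.
have := trigZ 2^-1 (trigD (trig_cos (fun i => c i - c' i) (th - th'))
                       (trig_cos (fun i => c i + c' i) (th + th'))).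
congr trig; apply/funext => u.
have -> : \sum_i (c i - c' i) * u i = \sum_i c i * u i - \sum_i c' i * u i.
  by rewrite -sumrB; apply: eq_bigr => i _; rewrite mulrBl.
have -> : \sum_i (c i + c' i) * u i = \sum_i c i * u i + \sum_i c' i * u i.
  by rewrite -big_split; apply: eq_bigr => i _; rewrite mulrDl.
set x := \sum_i _; set y := \sum_i _.
rewrite (_ : x - y + (th - th') = (x + th) - (y + th')); last by ring.
rewrite (_ : x + y + (th + th') = (x + th) + (y + th')); last by ring.
rewrite cosB [cos (_ + _ + _)]cosD; set p := cos _ * cos _; set q := sin _ * sin _.
by rewrite addrACA subrr addr0 -mulr2n -(mulr_natl p) mulKf.
Qed.

Lemma trig_prod (J : Type) (r : seq J) (Q : pred J) (F : J -> (I -> R) -> R) :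
  (forall j, trig (F j)) -> trig (fun u => \prod_(j <- r | Q j) F j u).
Proof.
move=> tF; elim: r => [|j r IH].
  by have := trig_cst 1; congr trig; apply/funext => u; rewrite big_nil.
under [X in trig X]funext do rewrite big_cons.
by case: (Q j) => //; exact: trigM.
Qed.

Lemma trig_sum (J : Type) (r : seq J) (Q : pred J) (F : J -> (I -> R) -> R) :
  (forall j, trig (F j)) -> trig (fun u => \sum_(j <- r | Q j) F j u).
Proof.
move=> tF; elim: r => [|j r IH].
  by have := trig_cst 0; congr trig; apply/funext => u; rewrite big_nil.
under [X in trig X]funext do rewrite big_cons.
by case: (Q j) => //; exact: trigD.
Qed.

Lemma trigX F n : trig F -> trig (fun u => F u ^+ n).
Proof.
move=> tF; have := @trig_prod _ (index_iota 0 n) xpredT (fun=> F) (fun=> tF).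
by congr trig; apply/funext => u; rewrite prodr_const_nat subn0.
Qed.

Lemma trig_1B F : trig F -> trig (fun u => 1 - F u).
Proof.
move=> /(trigZ (-1)) /(trigD (trig_cst 1)).
by congr trig; apply/funext => u; rewrite mulN1r.
Qed.

Lemma trig_step n (a M : R) i :
  trig (fun u => step_poly n ((1 + sin ((u i - a) / M)) / 2)).
Proof.
apply/trig_1B/trigX/trig_1B/trigX.
(* The sine is put in the form of [trig_cos] by sin t = cos (t - pi / 2). *)
have := trigM (trigD (trig_cst 1)
  (trig_cos (fun j => (j == i)%:R / M) (- (a / M) - pi / 2))) (trig_cst 2^-1).
congr trig; apply/funext => u; congr ((1 + _) / _).
rewrite (bigD1 i)//= eqxx big1 ?addr0 => [|j /negbTE ->]; last by rewrite !mul0r.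
rewrite addrA -[X in cos X]opprB cosN -[X in cos (X - _)]subr0.
have -> : 1 / M * u i - a / M = (u i - a) / M by ring.
by rewrite subr0 cosB cos_pihalf sin_pihalf mul0r add0r mul1r.
Qed.

(* the polynomial in the coordinates of [w] that agrees with the indicator of
   [Q] on 0-1 vectors *)
Definition multilin (Q : pred {ffun I -> bool}) (w : I -> R) : R :=
  \sum_(S | Q S) \prod_i (if S i then w i else 1 - w i).

Lemma multilin_bool Q (b : I -> bool) :
  multilin Q (fun i => (b i)%:R) = (Q [ffun i => b i])%:R.
Proof.
rewrite /multilin; under eq_bigr => S _.
  have -> : \prod_i (if S i then (b i)%:R else 1 - (b i)%:R) =
      (S == [ffun i => b i])%:R :> R.
    case: eqP => [->|Sb].
      by rewrite big1// => i _; rewrite ffunE; case: (b i); rewrite ?subr0.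
    have [i Sbi] : exists i, S i != b i.
      apply/existsP; rewrite -negb_forall; apply/negP => /forallP h; apply: Sb.
      by apply/ffunP => i; rewrite ffunE; exact/eqP.
    rewrite (bigD1 i)//= (_ : (if S i then _ else _) = 0) ?mul0r//.
    by move: Sbi; case: (S i); case: (b i) => //= _; rewrite subrr.
  over.
case Qb : (Q _).
  by rewrite (bigD1 [ffun i => b i])//= eqxx big1 ?addr0// => S /andP[_ /negbTE ->].
by rewrite big1// => S QS; case: eqP => // SE; move: Qb; rewrite -SE QS.
Qed.

Lemma multilin_bound Q (w : I -> R) : (forall i, 0 <= w i <= 1) ->
  `|multilin Q w| <= #|Q|%:R.
Proof.
move=> w01; rewrite (le_trans (ler_norm_sum _ _ _))// -sum1_card natr_sum.
apply: ler_sum => S _.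
suff /andP[p0 p1] : 0 <= \prod_i (if S i then w i else 1 - w i) <= 1.
  by rewrite ger0_norm.
elim/big_ind: _ => [|x y /andP[x0 x1] /andP[y0 y1]|i _]; first by rewrite ler01 lexx.
  by rewrite mulr_ge0//= mulr_ile1.
by have := w01 i; case: (S i) => /andP[? ?]; apply/andP; split; lra.
Qed.

Lemma cvg_multilin Q (w : nat -> I -> R) (l : I -> R) :
  (forall i, w n i @[n --> \oo] --> l i) ->
  multilin Q (w n) @[n --> \oo] --> multilin Q l.
Proof.
move=> wl; have cprod (S : {ffun I -> bool}) (r : seq I) :
    \prod_(i <- r) (if S i then w n i else 1 - w n i) @[n --> \oo] -->
    \prod_(i <- r) (if S i then l i else 1 - l i).
  elim: r => [|i r IH].
    by rewrite big_nil; under eq_fun do rewrite big_nil; exact: cvg_cst.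
  rewrite big_cons; under eq_fun do rewrite big_cons.
  by apply: cvgM => //; case: (S i) => //; apply: cvgB => //; exact: cvg_cst.
rewrite /multilin; elim: (index_enum _) => [|S r IH].
  by rewrite big_nil; under eq_fun do rewrite big_nil; exact: cvg_cst.
rewrite big_cons; under eq_fun do rewrite big_cons.
by case: (Q S) => //; apply: cvgD.
Qed.

End trig.

(** * From cosines of linear combinations to joint threshold events *)

Section cramer_wold.
Context {R : realType}.

Lemma expect_cvg d (T : measurableType d) (P : probability T R)
    (f : nat -> T -> R) (g : T -> R) (M : R) :
  (forall n, measurable_fun setT (f n)) -> (forall n x, `|f n x| <= M) ->
  measurable_fun setT g ->
  (forall x, f n x @[n --> \oo] --> g x) ->
  \int[P]_x f n x @[n --> \oo] --> \int[P]_x g x.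
Proof.
move=> mf fM mg fg.
have bf n : bounded_mfun (f n) by split => //; exists M.
have gM x : `|g x| <= M.
  have h : `|f n x| @[n --> \oo] --> `|g x| by apply: cvg_norm; exact: fg.
  rewrite -(cvg_lim (@Rhausdorff R) h); apply: limr_le.
    by apply/cvg_ex; exists `|g x|.
  by apply: nearW => n; exact: fM.
have bg : bounded_mfun g by split => //; exists M.
have [] := @dominated_convergence _ _ _ P setT measurableT
  (fun n x => (f n x)%:E) (fun x => (g x)%:E) (fun=> M%:E).
- by move=> n; apply/measurable_EFinP.
- exact/measurable_EFinP.
- by apply: aeW => x _; apply: cvg_EFin; [exact: nearW|exact: fg].
- exact: (bounded_mfun_integrable P (bounded_mfun_cst _ M)).
- by apply: aeW => x n _; rewrite /= lee_fin.
move=> _ _; rewrite expect_EFin//.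
rewrite (_ : [sequence _]_n = (fun n => (\int[P]_x f n x)%:E)); last first.
  by apply/funext => n; rewrite -expect_EFin.
by move/fine_cvg.
Qed.

Context (I : finType) d d' (T : measurableType d) (T' : measurableType d')
  (P : probability T R) (P' : probability T' R)
  (W : T -> R) (W' : T' -> R) (U : I -> T -> R) (V : I -> T' -> R).
Hypotheses (bW : bounded_mfun W) (bW' : bounded_mfun W').
Hypotheses (mU : forall i, measurable_fun setT (U i))
           (mV : forall i, measurable_fun setT (V i)).
Hypothesis eqcos : forall (c : I -> R) th,
  \int[P]_w (W w * cos (\sum_i c i * U i w + th)) =
  \int[P']_w (W' w * cos (\sum_i c i * V i w + th)).

Lemma bounded_mfun_trig F d0 (T0 : measurableType d0) (U0 : I -> T0 -> R) :
  (forall i, measurable_fun setT (U0 i)) -> trig F -> bounded_mfun (fun w => F (U0 ^~ w)).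
Proof.
move=> mU0; elim=> [c th|k G _ IH|G H _ IHG _ IHH].
- apply: bounded_mfun_cos; apply: measurable_funD => //.
  by apply: measurable_sum => i; apply: measurable_funM.
- by apply: bounded_mfunM => //; exact: bounded_mfun_cst.
- exact: bounded_mfunD.
Qed.

Lemma eq_expect_trig F : trig F ->
  \int[P]_w (W w * F (U ^~ w)) = \int[P']_w (W' w * F (V ^~ w)).
Proof.
elim=> [c th|k G tG IH|G H tG IHG tH IHH].
- exact: eqcos.
- under eq_Rintegral do rewrite mulrCA.
  under [RHS]eq_Rintegral do rewrite mulrCA.
  have bG := bounded_mfunM bW (bounded_mfun_trig mU tG).
  have bG' := bounded_mfunM bW' (bounded_mfun_trig mV tG).
  by rewrite !expectZ// IH.
- under eq_Rintegral do rewrite mulrDr.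
  under [RHS]eq_Rintegral do rewrite mulrDr.
  have bG := bounded_mfunM bW (bounded_mfun_trig mU tG).
  have bG' := bounded_mfunM bW' (bounded_mfun_trig mV tG).
  have bH := bounded_mfunM bW (bounded_mfun_trig mU tH).
  have bH' := bounded_mfunM bW' (bounded_mfun_trig mV tH).
  by rewrite !expectD// IHG IHH.
Qed.

Definition eq_expect (F : (I -> R) -> R) :=
  \int[P]_w (W w * F (U ^~ w)) = \int[P']_w (W' w * F (V ^~ w)).

(** Measurability of [F n] is expressed after composition with an arbitrary measurable family, so
    that it serves on both probability spaces. *)
Lemma eq_expect_lim (F : nat -> (I -> R) -> R) G (M : R) :
  (forall n d0 (T0 : measurableType d0) (U0 : I -> T0 -> R),
    (forall i, measurable_fun setT (U0 i)) -> measurable_fun setT (fun w => F n (U0 ^~ w))) ->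
  (forall n u, `|F n u| <= M) ->
  (forall u, F n u @[n --> \oo] --> G u) ->
  (forall n, eq_expect (F n)) -> eq_expect G.
Proof.
move=> mF FM FG eF; rewrite /eq_expect.
have cvgG d0 (T0 : measurableType d0) (P0 : probability T0 R) (W0 : T0 -> R)
    (U0 : I -> T0 -> R) : bounded_mfun W0 -> (forall i, measurable_fun setT (U0 i)) ->
    \int[P0]_w (W0 w * F n (U0 ^~ w)) @[n --> \oo] --> \int[P0]_w (W0 w * G (U0 ^~ w)).
  move=> [mW0 [N WN]] mU0; apply: (@expect_cvg _ _ _ _ _ (N * M)).
  - by move=> n; apply: measurable_funM => //; exact: mF.
  - by move=> n x; rewrite normrM ler_pM.
  - apply: measurable_funM => //.
    apply: (@measurable_fun_cvg _ _ _ _ (fun n w => F n (U0 ^~ w))).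
      by move=> n; exact: mF.
    by move=> w _; exact: FG.
  - by move=> x; apply: cvgM; [exact: cvg_cst|exact: FG].
have h1 := cvgG _ _ P _ _ bW mU; have h2 := cvgG _ _ P' _ _ bW' mV.
have E : (fun n => \int[P]_w (W w * F n (U ^~ w))) =
    (fun n => \int[P']_w (W' w * F n (V ^~ w))).
  by apply/funext => n; exact: eF.
rewrite E in h1; exact: (cvg_unique (@Rhausdorff R) h1 h2).
Qed.

(** The weights make one statement serve twice: weights 1 give equality of joint laws, while a
    function of a second family, compared with its mean, gives independence from that family. *)
Lemma eq_expect_config (a : I -> R) (Q : pred {ffun I -> bool}) :
  \int[P]_w (W w * (Q [ffun i => a i <= U i w])%:R) =
  \int[P']_w (W' w * (Q [ffun i => a i <= V i w])%:R).
Proof.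
pose b (M : nat) (u : I -> R) i := 0 <= sin ((u i - a i) / M.+1%:R).
pose w (n M : nat) (u : I -> R) i := step_poly n ((1 + sin ((u i - a i) / M.+1%:R)) / 2).
have s01 (x : R) : 0 <= (1 + sin x) / 2 <= 1.
  by have := sin_geN1 x; have := sin_le1 x => ? ?; apply/andP; split; lra.
have w01 n M u i : 0 <= w n M u i <= 1 by exact: step_poly_ge0.
have tw n M : trig (fun u => multilin Q (w n M u)).
  apply: trig_sum => S; apply: trig_prod => i.
  by case: (S i); [exact: trig_step|apply: trig_1B; exact: trig_step].
(* Limit in n at a fixed period: [step_poly] sharpens (1 + sin) / 2 at 1/2, that is, into the
   indicator of sin >= 0. *)
have eM M : eq_expect (fun u => (Q [ffun i => b M u i])%:R).
  apply: (@eq_expect_lim (fun n u => multilin Q (w n M u)) _ #|Q|%:R).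
  - by move=> n d0 T0 U0 mU0; case: (bounded_mfun_trig mU0 (tw n M)).
  - by move=> n u; exact: multilin_bound.
  - move=> u; rewrite -multilin_bool; apply: cvg_multilin => i.
    have := cvg_step_poly (s01 ((u i - a i) / M.+1%:R)).
    by rewrite (_ : (2^-1 <= _) = b M u i)// /b; apply/idP/idP => ?; lra.
  - by move=> n; apply: eq_expect_trig.
suff : eq_expect (fun u => (Q [ffun i => a i <= u i])%:R) by [].
(* Limit in M: at each fixed [u] the sign tests become exact. *)
apply: (@eq_expect_lim (fun M u => (Q [ffun i => b M u i])%:R) _ 1) => //.
- move=> M d0 T0 U0 mU0.
  apply: (@measurable_fun_cvg _ _ _ _ (fun n x => multilin Q (w n M (U0 ^~ x)))).
    by move=> n; case: (bounded_mfun_trig mU0 (tw n M)).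
  move=> x _; rewrite -multilin_bool; apply: cvg_multilin => i.
  have := cvg_step_poly (s01 ((U0 i x - a i) / M.+1%:R)).
  by rewrite (_ : (2^-1 <= _) = b M (U0 ^~ x) i)// /b; apply/idP/idP => ?; lra.
- by move=> n u; case: (Q _); rewrite ?normr0 ?normr1.
- move=> u; apply: cvg_near_cst.
  have : \forall M \near \oo, forall i, b M u i = (a i <= u i).
    apply: filter_forall => i.
    by near=> M; rewrite /b -[RHS]subr_ge0; near: M; exact: sin_eventually.
  apply: filterS => M bM; congr (Q _)%:R.
  by apply/ffunP => i; rewrite !ffunE bM.
Unshelve. all: by end_near. Qed.

End cramer_wold.

(** * Gaussian fields and decoupling *)

Section gaussian_field.
Context {R : realType} (X : choiceType) d (T : measurableType d)
  (P : probability T R) (g : X -> X -> R) (phi : T -> X -> R).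

Definition lin (c : seq (R * X)) (w : T) : R := \sum_(p <- c) p.1 * phi w p.2.

Definition cov (c c' : seq (R * X)) : R :=
  \sum_(p <- c) \sum_(q <- c') p.1 * q.1 * g p.2 q.2.

Definition scale (k : R) (c : seq (R * X)) := [seq (k * p.1, p.2) | p <- c].

Definition comb (I : finType) (k : I -> R) (l : I -> seq (R * X)) :=
  flatten [seq scale (k i) (l i) | i <- index_enum I].

Lemma lin_cat c c' w : lin (c ++ c') w = lin c w + lin c' w.
Proof. exact: big_cat. Qed.

Lemma lin_scale k c w : lin (scale k c) w = k * lin c w.
Proof. by rewrite /lin big_map mulr_sumr; apply: eq_bigr => p _; rewrite mulrA. Qed.

Lemma lin_comb (I : finType) k (l : I -> seq (R * X)) w :
  lin (comb k l) w = \sum_i k i * lin (l i) w.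
Proof.
rewrite /comb; elim: (index_enum I) => [|i r IH]; first by rewrite big_nil /lin big_nil.
by rewrite /= lin_cat big_cons lin_scale IH.
Qed.

Lemma cov_catl c c' e : cov (c ++ c') e = cov c e + cov c' e.
Proof. exact: big_cat. Qed.

Lemma cov_catr c c' e : cov e (c ++ c') = cov e c + cov e c'.
Proof. by rewrite /cov -big_split; apply: eq_bigr => p _; rewrite big_cat. Qed.

Lemma cov_scalel k c e : cov (scale k c) e = k * cov c e.
Proof.
rewrite /cov big_map mulr_sumr; apply: eq_bigr => p _ /=.
by rewrite mulr_sumr; apply: eq_bigr => q _; rewrite !mulrA.
Qed.

Lemma cov_scaler k c e : cov e (scale k c) = k * cov e c.
Proof.
rewrite /cov mulr_sumr; apply: eq_bigr => p _ /=; rewrite big_map mulr_sumr.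
by apply: eq_bigr => q _ /=; rewrite !mulrA [_ * k]mulrC.
Qed.

Lemma cov_combl (I : finType) k (l : I -> seq (R * X)) e :
  cov (comb k l) e = \sum_i k i * cov (l i) e.
Proof.
rewrite /comb; elim: (index_enum I) => [|i r IH]; first by rewrite big_nil /cov big_nil.
by rewrite /= cov_catl big_cons cov_scalel IH.
Qed.

Lemma cov_combr (I : finType) k (l : I -> seq (R * X)) e :
  cov e (comb k l) = \sum_i k i * cov e (l i).
Proof.
rewrite /comb; elim: (index_enum I) => [|i r IH].
  by rewrite big_nil /cov big1// => p _; rewrite big_nil.
by rewrite /= cov_catr big_cons cov_scaler IH.
Qed.

Hypothesis gfield : forall c, centered_gaussian P (lin c) (cov c c).

Lemma measurable_lin c : measurable_fun setT (lin c).
Proof. by case: (gfield c). Qed.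

(** Positive semidefiniteness of [g] is read off the field: [lin c] and its opposite are both
    Gaussian with variance [cov c c], so [gaussian_var_ge0] applies. *)
Lemma cov_ge0 c : 0 <= cov c c.
Proof.
apply: (gaussian_var_ge0 (gfield c)).
have := gfield (scale (-1) c); rewrite cov_scalel cov_scaler !mulN1r opprK.
by congr centered_gaussian; apply/funext => w; rewrite lin_scale mulN1r.
Qed.

Lemma lin_tail c s2 e : cov c c <= s2 -> 0 < s2 -> 0 < e ->
  pr P [set w | e < `|lin c w|] <= 2 * expR (- (e ^+ 2 / (s2 *+ 2))).
Proof.
apply: (gaussian_tail (gfield c)).
have := gfield (scale (-1) c); rewrite cov_scalel cov_scaler !mulN1r opprK.
by congr centered_gaussian; apply/funext => w; rewrite lin_scale mulN1r.
Qed.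

Lemma expect_cos_lin c th :
  \int[P]_w cos (lin c w + th) = gauss_cos (cov c c) * cos th.
Proof. by rewrite (gaussian_cos _ (gfield c))// cov_ge0. Qed.

Definition config (I : finType) (l : I -> seq (R * X)) (a : I -> R)
  (Q : pred {ffun I -> bool}) : set T :=
  [set w | Q [ffun i => a i <= lin (l i) w]].

Lemma measurable_config (I : finType) (l : I -> seq (R * X)) a Q :
  measurable (config l a Q).
Proof.
rewrite (_ : config l a Q = [set w | exists2 S, S \in enum Q &
  ~ exists2 i, i \in enum I & (a i <= lin (l i) w) != S i]).
  apply: (@measurable_ex _ T _ (enum Q) (fun S : {ffun I -> bool} =>
    [set w : T | ~ exists2 i, i \in enum I & (a i <= lin (l i) w) != S i])) => S _.
  apply: measurableC.
  apply: (@measurable_ex _ T _ (enum I) (fun i : I =>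
    [set w : T | (a i <= lin (l i) w) != S i])) => i _.
  have mle : measurable [set w | a i <= lin (l i) w].
    rewrite (_ : mkset _ = lin (l i) @^-1` `[a i, +oo[).
      by rewrite -[_ @^-1` _]setTI; exact: measurable_lin.
    by apply/seteqP; split => w /=; rewrite in_itv/= andbT.
  case: (S i).
    rewrite (_ : mkset _ = ~` [set w | a i <= lin (l i) w]).
      exact: measurableC.
    by apply/seteqP; split => w /=; case: (_ <= _).
  rewrite (_ : mkset _ = [set w | a i <= lin (l i) w])//.
  by apply/seteqP; split => w /=; case: (_ <= _).
apply/seteqP; split => w /=.
  move=> Qw; exists [ffun i => a i <= lin (l i) w]; first by rewrite mem_enum.
  by move=> [i _]; rewrite ffunE eqxx.
move=> [S]; rewrite mem_enum => QS h.
rewrite /config /= (_ : [ffun i => a i <= lin (l i) w] = S)//; apply/ffunP => i; rewrite ffunE.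
by apply/eqP; apply/negPn/negP => ne; apply: h; exists i; rewrite ?mem_enum.
Qed.

Lemma expect_indicator (A : T -> bool) : measurable [set w | A w] ->
  \int[P]_w (A w)%:R = pr P [set w | A w].
Proof.
move=> mA; rewrite /pr -[in RHS](setIT [set w | A w]) -integral_indic//=.
congr fine; apply: eq_integral => w _; rewrite indicE.
by congr (_%:R)%:E; case: (boolP (A w)) => Aw; [rewrite mem_set|rewrite memNset//; exact/negP].
Qed.

Lemma bounded_mfun_indicator (A : T -> bool) : measurable [set w | A w] ->
  bounded_mfun (fun w => (A w)%:R : R).
Proof.
move=> mA; split; last first.
  by exists 1 => w; case: (A w); rewrite ?normr0 ?normr1.
rewrite (_ : (fun w => _) = \1_[set w | A w]).
  exact: measurable_indic.
apply/funext => w; rewrite indicE.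
by congr (_%:R); case: (boolP (A w)) => Aw; [rewrite mem_set|rewrite memNset//; exact/negP].
Qed.

(** Two passes of [eq_expect_config]. With a cosine of the second family as weight, cosines of the
    first are replaced by its event; that event then serves as weight while the second family is
    treated. *)
Lemma config_indep (I J : finType) (l : I -> seq (R * X)) (m : J -> seq (R * X))
    a b Q Q' :
  (forall i j, cov (l i) (m j) = 0) -> (forall i j, cov (m j) (l i) = 0) ->
  pr P (config l a Q `&` config m b Q') = pr P (config l a Q) * pr P (config m b Q').
Proof.
move=> lm0 ml0.
have ml i := measurable_lin (l i); have mm j := measurable_lin (m j).
have mcos I' (l' : I' -> seq (R * X)) (mm' : forall i, measurable_fun setT (lin (l' i)))
    (r : seq I') c th :
  bounded_mfun (fun w => cos (\sum_(i <- r) c i * lin (l' i) w + th)).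
  apply: bounded_mfun_cos; apply: measurable_funD => //.
  by apply: measurable_sum => i; apply: measurable_funM.
have coscos c th c' th' :
    \int[P]_w (cos (\sum_j c' j * lin (m j) w + th') *
               cos (\sum_i c i * lin (l i) w + th)) =
    \int[P]_w (\int[P]_w cos (\sum_j c' j * lin (m j) w + th') *
               cos (\sum_i c i * lin (l i) w + th)).
  rewrite [RHS]expectZ; last exact: mcos.
  have cl th0 : \int[P]_w cos (\sum_i c i * lin (l i) w + th0) =
      gauss_cos (cov (comb c l) (comb c l)) * cos th0.
    by rewrite -expect_cos_lin; apply: eq_Rintegral => w _; rewrite lin_comb.
  have cm th0 : \int[P]_w cos (\sum_j c' j * lin (m j) w + th0) =
      gauss_cos (cov (comb c' m) (comb c' m)) * cos th0.
    by rewrite -expect_cos_lin; apply: eq_Rintegral => w _; rewrite lin_comb.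
  rewrite cl cm.
  (* The signs s = 1 and s = -1 are the two terms of the product-to-sum formula. The cross
     covariances being zero, both have the same variance, a sum, which [gauss_cosD] turns into a
     product. *)
  have clm (s : R) th0 : s ^+ 2 = 1 ->
     \int[P]_w cos (lin (comb c' m ++ scale s (comb c l)) w + th0) =
      gauss_cos (cov (comb c l) (comb c l)) *
      gauss_cos (cov (comb c' m) (comb c' m)) * cos th0.
    move=> s1; rewrite expect_cos_lin; congr (_ * _).
    rewrite -(gauss_cosD (cov_ge0 (comb c l)) (cov_ge0 (comb c' m))).
    congr gauss_cos.
    rewrite cov_catl !cov_catr !cov_scalel !cov_scaler mulrA -expr2 s1 mul1r.
    have -> : cov (comb c' m) (comb c l) = 0.
      rewrite cov_combl big1// => j _; rewrite cov_combr big1 ?mulr0// => i _.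
      by rewrite ml0 mulr0.
    have -> : cov (comb c l) (comb c' m) = 0.
      rewrite cov_combl big1// => j _; rewrite cov_combr big1 ?mulr0// => i _.
      by rewrite lm0 mulr0.
    by rewrite !mulr0 addr0 add0r addrC.
  transitivity (\int[P]_w (2^-1 * (cos (lin (comb c' m ++ scale (-1) (comb c l)) w + (th' - th))
      + cos (lin (comb c' m ++ scale 1 (comb c l)) w + (th' + th))))).
    apply: eq_Rintegral => w _; rewrite !lin_cat !lin_scale !lin_comb mulN1r mul1r.
    set x := \sum_j c' j * _; set y := \sum_i _.
    rewrite (_ : x - y + (th' - th) = (x + th') - (y + th)); last by ring.
    rewrite (_ : x + y + (th' + th) = (x + th') + (y + th)); last by ring.
    rewrite cosB [cos (_ + _ + _)]cosD; set p := cos _ * cos _; set q := sin _ * sin _.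
    by rewrite addrACA subrr addr0 -mulr2n -(mulr_natl p) mulKf.
  have bl c0 th0 : bounded_mfun (fun w => cos (lin c0 w + th0)).
    by apply: bounded_mfun_cos; apply: measurable_funD => //; exact: measurable_lin.
  rewrite expectZ ?expectD// ?clm ?sqrrN ?expr1n//; last exact: bounded_mfunD.
  rewrite cosB [cos (th' + th)]cosD.
  by set A := gauss_cos _; set B := gauss_cos _; field.
have step1 c' th' :
    \int[P]_w (cos (\sum_j c' j * lin (m j) w + th') * (Q [ffun i => a i <= lin (l i) w])%:R) =
    \int[P]_w (\int[P]_w cos (\sum_j c' j * lin (m j) w + th') *
        (Q [ffun i => a i <= lin (l i) w])%:R).
  apply: (@eq_expect_config _ _ _ _ _ _ _ _ _ _ (fun i => lin (l i)) (fun i => lin (l i))) => //.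
  - exact: mcos.
  - exact: bounded_mfun_cst.
have bQ := bounded_mfun_indicator (measurable_config l a Q).
have bQ' := bounded_mfun_indicator (measurable_config m b Q').
have step2 : \int[P]_w ((Q [ffun i => a i <= lin (l i) w])%:R *
       (Q' [ffun i => b i <= lin (m i) w])%:R) =
    \int[P]_w (\int[P]_w (Q [ffun i => a i <= lin (l i) w])%:R *
       (Q' [ffun i => b i <= lin (m i) w])%:R).
  apply: (@eq_expect_config _ _ _ _ _ _ _ _ _ _ (fun i => lin (m i)) (fun i => lin (m i))) => //.
  - exact: bounded_mfun_cst.
  - move=> c' th'; under eq_Rintegral do rewrite mulrC.
    rewrite step1 !expectZ//; last exact: mcos.
    by rewrite mulrC.
rewrite expectZ// !expect_indicator in step2; try exact: measurable_config.
rewrite -step2.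
have E : config l a Q `&` config m b Q' =
    [set w | Q [ffun i => a i <= lin (l i) w] && Q' [ffun i => b i <= lin (m i) w]].
  by apply/seteqP; split => w /=; [case=> ? ?; apply/andP|move/andP].
have mE := measurableI _ _ (measurable_config l a Q) (measurable_config m b Q').
rewrite E in mE *; rewrite -(expect_indicator mE).
by apply: eq_Rintegral => w _; rewrite -natrM mulnb.
Qed.

Lemma config_eq_law (I : finType) (l m : I -> seq (R * X)) a Q :
  (forall i j, cov (l i) (l j) = cov (m i) (m j)) ->
  pr P (config l a Q) = pr P (config m a Q).
Proof.
move=> lm.
have bQ := expect_indicator (measurable_config l a Q).
have bQ' := expect_indicator (measurable_config m a Q).
rewrite -bQ -bQ'.
under eq_Rintegral do rewrite -[_%:R]mul1r.
under [RHS]eq_Rintegral do rewrite -[_%:R]mul1r.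
apply: (@eq_expect_config _ _ _ _ _ _ _ _ (fun=> 1) (fun=> 1)
  (fun i => lin (l i)) (fun i => lin (m i))) => //; try exact: bounded_mfun_cst.
- by move=> i; exact: measurable_lin.
- by move=> i; exact: measurable_lin.
move=> c th; under eq_Rintegral do rewrite mul1r -lin_comb.
under [RHS]eq_Rintegral do rewrite mul1r -lin_comb.
rewrite (expect_cos_lin (comb c l)) (expect_cos_lin (comb c m)).
suff -> : cov (comb c l) (comb c l) = cov (comb c m) (comb c m) by [].
rewrite !cov_combl; apply: eq_bigr => i _; rewrite !cov_combr.
by congr (_ * _); apply: eq_bigr => j _; rewrite lm.
Qed.

End gaussian_field.

(** * Local and decreasing events of the level set *)

Section events.
Context {X : choiceType}.

Definition supported (K : seq X) (Q : set X -> Prop) : Prop :=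
  forall E E' : set X, (forall x, x \in K -> (E x <-> E' x)) -> Q E -> Q E'.

Definition decreasing (Q : set X -> Prop) : Prop :=
  forall E E' : set X, E `<=` E' -> Q E' -> Q E.

Lemma decreasing_on K Q : supported K Q -> decreasing Q ->
  forall E E' : set X, (forall x, x \in K -> E x -> E' x) -> Q E' -> Q E.
Proof.
move=> sQ dQ E E' EE' QE'.
apply: (sQ (E `&` [set x | x \in K])); first by move=> x xK; split=> [[]|].
by apply: dQ QE' => x [Ex xK]; exact: EE'.
Qed.

Context {R : realType} d (T : measurableType d)
  (P : probability T R) (g : X -> X -> R) (phi : T -> X -> R).
Hypothesis gfield : forall c, centered_gaussian P (lin phi c) (cov g c c).

(** Replacing the value at x by the linear form [l x] covers the field itself, its translates, and
    the field minus its projection. *)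
Definition event_of (l : X -> seq (R * X)) (h : R) (Q : set X -> Prop) : set T :=
  [set w | Q [set x | h <= lin phi (l x) w]].

Definition event (h : R) (Q : set X -> Prop) : set T :=
  [set w | Q [set x | h <= phi w x]].

Lemma lin1 x w : lin phi [:: (1, x)] w = phi w x.
Proof. by rewrite /lin big_seq1 mul1r. Qed.

Lemma eventE h Q : event h Q = event_of (fun x => [:: (1, x)]) h Q.
Proof.
apply/seteqP; split => w; rewrite /event /event_of /=.
  by congr (Q _); apply/seteqP; split => x /=; rewrite lin1.
by congr (Q _); apply/seteqP; split => x /=; rewrite lin1.
Qed.

Definition bool_pred (K : seq X) (Q : set X -> Prop) (S : {ffun seq_sub K -> bool}) : bool :=
  `[< Q [set x | exists i : seq_sub K, val i = x /\ S i] >].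

Lemma event_ofE K l h Q : supported K Q ->
  event_of l h Q =
  config phi (fun i : seq_sub K => l (val i)) (fun=> h) (@bool_pred K Q).
Proof.
move=> sQ; apply/seteqP; split => w; rewrite /event_of /config /=.
  move=> Qw; apply/asboolP; apply: sQ Qw => x xK; split => /= [hx|].
    by exists (SeqSub xK); rewrite ffunE.
  by move=> [i [<-]]; rewrite ffunE.
move=> /asboolP; apply: sQ => x xK; split => /= [|hx].
  by move=> [i [<-]]; rewrite ffunE.
by exists (SeqSub xK); rewrite ffunE.
Qed.

Lemma measurable_event_of K l h Q : supported K Q -> measurable (event_of l h Q).
Proof. by move=> sQ; rewrite (event_ofE _ _ sQ); exact: (measurable_config gfield). Qed.

Lemma measurable_event K h Q : supported K Q -> measurable (event h Q).
Proof. by rewrite eventE; exact: measurable_event_of. Qed.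

Lemma event_le_level K h h' Q : supported K Q -> decreasing Q -> h <= h' ->
  pr P (event h Q) <= pr P (event h' Q).
Proof.
move=> sQ dQ hh'; apply: pr_le; try exact: measurable_event sQ.
by move=> w; apply: dQ => x /=; exact: le_trans.
Qed.

(* [Z y] stands for the conditional expectation of [phi y] given the field on
   [K1], so that [phi y - Z y] is independent of the latter *)
Lemma decoupling (K1 K2 : seq X) (Z : X -> seq (R * X)) (Q1 Q2 : set X -> Prop)
    (h dl s2 : R) :
  supported K1 Q1 -> supported K2 Q2 -> decreasing Q2 -> 0 < dl -> 0 < s2 ->
  (forall x y, x \in K1 -> y \in K2 -> cov g [:: (1, x)] (Z y) = g x y) ->
  (forall x y, x \in K1 -> y \in K2 -> cov g (Z y) [:: (1, x)] = g y x) ->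
  (forall y, y \in K2 -> cov g (Z y) (Z y) <= s2) ->
  pr P (event h Q1 `&` event h Q2) <=
  pr P (event h Q1) * pr P (event (h + dl *+ 2) Q2) +
  ((size K2)%:R * (2 * expR (- (dl ^+ 2 / (s2 *+ 2))))) *+ 2.
Proof.
move=> s1 sQ2 dQ2 dl0 s20 covl covr var.
pose Y y := (1, y) :: scale (-1) (Z y).
have linY y w : lin phi (Y y) w = phi w y - lin phi (Z y) w.
  rewrite -[Y y]/([:: (1, y)] ++ scale (-1) (Z y)) lin_cat lin_scale lin1.
  by rewrite mulN1r.
pose far := [set w | exists2 y, y \in K2 & dl < `|lin phi (Z y) w|].
have mfar y : measurable [set w | dl < `|lin phi (Z y) w|].
  have mZ := measurable_lin gfield (Z y).
  rewrite (_ : mkset _ = (fun w => `|lin phi (Z y) w|) @^-1` `]dl, +oo[).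
    by rewrite -[_ @^-1` _]setTI; apply: measurableT_comp.
  by apply/seteqP; split => w /=; rewrite in_itv/= andbT.
have Mfar : measurable far.
  exact: (measurable_ex (fun i (_ : i \in K2) => mfar i)).
set err := (size K2)%:R * _.
have pfar : pr P far <= err.
  have hfar := pr_ex P (s := K2) (fun i (_ : i \in K2) => mfar i).
  apply: (le_trans hfar).
  rewrite big_seq_cond (@le_trans _ _ (\sum_(i <- K2 | (i \in K2) && true)
    (2 * expR (- (dl ^+ 2 / (s2 *+ 2))))))//.
    apply: ler_sum => y /andP[yK _]; apply: (lin_tail gfield) => //; exact: var.
  by rewrite -big_seq_cond big_const_seq count_predT iter_addr_0 -[leLHS]mulr_natl.
have m1 := measurable_event h s1.
have m2 k := measurable_event k sQ2.
have mY k := measurable_event_of Y k sQ2.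
have err0 : 0 <= err by rewrite mulr_ge0// mulr_ge0// expR_ge0.
have sub1 : event h Q1 `&` event h Q2 `<=`
    (event h Q1 `&` event_of Y (h + dl) Q2) `|` far.
  move=> w [Q1w Q2w]; case: (pselect (far w)) => nf; first by right.
  left; split; first exact: Q1w.
  apply: (decreasing_on sQ2 dQ2) Q2w => y yK /=; rewrite linY => hy.
  have : `|lin phi (Z y) w| <= dl.
    by rewrite leNgt; apply/negP => ?; apply: nf; exists y.
  by rewrite ler_norml => /andP[? ?]; lra.
have sub2 : event_of Y (h + dl) Q2 `<=` event (h + dl *+ 2) Q2 `|` far.
  move=> w Q2w; case: (pselect (far w)) => nf; first by right.
  left.
  apply: (decreasing_on sQ2 dQ2) Q2w => y yK /=; rewrite linY => hy.
  have : `|lin phi (Z y) w| <= dl.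
    by rewrite leNgt; apply/negP => ?; apply: nf; exists y.
  by rewrite ler_norml => /andP[? ?]; lra.
have p1 : 0 <= pr P (event h Q1) <= 1 by rewrite pr_ge0 pr_le1.
have indep : pr P (event h Q1 `&` event_of Y (h + dl) Q2) =
    pr P (event h Q1) * pr P (event_of Y (h + dl) Q2).
  rewrite eventE (event_ofE _ _ s1) (event_ofE _ _ sQ2).
  apply: (config_indep gfield) => i j.
    rewrite -[Y _]/([:: (1, val j)] ++ scale (-1) (Z (val j))) cov_catr cov_scaler.
    by rewrite covl ?ssvalP// mulN1r /cov !big_seq1/= !mul1r subrr.
  rewrite -[Y _]/([:: (1, val j)] ++ scale (-1) (Z (val j))) cov_catl cov_scalel.
  by rewrite covr ?ssvalP// mulN1r /cov !big_seq1/= !mul1r subrr.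
have := pr_le P (measurableI _ _ m1 (m2 h))
  (measurableU _ _ (measurableI _ _ m1 (mY (h + dl))) Mfar) sub1.
have := pr_setU P (measurableI _ _ m1 (mY (h + dl))) Mfar.
have := pr_le P (mY (h + dl)) (measurableU _ _ (m2 (h + dl *+ 2)) Mfar) sub2.
have := pr_setU P (m2 (h + dl *+ 2)) Mfar.
rewrite indep.
move: p1 => /andP[].
set A := pr P (event h Q1); set B := pr P (event_of _ _ _).
set C := pr P (event (h + dl *+ 2) Q2); set F := pr P far in pfar *.
set G := pr P (_ `|` _); set H := pr P (_ `|` _).
set J := pr P (_ `&` _) => A0 A1 h1 h2 h3 h4.
have h5 : A * B <= A * (C + F) by rewrite ler_wpM2l//; lra.
have h6 : A * F <= 1 * F by rewrite ler_wpM2r// pr_ge0.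
by lra.
Qed.

Lemma event_translation K (tau : X -> X) h Q Q' :
  (forall x y, g (tau x) (tau y) = g x y) ->
  supported K Q -> (forall E, Q' E = Q (tau @^-1` E)) ->
  pr P (event h Q') = pr P (event h Q).
Proof.
move=> gtau sQ Q'E.
have -> : event h Q' = event_of (fun x => [:: (1, tau x)]) h Q.
  apply/seteqP; split => w; rewrite /event /event_of /= Q'E.
    by congr (Q _); apply/seteqP; split => x /=; rewrite lin1.
  by congr (Q _); apply/seteqP; split => x /=; rewrite lin1.
rewrite eventE !(event_ofE _ _ sQ).
by apply: (config_eq_law gfield) => i j; rewrite /cov !big_seq1/= !mul1r gtau.
Qed.

End events.

(** * Green function and harmonic measure *)

Lemma cvg_sum_seq {R : realType} (I : eqType) (r : seq I) (f : nat -> I -> R) (l : I -> R) :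
  (forall i, i \in r -> f n i @[n --> \oo] --> l i) ->
  \sum_(i <- r) f n i @[n --> \oo] --> \sum_(i <- r) l i.
Proof.
elim: r => [|i r IH] h.
  by rewrite big_nil; under eq_fun do rewrite big_nil; exact: cvg_cst.
rewrite big_cons; under eq_fun do rewrite big_cons.
apply: cvgD; first by apply: h; rewrite mem_head.
by apply: IH => j jr; apply: h; rewrite inE jr orbT.
Qed.

Section walk.
Context {R : realType} {d : nat}.
Implicit Types x y z : pt d.

Definition dir (i : 'I_d) (s : int) : pt d := [ffun j => if j == i then s else 0].

Lemma shiftE x i s : Defs.shift x i s = x + dir i s.
Proof. by apply/ffunP => j; rewrite !ffunE. Qed.

Lemma dirN i s : dir i (- s) = - dir i s.
Proof. by apply/ffunP => j; rewrite !ffunE; case: (j == i); rewrite ?oppr0. Qed.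

Local Notation p := (@srw_prob R d).

Lemma srw_prob_ge0 n x y : 0 <= p n x y.
Proof.
elim: n x => [|n IH] x //=; rewrite mulr_ge0 ?invr_ge0//.
by apply: sumr_ge0 => i _; rewrite addr_ge0.
Qed.

Lemma srw_prob_translate n x y z : p n (x + z) (y + z) = p n x y.
Proof.
elim: n x => [|n IH] x /=; first by rewrite (inj_eq (addIr z)).
by congr (_ * _); apply: eq_bigr => i _; rewrite !shiftE ![x + z + _]addrAC !IH.
Qed.

Lemma srw_prob_opp n x y : p n (- x) (- y) = p n x y.
Proof.
elim: n x => [|n IH] x /=; first by rewrite (inj_eq oppr_inj).
congr (_ * _); apply: eq_bigr => i _; rewrite !shiftE addrC.
by rewrite -{1}[1]opprK !dirN -!opprD !IH opprK.
Qed.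

Lemma srw_prob_sym n x y : p n x y = p n y x.
Proof.
rewrite -[RHS]srw_prob_opp -[RHS](srw_prob_translate _ _ _ (x + y)).
by rewrite addrCA addNr addr0 addKr.
Qed.

(** The transition operator of simple random walk. *)
Definition mean (f : pt d -> R) x : R :=
  (d.*2)%:R^-1 * \sum_(i < d) (f (Defs.shift x i 1) + f (Defs.shift x i (-1))).

Lemma srw_probS n x y : p n.+1 x y = mean (fun z => p n z y) x.
Proof. by []. Qed.

Lemma mean_le f f' x : (forall z, f z <= f' z) -> mean f x <= mean f' x.
Proof.
move=> ff'; rewrite /mean ler_wpM2l ?invr_ge0//.
by apply: ler_sum => i _; rewrite lerD.
Qed.

Lemma meanZ k f x : mean (fun z => k * f z) x = k * mean f x.
Proof.
rewrite /mean [RHS]mulrCA; congr (_ * _); rewrite mulr_sumr.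
by apply: eq_bigr => i _; rewrite mulrDr.
Qed.

Lemma meanZr k f x : mean (fun z => f z * k) x = mean f x * k.
Proof. by rewrite mulrC -meanZ; congr mean; apply/funext => z; rewrite mulrC. Qed.

Lemma mean_sum (I : Type) (r : seq I) (Q : pred I) (f : I -> pt d -> R) x :
  mean (fun z => \sum_(j <- r | Q j) f j z) x = \sum_(j <- r | Q j) mean (f j) x.
Proof.
rewrite /mean -mulr_sumr; congr (_ * _); rewrite exchange_big/=.
by apply: eq_bigr => i _; rewrite -big_split.
Qed.

Lemma mean_cst (k : R) x : (0 < d)%N -> mean (fun=> k) x = k.
Proof.
move=> d0; rewrite /mean sumr_const card_ord -mulr2n -mulrnA mul2n -[k *+ _]mulr_natl.
by rewrite mulKf// pnatr_eq0 double_eq0 -lt0n.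
Qed.

(** Bounds are proved on partial sums, which obey the one-step identity [green_nS]; the value
    [green] is known to be their limit only once they are bounded, which is the hypothesis
    [transient]. *)
Definition green_n (N : nat) x y : R := \sum_(n < N) p n x y.

Lemma green_nS N x y :
  green_n N.+1 x y = (x == y)%:R + mean (fun z => green_n N z y) x.
Proof. by rewrite /green_n big_ord_recl/= -/(mean _ x) mean_sum. Qed.

Lemma green_n_ge0 N x y : 0 <= green_n N x y.
Proof. by apply: sumr_ge0 => n _; exact: srw_prob_ge0. Qed.

Lemma green_n_nondecreasing x y : nondecreasing_seq (fun N => green_n N x y).
Proof.
apply/nondecreasing_seqP => N; rewrite /green_n big_ord_recr/= lerDl.
exact: srw_prob_ge0.
Qed.

Lemma greenE x y : green R x y = limn (fun N => green_n N x y).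
Proof. by []. Qed.

Lemma green_sym x y : green R x y = green R y x.
Proof.
rewrite !greenE; congr (limn _); apply/funext => N.
by apply: eq_bigr => n _; exact: srw_prob_sym.
Qed.

Lemma green_translate x y z : green R (x + z) (y + z) = green R x y.
Proof.
rewrite !greenE; congr (limn _); apply/funext => N.
by apply: eq_bigr => n _; exact: srw_prob_translate.
Qed.

(** * First entrance decomposition and harmonic measure *)

Section transient.
Hypothesis transient : forall x y, exists B, forall N, green_n N x y <= B.

Lemma is_cvg_green_n x y : cvgn (fun N => green_n N x y).
Proof.
have [B hB] := transient x y; apply: nondecreasing_is_cvgn.
  exact: green_n_nondecreasing.
by exists B => _ [N _ <-].
Qed.

Lemma cvg_green_n x y : green_n N x y @[N --> \oo] --> green R x y.
Proof. exact: is_cvg_green_n. Qed.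

Lemma green_n_le x y N : green_n N x y <= green R x y.
Proof.
have := nondecreasing_cvgn_le (@green_n_nondecreasing x y) (@is_cvg_green_n x y) N.
exact.
Qed.

Lemma green_ge0 x y : 0 <= green R x y.
Proof. exact: le_trans (green_n_ge0 0 x y) (green_n_le x y 0). Qed.

Lemma green_le x y B : (forall N, green_n N x y <= B) -> green R x y <= B.
Proof.
by move=> hB; apply: limr_le; [exact: is_cvg_green_n|exact: nearW].
Qed.

Variable K : seq (pt d).
Hypothesis uK : uniq K.

(* the probability that the walk started at [y] enters [K] at time [n], at [x] *)
Fixpoint hit (n : nat) (y x : pt d) : R :=
  match n with
  | 0%N => ((y == x) && (y \in K))%:R
  | n'.+1 => if y \in K then 0 else mean (fun z => hit n' z x) y
  end.

Lemma hit_ge0 n y x : 0 <= hit n y x.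
Proof.
elim: n y => [|n IH] y //=; case: ifP => // _.
by rewrite mulr_ge0 ?invr_ge0//; apply: sumr_ge0 => i _; rewrite addr_ge0.
Qed.

Lemma sum_hit0 y (F : pt d -> R) : y \in K -> \sum_(z <- K) hit 0 y z * F z = F y.
Proof.
move=> yK; rewrite (bigD1_seq y)//= eqxx yK mul1r big1 ?addr0// => z zy.
by rewrite eq_sym (negbTE zy) mul0r.
Qed.

Lemma first_entrance n y x : x \in K ->
  p n y x = \sum_(m < n.+1) \sum_(z <- K) hit m y z * p (n - m) z x.
Proof.
move=> xK; elim: n y => [|n IH] y.
  rewrite big_ord1 subnn; case: (boolP (y \in K)) => yK; first by rewrite sum_hit0.
  rewrite /= big1 => [|z _]; last by rewrite (negbTE yK) andbF mul0r.
  by case: eqP => // yx; move: yK; rewrite yx xK.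
rewrite big_ord_recl subn0; case: (boolP (y \in K)) => yK.
  rewrite sum_hit0// (_ : \sum_(i < n.+1) _ = 0) ?addr0//.
  by rewrite big1// => m _; rewrite big1// => z _; rewrite /= yK mul0r.
rewrite (_ : \sum_(z <- K) hit 0 y z * _ = 0) ?add0r; last first.
  by rewrite big1// => z _; rewrite /= (negbTE yK) andbF mul0r.
rewrite srw_probS; under eq_fun => z do rewrite IH.
rewrite mean_sum; apply: eq_bigr => m _; rewrite mean_sum; apply: eq_bigr => z _.
by rewrite /= (negbTE yK) meanZr subSS.
Qed.

Definition hit_before M y x : R := \sum_(m < M) hit m y x.

Lemma hit_before_ge0 M y x : 0 <= hit_before M y x.
Proof. by apply: sumr_ge0 => m _; exact: hit_ge0. Qed.

Lemma hit_before_nondecreasing y x : nondecreasing_seq (fun M => hit_before M y x).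
Proof.
by apply/nondecreasing_seqP => N; rewrite /hit_before big_ord_recr/= lerDl hit_ge0.
Qed.

Lemma hit_before_sum_le1 M y : (0 < d)%N -> \sum_(x <- K) hit_before M y x <= 1.
Proof.
move=> d0; elim: M y => [|M IH] y.
  by rewrite big1// => x _; rewrite /hit_before big_ord0.
have E x : hit_before M.+1 y x = ((y == x) && (y \in K))%:R +
    if y \in K then 0 else mean (fun z => hit_before M z x) y.
  rewrite /hit_before big_ord_recl /=; congr (_ + _); rewrite mean_sum.
  by case: (y \in K) => //; rewrite big1.
under eq_bigr do rewrite E; case: (boolP (y \in K)) => yK.
  under eq_bigr do rewrite addr0 andbT.
  rewrite (bigD1_seq y)//= eqxx big1 ?addr0// => z zy.
  by rewrite eq_sym (negbTE zy).
under eq_bigr do rewrite andbF add0r.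
rewrite -mean_sum (le_trans (mean_le y (f' := fun=> 1) _))//.
by rewrite mean_cst.
Qed.

Lemma green_n_hit N y x : x \in K ->
  green_n N y x = \sum_(m < N) \sum_(z <- K) hit m y z * green_n (N - m) z x.
Proof.
move=> xK; elim: N => [|N IH]; first by rewrite /green_n !big_ord0.
rewrite /green_n big_ord_recr -/(green_n N y x) /= IH first_entrance//.
rewrite !big_ord_recr /= addrA -big_split /=; congr (_ + _); last first.
  by apply: eq_bigr => z _; rewrite subnn subSnn /green_n big_ord1.
apply: eq_bigr => m _; rewrite -big_split /=; apply: eq_bigr => z _.
rewrite -mulrDr; congr (_ * _).
by rewrite subSn ?(ltnW (ltn_ord m))// /green_n big_ord_recr.
Qed.

Hypothesis d0 : (0 < d)%N.

Lemma hit_before_le1 M y x : x \in K -> hit_before M y x <= 1.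
Proof.
move=> xK; apply: le_trans (hit_before_sum_le1 M y d0).
by rewrite (bigD1_seq x)//= lerDl sumr_ge0// => z _; exact: hit_before_ge0.
Qed.

Definition harm y x : R := limn (fun M => hit_before M y x).

Lemma is_cvg_hit_before y x : x \in K -> cvgn (fun M => hit_before M y x).
Proof.
move=> xK; apply: nondecreasing_is_cvgn; first exact: hit_before_nondecreasing.
by exists 1 => _ [N _ <-]; exact: hit_before_le1.
Qed.

Lemma hit_before_le_harm M y x : x \in K -> hit_before M y x <= harm y x.
Proof.
move=> xK.
have := nondecreasing_cvgn_le (@hit_before_nondecreasing y x) (@is_cvg_hit_before y x xK) M.
exact.
Qed.

Lemma harm_ge0 y x : x \in K -> 0 <= harm y x.
Proof. move=> xK; exact: le_trans (hit_before_ge0 0 y x) (hit_before_le_harm 0 y xK). Qed.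

Lemma harm_sum_le1 y : \sum_(x <- K) harm y x <= 1.
Proof.
have h : \sum_(x <- K) hit_before M y x @[M --> \oo] --> \sum_(x <- K) harm y x.
  by apply: cvg_sum_seq => x xK; exact: is_cvg_hit_before.
rewrite -(cvg_lim (@Rhausdorff R) h); apply: limr_le.
  by apply/cvg_ex; eexists; exact: h.
by apply: nearW => M; exact: hit_before_sum_le1.
Qed.

(** The strong Markov property at the entrance into K, as a limit of [green_n_hit]. It says that
    averaging the field against [harm y] reproduces its covariances with the points of K. *)
Lemma harm_green y x : x \in K -> \sum_(z <- K) harm y z * green R z x = green R y x.
Proof.
move=> xK; apply/eqP; rewrite eq_le; apply/andP; split; last first.
  apply: green_le => N; rewrite green_n_hit//.
  rewrite (@le_trans _ _ (\sum_(m < N) \sum_(z <- K) hit m y z * green R z x))//.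
    apply: ler_sum => m _; apply: ler_sum => z _.
    by rewrite ler_wpM2l ?hit_ge0// green_n_le.
  rewrite exchange_big /= big_seq [leRHS]big_seq; apply: ler_sum => z zK.
  by rewrite -mulr_suml ler_wpM2r ?green_ge0// hit_before_le_harm.
(* Among M + k steps only entrances before time M are kept, so at least k steps remain; k tends to
   infinity before M does. *)
have h1 M : \sum_(z <- K) hit_before M y z * green R z x <= green R y x.
  have h : \sum_(z <- K) hit_before M y z * green_n k z x @[k --> \oo] -->
      \sum_(z <- K) hit_before M y z * green R z x.
    by apply: cvg_sum_seq => z zK; apply: cvgM; [exact: cvg_cst|exact: cvg_green_n].
  rewrite -(cvg_lim (@Rhausdorff R) h); apply: limr_le.
    by apply/cvg_ex; eexists; exact: h.
  apply: nearW => k; rewrite (le_trans _ (green_n_le y x (M + k)))//.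
  rewrite green_n_hit// big_split_ord /= ler_wpDr//.
    by apply: sumr_ge0 => m _; apply: sumr_ge0 => z _; rewrite mulr_ge0 ?hit_ge0 ?green_n_ge0.
  rewrite exchange_big /=; apply: ler_sum => z _; rewrite mulr_suml.
  apply: ler_sum => m _; rewrite ler_wpM2l ?hit_ge0//.
  by apply: green_n_nondecreasing; rewrite -addnBAC ?leq_addl// ltnW.
have h : \sum_(z <- K) hit_before M y z * green R z x @[M --> \oo] -->
    \sum_(z <- K) harm y z * green R z x.
  by apply: cvg_sum_seq => z zK; apply: cvgM; [exact: is_cvg_hit_before|exact: cvg_cst].
rewrite -(cvg_lim (@Rhausdorff R) h); apply: limr_le.
  by apply/cvg_ex; eexists; exact: h.
exact: nearW.
Qed.

Lemma harm_green_le y s : (forall x, x \in K -> green R y x <= s) -> 0 <= s ->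
  \sum_(x <- K) harm y x * green R y x <= s.
Proof.
move=> gs s0; rewrite (@le_trans _ _ (\sum_(x <- K) harm y x * s))//.
  rewrite big_seq [leRHS]big_seq; apply: ler_sum => x xK.
  by rewrite ler_wpM2l ?harm_ge0// gs.
by rewrite -mulr_suml ler_piMl// harm_sum_le1.
Qed.

End transient.

End walk.

(** * A superharmonic function that dominates the Green function *)

Section lyapunov.
Context {R : realType}.

Lemma expr_inv_bound (s : nat) : exists2 C : R, 0 <= C & forall t : R, `|t| <= 2^-1 ->
  (1 + t)^-1 ^+ s <= 1 - s%:R * t + C * t ^+ 2.
Proof.
elim: s => [|s [C C0 hC]].
  by exists 0 => // t _; rewrite expr0 mul0r mul0r subr0 addr0.
exists (2 * C + 2 * s%:R + 2) => [|t t2]; first by rewrite !addr_ge0 ?mulr_ge0.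
have := hC t t2; move: t2; rewrite ler_norml => /andP[t1 t2] hs.
have t0 : 0 < 1 + t by lra.
have inv : (1 + t)^-1 <= 1 - t + 2 * t ^+ 2.
  rewrite -div1r ler_pdivrMr//.
  have : 0 <= t ^+ 2 * (1 + 2 * t) by rewrite mulr_ge0 ?sqr_ge0//; lra.
  by lra.
rewrite exprS.
have h1 : 0 <= (1 + t)^-1 by rewrite invr_ge0 ltW.
have h2 : 0 <= (1 + t)^-1 ^+ s by rewrite exprn_ge0.
have h3 : 0 <= 1 - s%:R * t + C * t ^+ 2 by apply: le_trans hs.
have h4 : (1 + t)^-1 * (1 + t)^-1 ^+ s <=
    (1 - t + 2 * t ^+ 2) * (1 - s%:R * t + C * t ^+ 2).
  by apply: ler_pM.
apply: (le_trans h4); rewrite -natr1; set S := s%:R.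
have S0 : 0 <= S :> R by rewrite ler0n.
have q0 : 0 <= t ^+ 2 by rewrite sqr_ge0.
have q1 : 0 <= t ^+ 2 * (2^-1 + t) by rewrite mulr_ge0//; lra.
have q2 : t ^+ 2 * t ^+ 2 <= t ^+ 2 * 4^-1.
  rewrite ler_wpM2l//.
  have : 0 <= (2^-1 - t) * (2^-1 + t) by rewrite mulr_ge0//; lra.
  by lra.
have q3 : 0 <= (C + 2 * S) * (t ^+ 2 * (2^-1 + t)).
  by rewrite mulr_ge0// addr_ge0// mulr_ge0.
have q4 : C * (t ^+ 2 * t ^+ 2) <= C * (t ^+ 2 * 4^-1) by rewrite ler_wpM2l.
have q5 : 0 <= C * t ^+ 2 by rewrite mulr_ge0.
have q6 : 0 <= S * t ^+ 2 by rewrite mulr_ge0.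
by lra.
Qed.

Context {d : nat}.
Implicit Types x y : pt d.

Definition sqnorm x : R := \sum_(i < d) ((x i)%:~R : R) ^+ 2.
(** Adding d keeps the relative change of the radius in one step at most 1/2, even near the origin,
    as soon as d >= 6. *)
Definition radius x : R := d%:R + sqnorm x.

Lemma sqnorm_ge0 x : 0 <= sqnorm x.
Proof. by apply: sumr_ge0 => i _; rewrite sqr_ge0. Qed.

Lemma sqnorm_coord x i : ((x i)%:~R : R) ^+ 2 <= sqnorm x.
Proof. by rewrite /sqnorm (bigD1 i)//= lerDl sumr_ge0// => j _; rewrite sqr_ge0. Qed.

Lemma sqnorm_shift x i s :
  sqnorm (Defs.shift x i s) = sqnorm x + 2 * s%:~R * (x i)%:~R + s%:~R ^+ 2.
Proof.
rewrite /sqnorm (bigD1 i)//= [X in _ = X + _ + _](bigD1 i)//=.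
rewrite ffunE eqxx intrD sqrrD.
rewrite (eq_bigr (fun j => ((x j)%:~R : R) ^+ 2)) => [|j ji]; last first.
  by rewrite ffunE (negbTE ji) addr0.
set S := \sum_(_ < _ | _) _; rewrite mulr2n; ring.
Qed.

(** With r the radius, its relative increments over the 2d steps average to 1/r and their squares to
    at most 4 / (d r). If d >= 10 C, the second-order loss is therefore less than half of the
    first-order gain s / r. *)
Lemma radius_mean_bound (s : nat) (C : R) x : (0 < s)%N -> 0 <= C ->
  (forall t : R, `|t| <= 2^-1 -> (1 + t)^-1 ^+ s <= 1 - s%:R * t + C * t ^+ 2) ->
  (6 <= d)%N -> 10 * C <= d%:R ->
  mean (fun z => (radius z)^-1 ^+ s) x <=
  (radius x)^-1 ^+ s * (1 - s%:R / (2 * radius x)).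
Proof.
move=> s0 C0 hC d6 dC; set r := radius x.
have d6R : 6 <= d%:R :> R by rewrite (ler_nat R 6 d).
have dr : d%:R <= r by rewrite lerDl sqnorm_ge0.
have r0 : 0 < r by lra.
have d0 : 0 < d%:R :> R by lra.
have pw (e : R) (i : 'I_d) : e ^+ 2 = 1 ->
    (r + 1 + 2 * e * (x i)%:~R)^-1 ^+ s <= r^-1 ^+ s *
      (1 - s%:R * ((1 + 2 * e * (x i)%:~R) / r) +
       C * ((1 + 2 * e * (x i)%:~R) / r) ^+ 2).
  move=> e1; set a := (x i)%:~R : R; set t := (1 + 2 * e * a) / r.
  have -> : r + 1 + 2 * e * a = r * (1 + t) by rewrite /t; field; rewrite gt_eqF.
  rewrite invfM exprMn ler_wpM2l ?exprn_ge0 ?invr_ge0 ?(ltW r0)//; apply: hC.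
  have ra : d%:R + a ^+ 2 <= r by rewrite lerD2l sqnorm_coord.
  rewrite /t normrM normfV (ger0_norm (ltW r0)) ler_pdivrMr// ler_norml.
  have e2 : (e * a) ^+ 2 = a ^+ 2 by rewrite exprMn e1 mul1r.
  have := sqr_ge0 (e * a - 2); have := sqr_ge0 (e * a + 2).
  move=> *; apply/andP; split; lra.
rewrite /mean.
apply: (@le_trans _ _ ((d.*2)%:R^-1 * \sum_(i < d) (r^-1 ^+ s *
   (2 * (1 - s%:R / r) + C * (2 + 8 * ((x i)%:~R : R) ^+ 2) / r ^+ 2)))).
  rewrite ler_wpM2l ?invr_ge0//; apply: ler_sum => i _.
  have := pw 1 i (expr1n _ _); have := pw (-1) i; rewrite sqrrN expr1n => /(_ erefl).
  rewrite /radius !sqnorm_shift.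
  rewrite (_ : d%:R + (sqnorm x + 2 * 1%:~R * (x i)%:~R + 1%:~R ^+ 2) =
     r + 1 + 2 * 1 * (x i)%:~R); last by rewrite /r /radius; ring.
  rewrite (_ : d%:R + (sqnorm x + 2 * (-1)%:~R * (x i)%:~R + (-1)%:~R ^+ 2) =
     r + 1 + 2 * -1 * (x i)%:~R); last by rewrite /r /radius; ring.
  move=> h1 h2; apply: (le_trans (lerD h2 h1)); rewrite -mulrDr.
  rewrite le_eqVlt; apply/orP; left; apply/eqP; congr (_ * _).
  by field; rewrite gt_eqF.
rewrite -mulr_sumr mulrCA ler_wpM2l ?exprn_ge0 ?invr_ge0 ?(ltW r0)//.
rewrite big_split /= sumr_const card_ord -mulr_suml -mulr_sumr big_split /=.
rewrite sumr_const card_ord -mulr_sumr -/(sqnorm x).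
rewrite -[_ *+ d]mulr_natl -[2 *+ d]mulr_natl -muln2 natrM.
have sx : sqnorm x = r - d%:R by rewrite /r /radius addrC addKr.
rewrite sx [leLHS](_ : _ = 1 - s%:R / r + C * (8 * r - 6 * d%:R) / (2 * d%:R * r ^+ 2)); last first.
  by field; rewrite !gt_eqF.
rewrite -addrA lerD2l -subr_ge0.
rewrite [leRHS](_ : _ =
  (s%:R * d%:R * r - C * (8 * r - 6 * d%:R)) / (2 * d%:R * r ^+ 2)); last first.
  by field; rewrite !gt_eqF.
have s1 : 1 <= s%:R :> R by rewrite (ler_nat R 1 s).
apply: divr_ge0; last by rewrite !mulr_ge0 ?exprn_ge0 ?ltW.
have h1 : 1 * (d%:R * r) <= s%:R * (d%:R * r) by rewrite ler_wpM2r// mulr_ge0// ltW.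
have h2 : 10 * C * r <= d%:R * r by rewrite ler_wpM2r// ltW.
have h3 : 0 <= C * r by rewrite mulr_ge0// ltW.
have h4 : 0 <= C * d%:R by rewrite mulr_ge0// ltW.
by lra.
Qed.

End lyapunov.

(** Comparison principle: [V] is superharmonic and drops by at least [kap] at the origin, so by
    induction on N the function [V (x - y) / kap] dominates the partial Green sums. *)
Lemma green_n_bound {R : realType} (s : nat) : (0 < s)%N ->
  exists d0 : nat, forall d, (d0 <= d)%N -> forall (x y : pt d) N,
    @green_n R d N x y <= 2 * d%:R / s%:R * (d%:R / (d%:R + @sqnorm R d (x - y))) ^+ s.
Proof.
move=> s0; have [C C0 hC] := @expr_inv_bound R s.
exists (maxn 6 (Num.truncn (10 * C)).+1) => d; rewrite geq_max => /andP[d6 dC] x y N.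
have {}dC : 10 * C <= d%:R.
  by rewrite ltW// (lt_le_trans (truncnS_gt _))// ler_nat.
have dR : 0 < d%:R :> R by rewrite ltr0n (leq_trans _ d6).
have sR : 0 < s%:R :> R by rewrite ltr0n.
pose V (z : pt d) := (@radius R d z)^-1 ^+ s.
pose kap : R := d%:R^-1 ^+ s * (s%:R / (2 * d%:R)).
have kap0 : 0 < kap by rewrite mulr_gt0 ?exprn_gt0 ?invr_gt0// divr_gt0// mulr_gt0.
have radius_gt0 z : 0 < @radius R d z by rewrite ltr_wpDr// sqnorm_ge0.
have V0 z : 0 <= V z by rewrite exprn_ge0// invr_ge0 ltW.
suff : @green_n R d N x y <= V (x - y) / kap.
  move=> h; apply: (le_trans h); rewrite le_eqVlt; apply/orP; left; apply/eqP.
  have r0 := radius_gt0 (x - y).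
  rewrite /V /kap -/(radius _) exprMn !exprVn; set r := radius _ in r0 *.
  by field; rewrite ?expf_neq0 ?(gt_eqF r0) ?(gt_eqF dR) ?(gt_eqF sR).
elim: N x => [|N IH] x; first by rewrite /green_n big_ord0 mulr_ge0// invr_ge0 ltW.
rewrite green_nS.
apply: (@le_trans _ _ ((x == y)%:R + mean (fun z => V (z - y) / kap) x)).
  by rewrite lerD2l; exact: mean_le.
rewrite meanZr.
have -> : mean (fun z => V (z - y)) x = mean V (x - y).
  rewrite /mean; congr (_ * _); apply: eq_bigr => i _; rewrite !shiftE.
  by rewrite ![x - y + _]addrAC.
have hm := radius_mean_bound (x - y) s0 C0 hC d6 dC.
rewrite ler_pdivlMr// mulrDl mulfVK ?gt_eqF//.
apply: (le_trans (lerD (lexx _) hm)); rewrite -/(V _) mulrBr mulr1 addrCA gerDl.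
case: eqP => [->|_]; last first.
  by rewrite mul0r add0r oppr_le0 mulr_ge0// divr_ge0 ?ltW// mulr_gt0.
by rewrite mul1r subrr /V /radius /sqnorm big1 ?addr0 ?subrr// => i _; rewrite ffunE expr0n.
Qed.
(** * Paths and planar duality *)

Section reach.
Context {T : Type}.
Implicit Types (e : T -> T -> Prop) (A B : T -> Prop).

(** One notion of path for the lattice, the quadrant and the star graph; all visited points, both
    ends included, satisfy [A]. *)
Inductive reach e A (x : T) : T -> Prop :=
| reach0 : A x -> reach e A x x
| reachS y z : reach e A x y -> e y z -> A z -> reach e A x z.

Lemma reach_sub e A B x y : (forall z, A z -> B z) -> reach e A x y -> reach e B x y.
Proof.
move=> AB; elim=> [Ax|u z _ IH uz Az]; first by apply: reach0; exact: AB.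
by apply: (reachS IH uz); exact: AB.
Qed.

Lemma reach_trans e A x y z : reach e A x y -> reach e A y z -> reach e A x z.
Proof. by move=> xy; elim=> // u v _ xu uv Av; exact: reachS xu uv Av. Qed.

Lemma reach_end e A x y : reach e A x y -> A y.
Proof. by case. Qed.

Lemma reach_start e A x y : reach e A x y -> A x.
Proof. by elim. Qed.

Lemma reach_sym e A x y : (forall u v, e u v -> e v u) ->
  reach e A x y -> reach e A y x.
Proof.
move=> eS; elim=> [|u z xu IH uz Az]; first exact: reach0.
apply: reach_trans IH; apply: (reachS (reach0 _ Az) (eS _ _ uz)).
exact: reach_end xu.
Qed.

(** Since [f] grows by at most 1 per step, the path cannot jump over the value L and is stopped when
    it first takes it. *)
Lemma reach_truncate e A (f : T -> nat) (L : nat) x y :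
  (forall u v, e u v -> (f v <= (f u).+1)%N) -> (f x <= L)%N -> (L <= f y)%N ->
  reach e A x y ->
  exists2 z, f z = L & reach e (fun w => A w /\ (f w <= L)%N) x z.
Proof.
move=> ef fx fy xy.
suff [[]|//] : ((f y <= L)%N /\ reach e (fun w => A w /\ (f w <= L)%N) x y) \/
    exists2 z, f z = L & reach e (fun w => A w /\ (f w <= L)%N) x z.
  by move=> yL r; exists y => //; apply/eqP; rewrite eqn_leq yL.
elim: xy => [Ax|u z _ [[uL IH]|?] uz Az]; last by right.
  by left; split => //; apply: reach0.
have := uL; rewrite leq_eqVlt => /orP[/eqP uL'|uL']; first by right; exists u.
have zL : (f z <= L)%N by apply: leq_trans (ef _ _ uz) uL'.
by left; split => //; exact: (reachS IH uz).
Qed.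

End reach.

Lemma path_inP d (A : set (pt d)) x y : path_in A x y <-> reach (@adj d) A x y.
Proof.
split.
  move=> [s [sA [sadj <-]]].
  elim: s x sA sadj => [|a s IH] x sA sadj /=.
    by apply: reach0; apply: sA; rewrite mem_head.
  have Ax : A x by apply: sA; rewrite mem_head.
  have xa := sadj 0%N isT; rewrite /= in xa.
  apply: (@reach_trans _ _ _ _ a).
    apply: (reachS (reach0 _ Ax) xa).
    by apply: sA; rewrite !inE eqxx orbT.
  apply: IH => [z zs|k ks]; first by apply: sA; rewrite inE zs orbT.
  have := sadj k.+1 ks; rewrite /= (set_nth_default a)//; last by rewrite /= ltnS ltnW.
  by rewrite (set_nth_default a x).
elim=> [Ax|u z _ [s [sA [sadj sl]]] uz Az].
  by exists [::]; split => // z; rewrite inE => /eqP ->.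
exists (rcons s z); split; [|split].
- move=> v; rewrite -rcons_cons mem_rcons inE => /predU1P[->//|]; exact: sA.
- move=> k; rewrite size_rcons ltnS leq_eqVlt => /predU1P[->|ks].
    rewrite nth_rcons ltnn eqxx -rcons_cons nth_rcons /= ltnSn.
    by rewrite -last_nth sl.
  rewrite nth_rcons ks -rcons_cons nth_rcons /= ltnS (ltnW ks).
  exact: sadj.
- by rewrite last_rcons.
Qed.

(** * Planar duality in the quadrant *)

Section quadrant.

Definition quad_adj (u v : nat * nat) : Prop :=
  (u.1 = v.1 /\ (v.2 = u.2.+1 \/ u.2 = v.2.+1)) \/
  (u.2 = v.2 /\ (v.1 = u.1.+1 \/ u.1 = v.1.+1)).

Definition quad_star (u v : nat * nat) : Prop :=
  [/\ (u.1 <= v.1.+1)%N, (v.1 <= u.1.+1)%N, (u.2 <= v.2.+1)%N & (v.2 <= u.2.+1)%N].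

(* If the cluster [S] of the origin is finite, let [A] be the part of its
   boundary that is star-connected to the horizontal axis.  The 1-cochain [flow],
   which is the coboundary of [S] near [A] and 0 elsewhere, is closed, whereas its
   circulation along the boundary of a large square would be -1 if [A] did not
   meet the vertical axis. *)
Lemma quadrant_duality (bad : nat * nat -> Prop) (N : nat) :
  (exists2 v, reach quad_adj (fun z => ~ bad z) (0, 0)%N v & (N <= maxn v.1 v.2)%N) \/
  (exists m k, (m <= N)%N /\ reach quad_star bad (m, 0)%N (0, k)%N).
Proof.
have [|nfar] := pselect (exists2 v,
  reach quad_adj (fun z => ~ bad z) (0, 0)%N v & (N <= maxn v.1 v.2)%N); first by left.
right; apply: contrapT => nopath.
pose S v : bool := `[< reach quad_adj (fun z => ~ bad z) (0, 0)%N v >].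
pose A v : bool := `[< exists2 m, (m <= N)%N & reach quad_star bad (m, 0)%N v >].
have S0 : S (0, 0)%N.
  apply/asboolP; apply: reach0 => b0; apply: nopath; exists 0%N, 0%N.
  by split => //; exact: reach0.
have Sfar v : (N <= maxn v.1 v.2)%N -> S v = false.
  by move=> vN; apply/asboolP => Sv; apply: nfar; exists v.
have A0 k : A (0%N, k) = false.
  by apply/asboolP => -[m mN r]; apply: nopath; exists m, k.
have Sgood v : S v -> ~ bad v by move=> /asboolP; exact: reach_end.
have bdry u v : quad_adj u v -> S u -> S v = false -> bad v.
  move=> uv /asboolP ru /asboolP nv; apply: contrapT => gv; apply: nv.
  exact: (reachS ru uv).
have Astar u v : A u -> quad_star u v -> bad v -> A v.
  by move=> /asboolP[m mN r] uv bv; apply/asboolP; exists m => //; exact: (reachS r uv).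
pose flow u v : int := if A u || A v then (S v)%:Z - (S u)%:Z else 0.
(* If S changes along an edge near a point p of A, the end outside S is bad and star-adjacent to p,
   hence in A; so near A the flow is the full coboundary of S. *)
have flow_near p u v : A p -> quad_star p u -> quad_star p v -> quad_adj u v ->
    quad_adj v u -> flow u v = (S v)%:Z - (S u)%:Z.
  move=> Ap pu pv uv vu; rewrite /flow; case: ifP => //.
  case Su : (S u); case Sv : (S v) => //.
    by rewrite (Astar p v Ap pv (bdry _ _ uv Su Sv)) orbT.
  by rewrite (Astar p u Ap pu (bdry _ _ vu Sv Su)).
have closed i j : flow (i, j) (i.+1, j) - flow (i, j.+1) (i.+1, j.+1) =
    flow (i, j) (i, j.+1) - flow (i.+1, j) (i.+1, j.+1).
  case AA : [|| A (i, j), A (i.+1, j), A (i, j.+1) | A (i.+1, j.+1)]; last first.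
    by move: AA; rewrite /flow; do 4 case: (A _).
  have [p Ap [pi pj]] : exists2 p, A p & (p.1 = i \/ p.1 = i.+1) /\ (p.2 = j \/ p.2 = j.+1).
    by case/or4P: AA => ?; [exists (i, j)|exists (i.+1, j)|exists (i, j.+1)|exists (i.+1, j.+1)];
      rewrite //=; split; auto.
  by rewrite !(flow_near p)//; [ring|..];
    rewrite /quad_adj /quad_star /=; try split; lia.
have zero_flow u v : S u = false -> S v = false -> flow u v = 0.
  by rewrite /flow => -> ->; case: ifP.
have bottom i : (i < N)%N ->
    flow (i, 0)%N (i.+1, 0)%N = (S (i.+1, 0)%N)%:Z - (S (i, 0)%N)%:Z.
  move=> iN.
  have Aax m : (m <= N)%N -> bad (m, 0)%N -> A (m, 0)%N.
    by move=> mN bm; apply/asboolP; exists m => //; exact: reach0.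
  rewrite /flow; case: ifP => //.
  case Su : (S (i, 0)%N); case Sv : (S (i.+1, 0)%N) => //.
    rewrite (Aax i.+1 iN) ?orbT//; apply: bdry Su Sv.
    by rewrite /quad_adj /=; lia.
  rewrite (Aax i (ltnW iN))//; apply: bdry Sv Su.
  by rewrite /quad_adj /=; lia.
(* Closedness summed over the square, then telescoped. The top and right sides carry no flow because
   S vanishes there, the left side because A misses the vertical axis; the bottom gives S(N, 0) -
   S(0, 0) = -1. *)
have H : \sum_(0 <= i < N) \sum_(0 <= j < N)
      (flow (i, j) (i.+1, j) - flow (i, j.+1) (i.+1, j.+1)) =
    \sum_(0 <= j < N) \sum_(0 <= i < N)
      (flow (i, j) (i, j.+1) - flow (i.+1, j) (i.+1, j.+1)).
  rewrite exchange_big /=; apply: eq_bigr => i _; apply: eq_bigr => j _.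
  exact: closed.
have tele (f : nat -> int) : \sum_(0 <= j < N) (f j - f j.+1) = f 0%N - f N.
  rewrite -[RHS]opprB -telescope_sumr// -sumrN; apply: eq_bigr => j _.
  by rewrite opprB.
move: H; under eq_bigr do rewrite (tele (fun j => flow (_, j) (_, j))).
under [in RHS]eq_bigr do rewrite (tele (fun i => flow (i, _) (i, _))).
rewrite [RHS]big1 => [|j _]; last first.
  rewrite {1}/flow !A0 zero_flow ?subr0//; apply: Sfar => /=; exact: leq_maxl.
rewrite big_nat_cond (eq_bigr (fun i => (S (i.+1, 0)%N)%:Z - (S (i, 0)%N)%:Z)); last first.
  move=> i; rewrite andbT => /andP[_ iN]; rewrite bottom//.
  by rewrite [X in _ - X]zero_flow ?subr0//; apply: Sfar => /=; exact: leq_maxr.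
rewrite -big_nat_cond telescope_sumr// (Sfar (N, 0)%N) ?leq_maxl//.
by rewrite S0.
Qed.

End quadrant.

Lemma reach_map (T T' : Type) (e : T -> T -> Prop) (e' : T' -> T' -> Prop)
    (A : T -> Prop) (B : T' -> Prop) (f : T -> T') x y :
  (forall u v, e u v -> e' (f u) (f v)) -> (forall z, A z -> B (f z)) ->
  reach e A x y -> reach e' B (f x) (f y).
Proof.
move=> ee AB; elim=> [Ax|u z _ IH uz Az]; first by apply: reach0; exact: AB.
by apply: (reachS IH); [exact: ee|exact: AB].
Qed.

(** * Good vertices and bad arms *)

Section good_vertices.
Context (R : realType) {d : nat}.
Implicit Types (E : set (pt d)) (x u v : int * int).

Lemma l1distC (y z : pt d) : l1dist y z = l1dist z y.
Proof. by apply: eq_bigr => i _; rewrite distnC. Qed.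

Lemma l1dist_triangle (y z w : pt d) : (l1dist y w <= l1dist y z + l1dist z w)%N.
Proof. by rewrite /l1dist -big_split /=; apply: leq_sum => i _; exact: leqD_dist. Qed.

Lemma adj_sym (y z : pt d) : adj y z -> adj z y.
Proof. by rewrite /adj l1distC. Qed.

Lemma path_in_trans (A : set (pt d)) y z w : path_in A y z -> path_in A z w -> path_in A y w.
Proof. by move=> /path_inP h1 /path_inP h2; apply/path_inP; exact: reach_trans h1 h2. Qed.

Lemma path_in_sym (A : set (pt d)) y z : path_in A y z -> path_in A z y.
Proof. by move=> /path_inP h; apply/path_inP; apply: reach_sym h; exact: adj_sym. Qed.

Lemma path_in_sub (A B : set (pt d)) y z : A `<=` B -> path_in A y z -> path_in B y z.
Proof. by move=> AB /path_inP h; apply/path_inP; exact: reach_sub h. Qed.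

Lemma path_in_refl (A : set (pt d)) y : A y -> path_in A y y.
Proof. by move=> Ay; apply/path_inP; exact: reach0. Qed.

Lemma path_in_end (A : set (pt d)) y z : path_in A y z -> A z.
Proof. by move=> /path_inP; exact: reach_end. Qed.

Definition comp (A : set (pt d)) (c : pt d) : set (pt d) := [set y | path_in A c y].

Definition closure_set x (C : set (pt d)) : {set {ffun 'I_d -> bool}} :=
  finset (fun b => `[< box_closure x C (box_pt x b) >]).

Lemma closure_setE x (C : set (pt d)) :
  #|[set b : {ffun 'I_d -> bool} | `[< box_closure x C (@box_pt d x b) >]]| =
  #|closure_set x C|.
Proof.
apply: eq_card => b; rewrite finset.inE; apply/idP/idP.
  by move=> /set_mem.
by move=> h; apply/mem_set.
Qed.

Definition large x (C : set (pt d)) : Prop :=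
  (#|closure_set x C|%:R : R) >= (1 - (d%:R ^- 2)) * (#|{ffun 'I_d -> bool}|%:R).

Lemma large_sub x x' (C C' : set (pt d)) :
  (forall b, box_closure x C (box_pt x b) -> box_closure x' C' (box_pt x' b)) ->
  large x C -> large x' C'.
Proof.
move=> CC'; rewrite /large => h; apply: (le_trans h); rewrite ler_nat.
apply: subset_leq_card; apply/fintype.subsetP => b; rewrite !finset.inE => /asboolP h1.
by apply/asboolP; exact: CC'.
Qed.

Definition nearby x : set (pt d) :=
  [set w | exists x0, (l1dist2 x0 x <= 1)%N /\ @box d x0 w].

(* an increasing reformulation of [G_event], with a point of each component in
   place of the component itself *)
Definition good E x : Prop :=
  exists c : int * int -> pt d,
    (forall x', (l1dist2 x' x <= 1)%N ->
      (@box d x' `&` E) (c x') /\ large x' (comp (@box d x' `&` E) (c x'))) /\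
    (forall x' x'', (l1dist2 x' x <= 1)%N -> (l1dist2 x'' x <= 1)%N ->
      path_in (E `&` nearby x) (c x') (c x'')).

Lemma G_eventE (h : R) x (phi : pt d -> R) :
  G_event h x phi <-> good (level_set phi h) x.
Proof.
set E := level_set phi h; split.
  move=> [C [hC hconn]].
  have : forall x', exists c0, (l1dist2 x' x <= 1)%N ->
      (@box d x' `&` E) c0 /\ C x' = comp (@box d x' `&` E) c0.
    move=> x'; have [n|] := pselect (l1dist2 x' x <= 1)%N; last by exists (@origin d).
    by have [_ [[c0 [Ac0 Cc0]] _]] := hC x' n; exists c0.
  move=> /choice[c hc]; exists c; split.
    move=> x' n; have [Ac Cc] := hc x' n; split => //; rewrite -Cc.
    by have [_ [_]] := hC x' n; rewrite closure_setE.
  move=> x' x'' n' n''.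
  have sub y z : (l1dist2 z x <= 1)%N -> C z y -> path_in (E `&` nearby x) (c z) y.
    move=> nz; have [_ ->] := hc z nz; apply: path_in_sub => w [bw Ew].
    by split => //; exists z.
  have [y [z [Cy [Cz yz]]]] := hconn x' x'' n' n''.
  apply: path_in_trans (sub _ _ n' Cy) _; apply: (path_in_trans yz).
  by apply: path_in_sym; exact: sub.
move=> [c [hc hconn]].
exists (fun x' => comp (@box d x' `&` E) (c x')); split.
  move=> x' n; have [Ac lc] := hc x' n; split; first by move=> y /path_in_end.
  by split; [exists (c x')|rewrite closure_setE].
move=> x' x'' n' n''; exists (c x'), (c x''); split; [|split; last exact: hconn].
  by apply: path_in_refl; have [] := hc x' n'.
by apply: path_in_refl; have [] := hc x'' n''.
Qed.

Lemma box_closure_sub x (C C' : set (pt d)) y : C `<=` C' ->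
  box_closure x C y -> box_closure x C' y.
Proof.
move=> CC' [by_ h]; split => //; case: h => [Cy|[c [Cc cy]]]; first by left; exact: CC'.
by right; exists c; split => //; exact: CC'.
Qed.

Lemma good_on E E' x :
  (forall y, nearby x y -> E y -> E' y) -> good E x -> good E' x.
Proof.
move=> EE' [c [hc hconn]]; exists c; split.
  move=> x' n; have [[bc Ec] lc] := hc x' n.
  have bsub : @box d x' `&` E `<=` @box d x' `&` E'.
    by move=> y [yb yE]; split => //; apply: EE' => //; exists x'.
  split; first exact: bsub.
  apply: large_sub lc => b; apply: box_closure_sub => y; exact: path_in_sub.
move=> x' x'' n' n''; apply: path_in_sub (hconn _ _ n' n'') => y [Ey ny].
by split => //; exact: EE'.
Qed.

Lemma good_increasing E E' x : E `<=` E' -> good E x -> good E' x.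
Proof. by move=> EE'; apply: good_on => y _; exact: EE'. Qed.

Definition lift2 x : pt d := [ffun i => 2 * embed2 d x i].

Lemma box_ptD x t b : box_pt (x + t) b = box_pt x b + lift2 t.
Proof.
apply/ffunP => i; rewrite !ffunE /=; case: ifP => _; first by ring.
by case: ifP => _; ring.
Qed.

Lemma l1dist_translate (y z w : pt d) : l1dist (y + w) (z + w) = l1dist y z.
Proof.
by apply: eq_bigr => i _; rewrite !ffunE; congr `|_|%N; ring.
Qed.

Lemma l1dist2_translate (y z w : int * int) : l1dist2 (y + w) (z + w) = l1dist2 y z.
Proof. by rewrite /l1dist2 /=; congr (`|_| + `|_|)%N; ring. Qed.

Lemma box_translate x t y : @box d (x + t) y -> @box d x (y - lift2 t).
Proof. by move=> [b _ <-]; exists b => //; rewrite box_ptD addrK. Qed.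

Lemma path_in_translate (A B : set (pt d)) (w y z : pt d) :
  (forall u : pt d, A u -> B (u - w)) -> path_in A y z -> path_in B (y - w) (z - w).
Proof.
move=> AB /path_inP h; apply/path_inP; apply: (reach_map _ AB) h => u v.
by rewrite /adj l1dist_translate.
Qed.

Lemma good_translate_imp E x t : good E x -> good [set z | E (z + lift2 t)] (x - t).
Proof.
move=> [c [hc hconn]]; exists (fun x' => c (x' + t) - lift2 t).
have nt x' : (l1dist2 x' (x - t)%R <= 1)%N -> (l1dist2 (x' + t)%R x <= 1)%N.
  by rewrite -(l1dist2_translate _ _ t) subrK.
split.
  move=> x' n; have [[bc Ec] lc] := hc _ (nt _ n).
  have sub (u : pt d) : (@box d (x' + t) `&` E) u ->
      (@box d x' `&` [set z | E (z + lift2 t)]) (u - lift2 t).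
    by move=> [bu Eu]; split; [exact: box_translate|rewrite /= subrK].
  split; first exact: sub.
  apply: large_sub lc => b [bb h]; split; first by exists b.
  case: h => [h|[a [ha ab]]].
    by left; have := path_in_translate sub h; rewrite box_ptD addrK.
  right; exists (a - lift2 t); split; first exact: path_in_translate ha.
  by rewrite /adj -(l1dist_translate _ _ (lift2 t)) subrK -box_ptD.
move=> x' x'' n' n''; apply: path_in_translate (hconn _ _ (nt _ n') (nt _ n'')).
move=> u [Eu [x0 [n0 b0]]]; split; first by rewrite /= subrK.
exists (x0 - t); split; first by rewrite l1dist2_translate.
by apply: box_translate; rewrite subrK.
Qed.

Lemma good_translate E x : good E x <-> good [set z | E (z + lift2 x)] 0.
Proof.
split; first by move=> /(@good_translate_imp _ _ x); rewrite subrr.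
move=> /(@good_translate_imp _ _ (- x)); rewrite sub0r opprK.
apply: good_increasing => z /=.
have -> : z + lift2 (- x) + lift2 x = z.
  apply/ffunP => i; rewrite !ffunE /=; case: ifP => _; first by ring.
  by case: ifP => _; ring.
by [].
Qed.

Definition flip (b : {ffun 'I_d -> bool}) (o : option 'I_d) : {ffun 'I_d -> bool} :=
  if o is Some i then [ffun j => if j == i then ~~ b j else b j] else b.

Lemma adj_box x b b' : adj (box_pt x b) (box_pt x b') -> exists i, b' = flip b (Some i).
Proof.
rewrite /adj /l1dist => h.
have E i : `|box_pt x b i - box_pt x b' i|%N = (b i != b' i).
  by rewrite !ffunE; case: (b i); case: (b' i) => /=; lia.
move: h; under eq_bigr do rewrite E.
move=> h; have [i bi] : exists i, b i != b' i.
  apply/existsP; apply: contraT => /existsPn n; move: h; rewrite big1// => i _.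
  by have := n i; rewrite negbK => ->.
exists i; apply/ffunP => j; rewrite ffunE; case: eqP => [->|/eqP ji].
  by move: bi; case: (b i); case: (b' i).
move: h; rewrite (bigD1 i)//= bi (bigD1 j)//=.
by case: (b j); case: (b' j).
Qed.

(** The closure is covered by C and its images under the d coordinate flips. *)
Lemma closure_set_card x (C : set (pt d)) :
  (#|closure_set x C| <= d.+1 * #|finset (fun b : {ffun 'I_d -> bool} => `[< C (box_pt x b) >])|)%N
  \/ ~ (C `<=` @box d x).
Proof.
have [Cbox|] := pselect (C `<=` @box d x); [left|by right].
set D := finset _.
have sub : closure_set x C \subset
    (fun p : {ffun 'I_d -> bool} * option 'I_d => flip p.1 p.2) @: finset.setX D finset.setT.
  apply/fintype.subsetP => b; rewrite finset.inE => /asboolP[_ [Cb|[c [Cc cb]]]].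
    apply/imsetP; exists (b, None) => //; rewrite !finset.inE andbT /=; exact/asboolP.
  have [b' _ cE] := Cbox _ Cc; rewrite -cE in cb Cc.
  have [i ->] := adj_box cb.
  by apply/imsetP; exists (b', Some i) => //; rewrite !finset.inE andbT /=; exact/asboolP.
apply: (leq_trans (subset_leq_card sub)); apply: (leq_trans (leq_imset_card _ _)).
by rewrite cardsX cardsT card_option card_ord mulnC.
Qed.

(** If the components differ, the first one avoids the intersection of the two closures, so it has
    at most 2n / d^2 of the n points of the box. Its closure then has at most 2 (d + 1) n / d^2
    points, less than (1 - d^-2) n once d >= 4; for d = 3 both bounds are equal. *)
Lemma large_unique E x c1 c2 : (4 <= d)%N ->
  (@box d x `&` E) c1 -> (@box d x `&` E) c2 ->
  large x (comp (@box d x `&` E) c1) -> large x (comp (@box d x `&` E) c2) ->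
  path_in (@box d x `&` E) c1 c2.
Proof.
move=> d4; set A := @box d x `&` E => A1 A2 l1 l2; apply: contrapT => n12.
pose S1 := closure_set x (comp A c1); pose S2 := closure_set x (comp A c2).
pose D := finset (fun b : {ffun 'I_d -> bool} => `[< comp A c1 (box_pt x b) >]).
have cardS1 : (#|S1| <= d.+1 * #|D|)%N.
  by case: (closure_set_card x (comp A c1)) => // -[] y /path_in_end [].
have DS : D \subset ~: (S1 :&: S2)%SET.
  apply/fintype.subsetP => b; rewrite !finset.inE => /asboolP D1.
  apply/negP => /andP[_ /asboolP[_ h]].
  apply: n12; case: h => [h|[c [h hb]]].
    exact: path_in_trans D1 (path_in_sym h).
  apply: (path_in_trans D1); apply: path_in_sym.
  apply: (path_in_trans h); apply/path_inP.
  apply: (reachS _ hb); last exact: path_in_end D1.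
  by apply: reach0; exact: path_in_end h.
pose n := #|{ffun 'I_d -> bool}|.
have cardD : (#|D| + #|S1| + #|S2| <= 2 * n)%N.
  have h1 : (#|D| <= #|~: (S1 :&: S2)%SET|)%N := subset_leq_card DS.
  have h2 : (#|(S1 :&: S2)%SET| + #|~: (S1 :&: S2)%SET| = n)%N := cardsC _.
  have h3 : (#|(S1 :|: S2)%SET| + #|(S1 :&: S2)%SET| = #|S1| + #|S2|)%N := cardsUI _ _.
  have h4 : (#|(S1 :|: S2)%SET| <= n)%N := max_card _.
  move: h1 h2 h3 h4; move: #|D| #|S1| #|S2| #|_| #|_| #|_| n.
  by move=> *; lia.
have n0 : (0 < n)%N by rewrite /n card_ffun card_bool card_ord expn_gt0.
move: l1 l2; rewrite /large -/S1 -/S2 -/n => l1 l2.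
have {}cardS1 : #|S1|%:R <= (d%:R + 1) * #|D|%:R :> R.
  by rewrite natr1 -natrM ler_nat.
have {}cardD : #|D|%:R + #|S1|%:R + #|S2|%:R <= 2 * n%:R :> R.
  by rewrite -!natrD -natrM ler_nat.
have {}n0 : 0 < n%:R :> R by rewrite ltr0n.
have d4R : 4 <= d%:R :> R by rewrite (ler_nat R 4 d).
move: l1 l2 cardS1 cardD.
set k := d%:R; rewrite -/k in d4R.
set s1 := #|S1|%:R; set s2 := #|S2|%:R; set m := n%:R in n0 *; set D' := #|D|%:R.
move=> l1 l2 h3 h4.
pose q := m / k ^+ 2.
have k0 : k != 0 by rewrite gt_eqF//; lra.
have mq : m = q * k ^+ 2 by rewrite /q mulfVK// expf_neq0.
have q0 : 0 < q by rewrite divr_gt0// exprn_gt0//; lra.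
have e1 : (1 - k ^- 2) * m = m - q by rewrite mulrBl mul1r mulrC.
rewrite e1 in l1 l2.
have D2 : D' <= 2 * q by lra.
have : (k + 1) * D' <= (k + 1) * (2 * q) by rewrite ler_wpM2l//; lra.
have : 0 < q * ((k - 4) * (k + 2) + 5) by rewrite mulr_gt0// ltr_wpDl// mulr_ge0//; lra.
by move=> *; lra.
Qed.

End good_vertices.

(** * Bad arms, and connections along good vertices *)

Section arms.
Context (R : realType) {d : nat}.
Implicit Types (E : set (pt d)) (u v x : int * int) (y z : pt d).

Definition supdist u v : nat := maxn `|u.1 - v.1|%N `|u.2 - v.2|%N.

Lemma supdist_triangle u v x : (supdist u x <= supdist u v + supdist v x)%N.
Proof. by rewrite /supdist; lia. Qed.

Lemma supdistC u v : supdist u v = supdist v u.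
Proof. by rewrite /supdist; lia. Qed.

Lemma supdistxx u : supdist u u = 0%N.
Proof. by rewrite /supdist; lia. Qed.

Definition star u v : Prop := (supdist u v <= 1)%N.

Definition window u (r : nat) : seq (int * int) :=
  [seq (u.1 - r%:Z + i%:Z, u.2 - r%:Z + j%:Z) | i <- iota 0 r.*2.+1, j <- iota 0 r.*2.+1].

Lemma size_window u r : size (window u r) = (r.*2.+1 ^ 2)%N.
Proof. by rewrite size_allpairs !size_iota. Qed.

Lemma mem_window u r v : (v \in window u r) = (supdist u v <= r)%N.
Proof.
apply/allpairsP/idP.
  move=> [[i j] [ir jr ->]]; move: ir jr; rewrite !mem_iota /supdist; cbn [fst snd]; lia.
case: v => a b; rewrite /supdist; cbn [fst snd] => h.
exists (absz (a - (u.1 - r%:Z))%R, absz (b - (u.2 - r%:Z))%R); cbn [fst snd].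
rewrite !mem_iota; split; [lia|lia|].
by congr (_, _); lia.
Qed.

(** [undup] makes immediate the uniqueness that the harmonic measure asks of its set. *)
Definition cells u r : seq (pt d) :=
  undup [seq box_pt v b | v <- window u r, b <- enum {ffun 'I_d -> bool}].

Lemma size_cells u r : (size (cells u r) <= r.*2.+1 ^ 2 * 2 ^ d)%N.
Proof.
apply: (leq_trans (size_undup _)); rewrite size_allpairs size_window.
by rewrite -cardE card_ffun card_bool card_ord.
Qed.

Lemma mem_cells u r v b : (supdist u v <= r)%N -> box_pt v b \in cells u r.
Proof.
move=> uv; rewrite mem_undup; apply/allpairsP; exists (v, b); split => //=.
  by rewrite mem_window.
by rewrite mem_enum.
Qed.

Lemma cellsP u r y : y \in cells u r -> exists v b, (supdist u v <= r)%N /\ y = box_pt v b.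
Proof.
rewrite mem_undup => /allpairsP[[v b] /= [vu _ ->]]; exists v, b.
by rewrite -mem_window.
Qed.

Lemma cells_separated u v r y z : (2 <= d)%N -> y \in cells u r -> z \in cells v r ->
  exists i : 'I_d, (2 * supdist u v <= `|y i - z i| + 4 * r + 1)%N.
Proof.
move=> d2 /cellsP[u' [b [ur ->]]] /cellsP[v' [c [vr ->]]].
have d0 : (0 < d)%N by exact: leq_trans d2.
have [h|h] := leqP `|u.2 - v.2|%N `|u.1 - v.1|%N.
  exists (Ordinal d0); rewrite !ffunE /=.
  by move: ur vr h; rewrite /supdist; case: (b _); case: (c _) => /=; lia.
exists (Ordinal d2); rewrite !ffunE /=.
by move: ur vr h; rewrite /supdist; case: (b _); case: (c _) => /=; lia.
Qed.

Lemma good_cells E E' x : (forall y, y \in cells x 1 -> E y -> E' y) ->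
  good R E x -> good R E' x.
Proof.
move=> EE'; apply: good_on => y [v [vx [b _ <-]]]; apply: EE'.
apply: mem_cells; move: vx; rewrite /l1dist2 /supdist; lia.
Qed.

Lemma good_supported x : supported (cells x 1) (fun E => ~ good R E x).
Proof.
move=> E E' EE' nE gE'; apply: nE; apply: good_cells gE' => y yx.
by apply EE'.
Qed.

(** Confining the path to the ball of radius L makes the event local. Its support needs one more
    layer, because [good] at a vertex inspects the neighbouring boxes. *)
Definition arm (L : nat) u E : Prop :=
  exists2 v, reach star (fun v' => ~ good R E v' /\ (supdist u v' <= L)%N) u v &
    (L <= supdist u v)%N.

Lemma arm_bad L u E : arm L u E -> ~ good R E u.
Proof. by move=> [v uv _]; have [] := reach_start uv. Qed.

Lemma arm_mono L u E E' : (forall y, y \in cells u L.+1 -> E y -> E' y) ->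
  arm L u E' -> arm L u E.
Proof.
move=> EE' [v uv Lv]; exists v => //; apply: reach_sub uv => z [nz uz]; split => //.
move=> gz; apply: nz; apply: good_cells gz => y /cellsP[w [b [zw ->]]].
by apply: EE'; apply: mem_cells; have := supdist_triangle u z w; lia.
Qed.

Lemma arm_supported L u : supported (cells u L.+1) (arm L u).
Proof. by move=> E E' EE'; apply: arm_mono => y /EE' []. Qed.

Lemma arm_decreasing L u : decreasing (arm L u).
Proof. by move=> E E' EE'; apply: arm_mono => y _; exact: EE'. Qed.

Lemma star_supdist u v w : star v w -> (supdist u w <= (supdist u v).+1)%N.
Proof. by move=> vw; have := supdist_triangle u v w; rewrite /star in vw; lia. Qed.

Lemma arm_of_reach E u v L : reach star (fun v' => ~ good R E v') u v ->
  (L <= supdist u v)%N -> arm L u E.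
Proof.
move=> uv Lv.
have [|w wL uw] := reach_truncate (f := supdist u) (L := L) (@star_supdist u) _ Lv uv.
  by rewrite supdistxx.
by exists w => //; rewrite wL.
Qed.

Lemma arm_le L L' u E : (L <= L')%N -> arm L' u E -> arm L u E.
Proof.
move=> LL [v uv Lv]; apply: (@arm_of_reach _ _ v); last exact: leq_trans LL Lv.
by apply: reach_sub uv => z [].
Qed.

(** The path is stopped when it first reaches distance L'; run backwards, it is an arm of its
    endpoint. *)
Lemma arm_split L L' u E : (L <= L')%N -> arm L' u E ->
  arm L u E /\ exists2 v, v \in window u L' & supdist u v = L' /\ arm L v E.
Proof.
move=> LL aE; split; first exact: arm_le aE.
have [v uv Lv] := aE.
have [|w wL uw] := reach_truncate (f := supdist u) (L := L') (@star_supdist u) _ Lv uv.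
  by rewrite supdistxx.
exists w; first by rewrite mem_window wL.
split=> //; apply: (@arm_of_reach _ _ u); last by rewrite supdistC wL.
apply: reach_sym; first by move=> a b; rewrite /star supdistC.
by apply: reach_sub uw => z [[]].
Qed.

Definition rep E v y : Prop :=
  (@box d v `&` E) y /\ large R v (comp (@box d v `&` E) y).

Lemma rep_connected E v y z : (4 <= d)%N -> rep E v y -> rep E v z -> path_in E y z.
Proof.
move=> d4 [yv yl] [zv zl]; apply: path_in_sub (large_unique d4 yv zv yl zl).
by move=> w [].
Qed.

Lemma good_connected E x v v' y z : (4 <= d)%N -> good R E x ->
  (l1dist2 v x <= 1)%N -> (l1dist2 v' x <= 1)%N -> rep E v y -> rep E v' z ->
  path_in E y z.
Proof.
move=> d4 [c [hc hconn]] vx v'x ry rz.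
apply: (path_in_trans (rep_connected d4 ry (hc _ vx))).
apply: path_in_trans (rep_connected d4 (hc _ v'x) rz).
by apply: path_in_sub (hconn _ _ vx v'x) => w [].
Qed.

Lemma l1dist2xx x : l1dist2 x x = 0%N.
Proof. by rewrite /l1dist2; lia. Qed.

Lemma good_rep E x : good R E x -> exists y, rep E x y.
Proof. by move=> [c [hc _]]; exists (c x); apply: hc; rewrite l1dist2xx. Qed.

Lemma good_path_connected E u v : (4 <= d)%N ->
  reach (fun a b => (l1dist2 a b <= 1)%N) (good R E) u v ->
  forall y z, rep E u y -> rep E v z -> path_in E y z.
Proof.
move=> d4; elim=> [gu y z|v' w uv' IH vw gw y z ry rz].
  by apply: (good_connected d4 gu); rewrite l1dist2xx.
have gv := reach_end uv'; have [y' ry'] := good_rep gv.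
apply: (path_in_trans (IH _ _ ry ry')).
by apply: (good_connected d4 gv) ry' rz; rewrite ?l1dist2xx// /l1dist2 addnC;
  move: vw; rewrite /l1dist2; lia.
Qed.

Definition quad_vertex (q : nat * nat) : int * int := (q.1%:Z, q.2%:Z).

(** The large component of the box at 0 need not contain the origin, so the starting vertex [b] is
    existential. *)
Lemma good_quadrant_path E (q : nat * nat) N : (4 <= d)%N -> (0 < N)%N ->
  reach quad_adj (fun q => ~ ~ good R E (quad_vertex q)) (0, 0)%N q ->
  (N <= maxn q.1 q.2)%N ->
  exists b z, path_in E (box_pt (0, 0) b) z /\ (N <= l1dist (box_pt (0, 0)%R b) z)%N.
Proof.
move=> d4 N0 r Nq.
have {}r : reach (fun a b => (l1dist2 a b <= 1)%N) (good R E) (quad_vertex (0, 0)%N)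
    (quad_vertex q).
  apply: reach_map r => [a b|a /contrapT//].
  by rewrite /quad_adj /l1dist2 /quad_vertex /=; lia.
have [y ry] := good_rep (reach_start r); have [z rz] := good_rep (reach_end r).
have yz := good_path_connected d4 r ry rz.
have [[[b _ yb] _] _] := ry; have [[[c _ zc] _] _] := rz.
exists b, z; rewrite /quad_vertex /= in yb; rewrite yb; split => //.
have d0 : (0 < d)%N by exact: leq_trans d4.
have d2 : (1 < d)%N by exact: leq_trans d4.
have coord (i : 'I_d) : (`|y i - z i| <= l1dist y z)%N.
  by rewrite /l1dist (bigD1 i)//= leq_addr.
rewrite -yb -zc in coord *; rewrite /quad_vertex in coord *.
have [h|h] := leqP q.2 q.1.
  apply: leq_trans (coord (Ordinal d0)); rewrite !ffunE /=.
  by move: Nq h; case: (b _); case: (c _) => /=; lia.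
apply: leq_trans (coord (Ordinal d2)); rewrite !ffunE /=.
by move: Nq h; case: (b _); case: (c _) => /=; lia.
Qed.

Definition far (N : nat) y E : Prop :=
  exists2 z, path_in (E `&` [set w | (l1dist y w <= N)%N]) y z & (N <= l1dist y z)%N.

Lemma l1distxx y : l1dist y y = 0%N.
Proof. by rewrite /l1dist big1// => i _; rewrite subrr. Qed.

Lemma far_of_path N y z E : path_in E y z -> (N <= l1dist y z)%N -> far N y E.
Proof.
move=> /path_inP yz Nz.
have [||w wN yw] := reach_truncate (f := l1dist y) (L := N) _ _ Nz yz.
- by move=> u v; rewrite /adj => uv; have := l1dist_triangle y u v; rewrite uv addn1.
- by rewrite l1distxx.
by exists w; [exact/path_inP|rewrite wN].
Qed.

Lemma far_le M N y E : (M <= N)%N -> far N y E -> far M y E.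
Proof.
move=> MN [z yz Nz]; apply: (@far_of_path _ _ z); last exact: leq_trans Nz.
by apply: path_in_sub yz => w [].
Qed.

(** In fact the cube of radius N: any finite list containing the ball can serve as a support. *)
Definition l1ball (N : nat) y : seq (pt d) :=
  [seq [ffun i => y i - N%:Z + (nat_of_ord (f i))%:Z] : pt d |
    f : {ffun 'I_d -> 'I_(N.*2.+1)} <- enum {ffun 'I_d -> 'I_(N.*2.+1)}].

Lemma mem_l1ball N y z : (l1dist y z <= N)%N -> z \in l1ball N y.
Proof.
move=> yz; have coord (i : 'I_d) : (`|y i - z i| <= N)%N.
  by apply: leq_trans yz; rewrite /l1dist (bigD1 i)//= leq_addr.
apply/mapP; exists [ffun i => inord (absz (z i - (y i - N%:Z))%R)]; first by rewrite mem_enum.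
apply/ffunP => i; rewrite !ffunE; have := coord i; move: (y i) (z i) => a b ab.
by rewrite inordK; lia.
Qed.

Lemma far_supported N y : supported (l1ball N y) (far N y).
Proof.
move=> E E' EE' [z yz Nz]; exists z => //; apply: path_in_sub yz => w [Ew wN].
by split => //; apply/EE' => //; exact: mem_l1ball.
Qed.

Lemma far_translate_imp N y (w : pt d) E : far N y E -> far N (y - w) [set z | E (z + w)].
Proof.
have dist (a b : pt d) : l1dist (a - w) (b - w) = l1dist a b.
  by rewrite -(l1dist_translate _ _ w) !subrK.
move=> [z yz Nz]; exists (z - w); last by rewrite dist.
apply: path_in_translate yz => u [Eu uN].
by split; rewrite /= ?subrK ?dist.
Qed.

Lemma far_translate N y E : far N y E <-> far N (@origin d) [set z | E (z + y)].
Proof.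
have o0 : @origin d = 0 by apply/ffunP => i; rewrite !ffunE.
rewrite o0; split=> [/(far_translate_imp y)|/(far_translate_imp (- y))].
  by rewrite subrr.
rewrite sub0r opprK; congr (far _ _ _).
by apply/seteqP; split => z /=; rewrite subrK.
Qed.

Lemma perc_of_far (h : R) (phi : pt d -> R) :
  (forall N, far N (@origin d) (level_set phi h)) -> perc_from_origin h phi.
Proof.
move=> hfar; split.
  by have [z /path_inP oz _] := hfar 0%N; have [] := reach_start oz.
move=> /finite_seqP[s sE].
pose M := (\max_(z <- s) l1dist (@origin d) z).+1.
have [z oz Nz] := hfar M.
have : z \in s.
  have : [set y | path_in (level_set phi h) (@origin d) y] z.
    by apply: path_in_sub oz => w [].
  by rewrite sE.
move=> zs; move: Nz; rewrite /M leqNgt ltnS.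
by rewrite (leq_bigmax_seq z).
Qed.

End arms.

(** * Renormalization *)

Section field.
Context {R : realType} {d : nat} {dsp : measure_display} {T : measurableType dsp}
  (P : probability T R) (phi : T -> pt d -> R).
Hypotheses (gff : is_GFF P phi) (d4 : (4 <= d)%N).
Hypothesis transient : forall x y : pt d, exists B : R, forall N, green_n N x y <= B.

Local Notation G := (@green R d).

Lemma gff_gaussian c : centered_gaussian P (lin phi c) (cov G c c).
Proof. exact: gff. Qed.

Let d0 : (0 < d)%N. Proof. exact: leq_trans d4. Qed.

(** The coefficients of the orthogonal projection of the field at y onto the field on K. *)
Definition proj (K : seq (pt d)) (y : pt d) : seq (R * pt d) :=
  [seq (harm K y x, x) | x <- K].

Lemma cov_proj (K : seq (pt d)) x y : uniq K -> x \in K ->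
  cov G (proj K y) [:: (1, x)] = G y x.
Proof.
move=> uK xK; rewrite /cov /proj big_map -(harm_green transient uK d0 y xK).
by apply: eq_bigr => z _; rewrite big_seq1 /= mulr1.
Qed.

Lemma cov_projr (K : seq (pt d)) x y : uniq K -> x \in K ->
  cov G [:: (1, x)] (proj K y) = G x y.
Proof.
move=> uK xK; rewrite green_sym -(cov_proj y uK xK) /cov /proj big_seq1 !big_map.
by apply: eq_bigr => z _; rewrite big_seq1 /= mul1r mulr1 green_sym.
Qed.

(** By the reproducing identity the double sum collapses to the sum over x of [harm K y x * G y x],
    an average of the Green function. *)
Lemma var_proj (K : seq (pt d)) y s2 : uniq K -> 0 <= s2 ->
  (forall x, x \in K -> G y x <= s2) -> cov G (proj K y) (proj K y) <= s2.
Proof.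
move=> uK s0 hs.
apply: le_trans (harm_green_le uK d0 hs s0).
rewrite /cov {1}/proj big_map le_eqVlt big_seq [X in _ == X]big_seq.
apply/orP; left; apply/eqP; apply: eq_bigr => x xK /=.
rewrite -[G y x](cov_proj y uK xK) /cov /proj !big_map mulr_sumr.
by apply: eq_bigr => z _; rewrite big_seq1 /= mulr1 green_sym mulrA.
Qed.

Lemma arms_decoupled L u v (h dl s2 : R) : 0 < dl -> 0 < s2 ->
  (forall x y, x \in cells u L.+1 -> y \in cells v L.+1 -> G y x <= s2) ->
  pr P (event phi h (arm R L u) `&` event phi h (arm R L v)) <=
  pr P (event phi h (arm R L u)) * pr P (event phi (h + dl *+ 2) (arm R L v)) +
  ((size (cells v L.+1 : seq (pt d)))%:R * (2 * expR (- (dl ^+ 2 / (s2 *+ 2))))) *+ 2.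
Proof.
move=> dl0 s20 hs; have uK : uniq (cells u L.+1 : seq (pt d)) by exact: undup_uniq.
apply: (decoupling gff_gaussian (Z := proj (cells u L.+1)) h _ _ _ dl0 s20).
- exact: arm_supported.
- exact: arm_supported.
- exact: arm_decreasing.
- by move=> x y xK _; exact: cov_projr.
- by move=> x y xK _; exact: cov_proj.
- by move=> y yK; apply: var_proj => //; [exact: ltW|move=> x xK; exact: hs].
Qed.

Lemma arm_recursion L L' (h dl s2 b : R) : (L <= L')%N -> 0 < dl -> 0 < s2 ->
  (forall u v x y, supdist u v = L' -> x \in cells u L.+1 -> y \in cells v L.+1 ->
     G y x <= s2) ->
  (forall u, pr P (event phi (h + dl *+ 2) (arm R L u)) <= b) ->
  forall u, pr P (event phi h (arm R L' u)) <=
    (L'.*2.+1 ^ 2)%:R * (b ^+ 2 +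
      (((L.+1.*2.+1 ^ 2 * 2 ^ d)%N)%:R * (2 * expR (- (dl ^+ 2 / (s2 *+ 2))))) *+ 2).
Proof.
move=> LL dl0 s20 hs hb u.
have ms k v := measurable_event gff_gaussian k (@arm_supported R d L v).
pose s := [seq v <- window u L' | supdist u v == L'].
pose A v := event phi h (arm R L u) `&` event phi h (arm R L v).
have mA v : v \in s -> measurable (A v) by move=> _; exact: measurableI.
have sub : event phi h (arm R L' u) `<=` [set w | exists2 v, v \in s & A v w].
  move=> w aw; have [aL [v vw [uv av]]] := arm_split LL aw.
  by exists v; [rewrite mem_filter uv eqxx|split].
have h1 := pr_le P (measurable_event gff_gaussian h (@arm_supported R d L' u))
  (measurable_ex mA) sub.
apply: (le_trans h1); apply: (le_trans (pr_ex P mA)).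
set err := _ *+ 2.
have err0 : 0 <= err by rewrite mulrn_wge0// mulr_ge0// mulr_ge0// expR_ge0.
have bound v : v \in s -> pr P (A v) <= b ^+ 2 + err.
  rewrite mem_filter => /andP[/eqP uv _].
  have h2 := @arms_decoupled L u v h dl s2 dl0 s20 (fun x y => hs u v x y uv).
  apply: (le_trans h2); apply: lerD.
    rewrite expr2 ler_pM ?pr_ge0//; apply: le_trans (hb u).
    (* [hb] holds at the raised level; arms are decreasing events, so the first arm may be moved to
       that level too. *)
    apply: (event_le_level gff_gaussian (@arm_supported R d L u)).
      exact: arm_decreasing.
    by rewrite lerDl mulrn_wge0// ltW.
  rewrite lerMn2r ler_wpM2r ?mulr_ge0 ?expR_ge0// ler_nat; exact: size_cells.
rewrite big_seq (le_trans (ler_sum _ bound))// -big_seq.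
rewrite big_const_seq count_predT iter_addr_0 -[leLHS]mulr_natl.
rewrite ler_wpM2r//; first by rewrite addr_ge0// sqr_ge0.
rewrite ler_nat -(size_window u L') size_filter; exact: count_size.
Qed.

Lemma bad_translate (h : R) u :
  pr P (event phi h (fun E => ~ good R E u)) = pr P (event phi h (fun E => ~ good R E 0)).
Proof.
apply: (event_translation gff_gaussian (tau := fun z => z + lift2 u)).
- by move=> x y; exact: green_translate.
- exact: good_supported.
- move=> E; have [h1 h2] := @good_translate R d E u.
  by apply/propext; split; apply: contra_not; [exact: h2|exact: h1].
Qed.

Lemma far_translate_pr (h : R) N y :
  pr P (event phi h (far N y)) = pr P (event phi h (far N (@origin d))).
Proof.
apply: (event_translation gff_gaussian (tau := fun z => z + y)).
- by move=> x z; exact: green_translate.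
- exact: far_supported.
- by move=> E; apply/propext; exact: far_translate.
Qed.

Lemma percE (h : R) :
  [set w | perc_from_origin h (phi w)] = \bigcap_N event phi h (far N (@origin d)).
Proof.
apply/seteqP; split => w /=; last first.
  by move=> hw; apply: perc_of_far => N; exact: hw.
move=> [h0 inf] N _; apply: contrapT => nfar; apply: inf.
apply: (@sub_finite_set _ _ [set z | z \in l1ball N (@origin d)]).
  move=> z /= oz; apply: mem_l1ball; rewrite leqNgt; apply/negP => zN.
  by apply: nfar; apply: (far_of_path oz); exact: ltnW.
exact: finite_seq.
Qed.

Lemma measurable_perc (h : R) : measurable [set w | perc_from_origin h (phi w)].
Proof.
rewrite percE; apply: bigcapT_measurable => N.
exact: (measurable_event gff_gaussian h (@far_supported d N (@origin d))).
Qed.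

Lemma perc_prob (h c : R) : (forall N, (0 < N)%N -> c <= pr P (event phi h (far N (@origin d)))) ->
  c <= pr P [set w | perc_from_origin h (phi w)].
Proof.
(* The index starts at 1, where [hc] applies; the intersection is unchanged because [far] is
   monotone in N. *)
move=> hc; pose F N := event phi h (far N.+1 (@origin d)).
have mF N : measurable (F N).
  exact: (measurable_event gff_gaussian h (@far_supported d N.+1 (@origin d))).
have PF : [set w | perc_from_origin h (phi w)] = \bigcap_N F N.
  rewrite percE; apply/seteqP; split => w hw N _; first exact: hw.
  by apply: far_le (hw N I).
have niF : nonincreasing_seq F.
  by move=> M N MN; apply/subsetPset => w; apply: far_le; rewrite ltnS.
have h1 : P (F N) @[N --> \oo] --> P (\bigcap_N F N).
  apply: nonincreasing_cvg_mu => //.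
  - by rewrite -ge0_fin_numE// fin_num_measure.
  - exact: bigcapT_measurable.
rewrite -PF in h1.
have mp := measurable_perc h.
rewrite -lee_fin -prE//.
rewrite -(cvg_lim _ h1)//; apply: lime_ge; first by apply/cvg_ex; eexists; exact: h1.
apply: nearW => N; rewrite prE// lee_fin; exact: hc.
Qed.

(** Either some vertex of the box at 0 is joined to distance N, at the price of a factor 2^d by
    translation invariance, or a bad star-path joins (m, 0) to the vertical axis. The latter goes to
    distance at least m and contains an arm of any length [Lm m <= m]. *)
Lemma far_lower_bound (h : R) (N : nat) (q : R) (Lm : nat -> nat) : (0 < N)%N ->
  (forall m, (Lm m <= m)%N) ->
  \sum_(m < N.+1) pr P (event phi h (arm R (Lm m) (m%:Z, 0))) <= q ->
  1 - q <= 2 ^+ d * pr P (event phi h (far N (@origin d))).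
Proof.
move=> N0 Lmm hq.
pose A (m : nat) := event phi h (arm R (Lm m) (m%:Z, 0)).
pose B (b : {ffun 'I_d -> bool}) := event phi h (far N (box_pt (0, 0) b)).
have mA (m : nat) : m \in iota 0 N.+1 -> measurable (A m).
  move=> _; exact: (measurable_event gff_gaussian h (@arm_supported R d _ _)).
have mB b : b \in enum {ffun 'I_d -> bool} -> measurable (B b).
  move=> _; exact: (measurable_event gff_gaussian h (@far_supported d _ _)).
have mA' := measurable_ex mA; have mB' := measurable_ex mB.
have sub : setT `<=` [set w | exists2 m, m \in iota 0 N.+1 & A m w] `|`
    [set w | exists2 b, b \in enum {ffun 'I_d -> bool} & B b w].
  move=> w _; set E := [set x | h <= phi w x].
  have [[q0 r Nq]|[m [k [mN r]]]] := quadrant_duality (fun q => ~ good R E (quad_vertex q)) N.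
    right; have [b [z [bz Nz]]] := good_quadrant_path d4 N0 r Nq.
    by exists b; rewrite ?mem_enum//; exact: far_of_path bz Nz.
  left; exists m; first by rewrite mem_iota.
  apply: (@arm_of_reach _ _ _ _ (quad_vertex (0%N, k))).
    apply: reach_map r => [a b|//].
    by case=> ? ? ? ?; rewrite /star /supdist /quad_vertex /=; lia.
  by apply: (leq_trans (Lmm m)); rewrite /supdist /quad_vertex /=; lia.
have h1 := pr_le P (@measurableT _ T) (measurableU _ _ mA' mB') sub.
rewrite pr_setT in h1.
have h2 := pr_setU P mA' mB'.
have h3 := pr_ex P mA; have h4 := pr_ex P mB.
rewrite -[iota 0 N.+1]/(index_iota 0 N.+1) big_mkord in h3.
have h5 : \sum_(b <- enum {ffun 'I_d -> bool}) pr P (B b) =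
    2 ^+ d * pr P (event phi h (far N (@origin d))).
  under eq_bigr do rewrite /B far_translate_pr.
  rewrite big_const_seq count_predT iter_addr_0 -[LHS]mulr_natl.
  by rewrite -cardE card_ffun card_bool card_ord natrX.
rewrite h5 in h4.
by lra.
Qed.

End field.

(** A Y^110 <= Y^112 <= e^(112 Y), and 113 Y^21 <= 144 Y^21 <= Y^23. In the recursion A is
    numerical, 110 = 3 * 22 + 44, and e^(Y^21) bounds 2^d. *)
Lemma expR_beats_power {R : realType} (A Y : R) : 12 <= Y -> A <= Y ^+ 2 ->
  A * Y ^+ 110 * expR (Y ^+ 21) <= expR (Y ^+ 23).
Proof.
move=> Y12 AY; have Y0 : 0 <= Y by apply: le_trans Y12.
have Y1 : 1 <= Y by apply: le_trans Y12; rewrite ler1n.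
apply: (@le_trans _ _ (expR Y ^+ 112 * expR (Y ^+ 21))).
  rewrite ler_wpM2r ?expR_ge0//.
  apply: (@le_trans _ _ (Y ^+ 2 * Y ^+ 110)).
    by rewrite ler_wpM2r ?exprn_ge0.
  rewrite -exprD; apply: lerXn2r; rewrite ?nnegrE ?expR_ge0//.
  by apply: le_trans (expR_ge1Dx _); rewrite lerDr.
rewrite -expRM_natl -expRD ler_expR.
have -> : Y ^+ 23 = Y ^+ 2 * Y ^+ 21 by rewrite -exprD.
have h1 : Y <= Y ^+ 21 by rewrite exprS ler_peMr// exprn_ege1.
have h3 : 12 * 12 <= Y ^+ 2 by rewrite expr2 ler_pM.
have h2 : 12 * 12 * Y ^+ 21 <= Y ^+ 2 * Y ^+ 21 by rewrite ler_wpM2r ?exprn_ge0.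
apply: le_trans h2; move: (Y ^+ 21) h1 => Z h1.
by lra.
Qed.

Lemma sum_inv_sqr_le2 {R : realType} N : \sum_(k < N.+1) (k.+1%:R ^- 2 : R) <= 2.
Proof.
suff : \sum_(k < N.+1) (k.+1%:R ^- 2 : R) <= 2 - N.+1%:R^-1.
  by move=> h; apply: (le_trans h); rewrite gerBl invr_ge0.
elim: N => [|N IH]; first by rewrite big_ord1 expr1n invr1; lra.
rewrite big_ord_recr /=; apply: (le_trans (lerD IH (lexx _))).
have a0 : 0 < N.+1%:R :> R by [].
rewrite -[N.+2%:R]natr1; move: (N.+1%:R : R) a0 => a a0.
have b0 : 0 < a + 1 by lra.
rewrite -subr_ge0.
have -> : 2 - (a + 1)^-1 - (2 - a^-1 + (a + 1) ^- 2) = (a * (a + 1) ^+ 2)^-1.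
  by field; rewrite !gt_eqF.
by rewrite invr_ge0 mulr_ge0 ?exprn_ge0// ltW.
Qed.

(** * The recursion over scales *)

Section renormalization.
Context {R : realType} {d : nat} {dsp : measure_display} {T : measurableType dsp}
  (P : probability T R) (phi : T -> pt d -> R).
Hypotheses (gff : is_GFF P phi) (d4 : (4 <= d)%N).
Hypothesis green_bound : forall (x y : pt d) N,
  green_n N x y <= 2 * d%:R / 23%:R * (d%:R / (d%:R + @sqnorm R d (x - y))) ^+ 23.
Variables (eps h c : R) (m : nat).
Local Notation M := (m%:R : R).
Hypotheses (eps0 : 0 < eps) (c1 : 1 <= c) (M12 : 12 <= M)
  (M2 : 9 * 25 * 4 * 40 <= M ^+ 2) (cM : c <= M)
  (dM : d%:R <= c * M ^+ 20) (epsM : 4 * c ^+ 24 / eps ^+ 2 <= M).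
Hypothesis bad0 : pr P (event phi (h + eps) (fun E => ~ good R E 0)) <= M ^- 46.

Lemma transient x y : exists B : R, forall N, @green_n R d N x y <= B.
Proof. by eexists => N; exact: green_bound. Qed.

Let M0 : 0 < M. Proof. by apply: lt_le_trans M12. Qed.
Let M1 : 1 <= M. Proof. by apply: le_trans M12; rewrite ler1n. Qed.

(** With Y = m^(n+1), the squared distance is at least Y^22 and d <= c Y^20, so the ratio in
    [green_bound] is at most c Y^-2. Its power 23 times the prefactor, at most 2 c Y^20, is the
    bound. *)
Lemma green_far n (u v : int * int) (x y : pt d) :
  supdist u v = (m ^ (11 * n.+1))%N ->
  x \in cells u (m ^ (11 * n)).+1 -> y \in cells v (m ^ (11 * n)).+1 ->
  green R y x <= 2 * c ^+ 24 * (M ^+ n.+1) ^- 26.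
Proof.
move=> uv xu yv; set Y := M ^+ n.+1.
have Y1 : 1 <= Y by rewrite exprn_ege1.
have Y0 : 0 < Y by apply: lt_le_trans Y1.
have d0 : 0 < d%:R :> R by rewrite ltr0n; exact: leq_trans d4.
have d2 : (2 <= d)%N by exact: leq_trans d4.
have c0 : 0 < c by apply: lt_le_trans c1.
have m9 : (9 <= m)%N by rewrite -(ler_nat R); apply: le_trans M12; rewrite ler_nat.
have [i hi] := cells_separated d2 xu yv.
have sep : (m ^ (11 * n.+1) <= `|x i - y i|)%N.
  move: hi; rewrite uv => hi.
  (* [cells_separated] loses 4 (L_n + 1) + 1 <= 9 L_n, which one of the two copies of L_(n+1)
     absorbs. *)
  have h1 : (9 * m ^ (11 * n) <= m ^ (11 * n.+1))%N.
    rewrite mulnSr expnD mulnC leq_mul2l; apply/orP; right.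
    by apply: (leq_trans m9); rewrite -[leqLHS]expn1 leq_exp2l// (leq_trans _ m9).
  have h2 : (0 < m ^ (11 * n))%N by rewrite expn_gt0 (leq_trans _ m9).
  move: hi h1 h2; move: (m ^ (11 * n.+1))%N (m ^ (11 * n))%N (absz _) => a b k.
  by clear; lia.
have mY : ((m ^ (11 * n.+1))%N%:R : R) = Y ^+ 11.
  by rewrite natrX /Y -exprM mulnC.
have sq : Y ^+ 22 <= @sqnorm R d (y - x).
  apply: le_trans (sqnorm_coord (y - x) i).
  have -> : Y ^+ 22 = (Y ^+ 11) ^+ 2 by rewrite -exprM.
  rewrite -mY -[leRHS]ger0_norm ?sqr_ge0// normrX lerXn2r ?nnegrE//.
  rewrite -intr_norm -[(_)%:R]/((_ : nat)%:~R) ler_int !ffunE.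
  move: sep; move: (m ^ _)%N (x i) (y i) => k a b.
  by clear; lia.
apply: green_le; first exact: transient.
move=> N; apply: (le_trans (green_bound _ _ _)).
have Y22 : 0 < Y ^+ 22 by rewrite exprn_gt0.
have dY : d%:R <= c * Y ^+ 20.
  apply: (le_trans dM); rewrite ler_wpM2l ?(ltW c0)// lerXn2r ?nnegrE ?(ltW M0) ?(ltW Y0)//.
  by rewrite /Y exprS ler_peMr ?(ltW M0)// exprn_ege1.
have q : d%:R / (d%:R + @sqnorm R d (y - x)) <= c * Y ^- 2.
  rewrite ler_pdivrMr; last by rewrite ltr_pwDl// sqnorm_ge0.
  apply: (le_trans dY).
  have -> : c * Y ^+ 20 = c * Y ^- 2 * Y ^+ 22.
    have -> : Y ^+ 22 = Y ^+ 2 * Y ^+ 20 by rewrite -exprD.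
    by rewrite -mulrA mulKf// expf_neq0// gt_eqF.
  rewrite ler_wpM2l//; first by rewrite mulr_ge0 ?(ltW c0)// invr_ge0 exprn_ge0// ltW.
  by apply: (le_trans sq); rewrite lerDr ltW.
have q0 : 0 <= d%:R / (d%:R + @sqnorm R d (y - x)).
  by rewrite divr_ge0// addr_ge0// sqnorm_ge0.
apply: (@le_trans _ _ (2 * (c * Y ^+ 20) * (c * Y ^- 2) ^+ 23)).
  apply: ler_pM => //.
  - exact: exprn_ge0.
  - rewrite -mulrA ler_wpM2l//; apply: le_trans dY.
    apply: ler_piMr; first exact: ltW.
    by rewrite invf_le1 ?ler1n ?ltr0n.
  - by rewrite lerXn2r// nnegrE mulr_ge0 ?(ltW c0)// invr_ge0 exprn_ge0// ltW.
rewrite le_eqVlt; apply/orP; left; apply/eqP.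
have e : (Y ^- 2) ^+ 23 = (Y ^+ 20 * Y ^+ 26)^-1 by rewrite exprVn -exprM -exprD.
rewrite exprMn e [c ^+ 24]exprS.
have a0 : Y ^+ 20 != 0 by rewrite expf_neq0// gt_eqF.
have b0 : Y ^+ 26 != 0 by rewrite expf_neq0// gt_eqF.
move: (Y ^+ 20) (Y ^+ 26) (c ^+ 23) a0 b0 => a b k a0 b0.
by field; rewrite a0 b0.
Qed.

(* With l = m^11 and L_n = l^n the bound reads l^-(2n + 4) / 20, which is stable
   under the recursion p_(n+1) <= 9 L_(n+1)^2 (p_n^2 + error). *)
Lemma arm_bound n u :
  pr P (event phi (h + eps / 2 ^+ n) (arm R (m ^ (11 * n)) u)) <=
  20^-1 * ((M ^+ n) ^- 22 * M ^- 44).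
Proof.
have gauss := gff_gaussian gff.
have m1 : (1 <= m)%N by rewrite -(ler_nat R).
elim: n u => [|n IH] u.
  rewrite muln0 expn0 expr0 divr1 expr0 expr1n invr1 mul1r.
  apply: (@le_trans _ _ (pr P (event phi (h + eps) (fun E => ~ good R E u)))).
    apply: pr_le.
    - exact: (measurable_event gauss _ (@arm_supported R d _ _)).
    - exact: (measurable_event gauss _ (@good_supported R d _)).
    - by move=> w; exact: arm_bad.
  rewrite (bad_translate gff); apply: (le_trans bad0).
  (* The spare M^-2 pays for the factor 1/20. *)
  have -> : M ^- 46 = M ^- 2 * M ^- 44 by rewrite -invfM -exprD.
  rewrite ler_wpM2r ?invr_ge0 ?exprn_ge0 ?(ltW M0)// lef_pV2 ?posrE ?exprn_gt0//.
  apply: le_trans M2; have : 1 <= 9 :> R by rewrite ler1n.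
  by lra.
set Y := M ^+ n.+1.
have YM : M <= Y by rewrite /Y exprS ler_peMr ?(ltW M0)// exprn_ege1.
have Y0 : 0 < Y by apply: lt_le_trans YM.
have Y1 : 1 <= Y by apply: le_trans YM.
have c0 : 0 < c by apply: lt_le_trans c1.
have p2 : 0 < 2 ^+ n.+2 :> R by rewrite exprn_gt0.
(* Twice [dl] is exactly the gap between levels n and n + 1, and [s2] is the bound of
   [green_far]. *)
pose dl := eps / 2 ^+ n.+2; pose s2 := 2 * c ^+ 24 * Y ^- 26.
have dl0 : 0 < dl by rewrite divr_gt0.
have s20 : 0 < s2 by rewrite mulr_gt0 ?invr_gt0 ?exprn_gt0// mulr_gt0// exprn_gt0.
have LL : (m ^ (11 * n) <= m ^ (11 * n.+1))%N by rewrite leq_pexp2l// leq_pmul2l.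
have lev : h + eps / 2 ^+ n.+1 + dl *+ 2 = h + eps / 2 ^+ n.
  rewrite -addrA; congr (_ + _); rewrite /dl !exprS; field.
  by rewrite expf_neq0// pnatr_eq0.
have rec := @arm_recursion R d dsp T P phi gff d4 transient _ _
  (h + eps / 2 ^+ n.+1) dl s2 (20^-1 * ((M ^+ n) ^- 22 * M ^- 44)) LL dl0 s20
  (fun u v x y uv xu yv => green_far uv xu yv).
rewrite lev in rec; apply: (le_trans (rec IH u)) => {rec}.
have Y11 : ((m ^ (11 * n.+1))%N%:R : R) = Y ^+ 11 by rewrite natrX /Y -exprM mulnC.
have b1 : ((m ^ (11 * n.+1)).*2.+1 ^ 2)%:R <= 9 * Y ^+ 22 :> R.
  have -> : 9 * Y ^+ 22 = ((3 * m ^ (11 * n.+1)) ^ 2)%:R :> R.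
    rewrite natrX natrM Y11 exprMn -[Y ^+ 11 ^+ 2]exprM; congr (_ * _).
    by rewrite -natrX.
  rewrite ler_nat leq_exp2r//.
  have : (0 < m ^ (11 * n.+1))%N by rewrite expn_gt0 m1.
  by move: (m ^ _)%N => k; clear; lia.
(* The vertices of the boxes contribute 2^d <= e^d, and d <= c m^20 <= Y^21 because c <= m <= Y. *)
have b2 : ((m ^ (11 * n)).+1.*2.+1 ^ 2 * 2 ^ d)%N%:R <= 25 * Y ^+ 22 * expR (Y ^+ 21) :> R.
  rewrite natrM ler_pM//.
    have -> : 25 * Y ^+ 22 = ((5 * m ^ (11 * n.+1)) ^ 2)%:R :> R.
      rewrite natrX natrM Y11 exprMn -[Y ^+ 11 ^+ 2]exprM; congr (_ * _).
      by rewrite -natrX.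
    rewrite ler_nat leq_exp2r//; move: LL.
    have : (0 < m ^ (11 * n.+1))%N by rewrite expn_gt0 m1.
    by move: (m ^ _)%N (m ^ _)%N => k l; clear; lia.
  have dY : d%:R <= Y ^+ 21.
    apply: (le_trans dM); rewrite [Y ^+ 21]exprS; apply: ler_pM.
    - exact: ltW.
    - by rewrite exprn_ge0// ltW.
    - exact: le_trans cM YM.
    - by apply: lerXn2r; rewrite ?nnegrE ?(ltW M0) ?(ltW Y0).
  rewrite natrX -[leLHS]/(2 ^+ d).
  apply: (@le_trans _ _ (expR 1 ^+ d)).
    apply: lerXn2r; rewrite ?nnegrE ?expR_ge0//.
    by apply: le_trans (expR_ge1Dx _); rewrite -[1 + 1]/(2%:R).
  by rewrite -expRM_natl mulr1 ler_expR.
(* Of the 26 powers of Y in 1 / s2, one pays for 4 c^24 / eps^2 and two for the square of 2^(n+2),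
   since 2^(n+2) <= 4^(n+1) <= Y. *)
have X : Y ^+ 23 <= dl ^+ 2 / (s2 *+ 2).
  have h4 : (2 ^+ n.+2) ^+ 2 <= Y ^+ 2.
    apply: lerXn2r; rewrite ?nnegrE ?(ltW p2) ?(ltW Y0)//.
    apply: (@le_trans _ _ (4 ^+ n.+1)).
      have -> : 4 ^+ n.+1 = 2 ^+ (2 * n.+1) :> R by rewrite exprM expr2 -natrM.
      by rewrite ler_weXn2l ?ler1n//; clear; lia.
    apply: lerXn2r; rewrite ?nnegrE ?(ltW M0)//.
    by apply: le_trans M12; rewrite ler_nat.
  have s2E : (s2 *+ 2)^-1 = (4 * c ^+ 24)^-1 * Y ^+ 26.
    have -> : s2 *+ 2 = 4 * c ^+ 24 * Y ^- 26.
      by rewrite /s2; move: (c ^+ 24) (Y ^- 26) => a b; ring.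
    by rewrite invfM invrK.
  rewrite s2E /dl expr_div_n.
  have e2 : 0 < eps ^+ 2 by rewrite exprn_gt0.
  have q1 : Y ^- 2 <= ((2 ^+ n.+2) ^+ 2)^-1 by rewrite lef_pV2 ?posrE ?exprn_gt0.
  have q2 : Y ^- 1 <= eps ^+ 2 * (4 * c ^+ 24)^-1.
    rewrite expr1 -[leRHS]invrK lef_pV2 ?posrE ?invr_gt0//; last first.
      by rewrite mulr_gt0// invr_gt0 mulr_gt0// exprn_gt0.
    by rewrite invfM invrK mulrC; apply: le_trans YM.
  have -> : Y ^+ 23 = Y ^- 1 * Y ^- 2 * Y ^+ 26.
    rewrite -invfM -exprD; have -> : Y ^+ 26 = Y ^+ (1 + 2) * Y ^+ 23 by rewrite -exprD.
    by rewrite mulKf// expf_neq0// gt_eqF.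
  rewrite [leRHS]mulrA ler_wpM2r ?exprn_ge0 ?(ltW Y0)// mulrAC.
  by apply: ler_pM => //; rewrite invr_ge0 exprn_ge0// ltW.
have beats : (9 * 25 * 4 * 40) * Y ^+ 110 * expR (Y ^+ 21) <= expR (Y ^+ 23).
  apply: expR_beats_power; first exact: le_trans M12 YM.
  by apply: (le_trans M2); apply: lerXn2r; rewrite ?nnegrE ?(ltW M0) ?(ltW Y0).
set err := _ *+ 2.
have err_le : err <= (25 * Y ^+ 22 * expR (Y ^+ 21) * (2 * (expR (Y ^+ 23))^-1)) *+ 2.
  rewrite lerMn2r; apply: ler_pM b2 _ => //.
  by rewrite ler_wpM2l// -expRN ler_expR lerN2.
have err0 : 0 <= err by rewrite mulrn_wge0// mulr_ge0// mulr_ge0 ?expR_ge0.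
have A0 : 0 < Y ^+ 22 by rewrite exprn_gt0.
have B0 : 0 < M ^+ 22 by rewrite exprn_gt0.
have bE : 20^-1 * ((M ^+ n) ^- 22 * M ^- 44) = 20^-1 * ((Y ^+ 22)^-1 * (M ^+ 22)^-1) :> R.
  congr (_ * _); have -> : M ^+ 44 = M ^+ 22 * M ^+ 22 by rewrite -exprD.
  have -> : Y ^+ 22 = M ^+ 22 * (M ^+ n) ^+ 22 by rewrite /Y [M ^+ n.+1]exprS exprMn.
  by rewrite !invfM; move: (M ^+ 22)^-1 ((M ^+ n) ^+ 22)^-1 => a b'; ring.
have tE : Y ^- 22 * M ^- 44 = (Y ^+ 22)^-1 * ((M ^+ 22)^-1 * (M ^+ 22)^-1).
  by congr (_ * _); rewrite -invfM -exprD.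
have e110 : Y ^+ 22 * Y ^+ 22 * Y ^+ 22 * (M ^+ 22 * M ^+ 22) <= Y ^+ 110.
  rewrite -!exprD -[M ^+ _]mul1r [Y ^+ 110](exprD Y 66 44) mul1r.
  rewrite ler_wpM2l ?exprn_ge0 ?(ltW Y0)//.
  by apply: lerXn2r; rewrite ?nnegrE ?(ltW M0) ?(ltW Y0).
rewrite bE tE.
have E0 : 0 < expR (Y ^+ 23) by exact: expR_gt0.
have F0 : 0 < expR (Y ^+ 21) by exact: expR_gt0.
have sz0 : 0 <= ((m ^ (11 * n.+1)).*2.+1 ^ 2)%:R :> R by exact: ler0n.
apply: (@le_trans _ _ (9 * Y ^+ 22 * ((20^-1 * ((Y ^+ 22)^-1 * (M ^+ 22)^-1)) ^+ 2 +
    (25 * Y ^+ 22 * expR (Y ^+ 21) * (2 * (expR (Y ^+ 23))^-1)) *+ 2))).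
  by apply: (ler_pM sz0 _ b1); [rewrite addr_ge0// sqr_ge0|rewrite lerD2l].
move: (expR (Y ^+ 23)) (expR (Y ^+ 21)) (Y ^+ 22) (M ^+ 22) (Y ^+ 110)
  A0 B0 E0 F0 e110 beats.
move=> E F A B Z A0 B0 E0 F0 e110 beats.
have key : (9 * 25 * 4 * 40) * (A * A * A * (B * B)) * F <= E.
  apply: le_trans beats; rewrite ler_wpM2r ?(ltW F0)//.
  by apply: ler_wpM2l e110; rewrite !mulr_ge0.
have k2 : 9 * 25 * 4 * 40 * F * (A * A) / E <= A^-1 * (B^-1 * B^-1).
  rewrite ler_pdivrMr// -!invfM [leRHS]mulrC ler_pdivlMr ?mulr_gt0//.
  by apply: le_trans key; rewrite le_eqVlt; apply/orP; left; apply/eqP; ring.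
have k3 : 0 < A^-1 * (B^-1 * B^-1) by rewrite !mulr_gt0// invr_gt0.
(* The squared term contributes 9/400 of the target and the decoupling error 1/40, together less
   than 1/20; the factor 40 in the constant was kept for this. *)
have -> : 9 * A * ((20^-1 * (A^-1 * B^-1)) ^+ 2 + (25 * A * F * (2 * E^-1)) *+ 2) =
   9 / (20 * 20) * (A^-1 * (B^-1 * B^-1)) + 9 * 25 * 4 * 40 * F * (A * A) / E / 40.
  by field; rewrite !gt_eqF.
by lra.
Qed.

(** The largest scale not exceeding k. For k = 0 every scale is too long, so the length is 0. *)
Definition arm_scale (k : nat) : nat :=
  if k == 0%N then 0%N else (m ^ (11 * trunc_log (m ^ 11) k))%N.

(** With l = m^11, [arm_bound] gives l^-(2n + 4) / 20, while k + 1 <= l^(n+1). The result is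
    summable over the points (k, 0) of the axis. *)
Lemma arm_scale_bound k u :
  pr P (event phi h (arm R (arm_scale k) u)) <= 20^-1 * k.+1%:R ^- 2.
Proof.
have gauss := gff_gaussian gff.
rewrite /arm_scale; case: eqP => [->|/eqP k0].
  apply: (@le_trans _ _ (pr P (event phi (h + eps) (fun E => ~ good R E u)))).
    apply: (@le_trans _ _ (pr P (event phi (h + eps) (arm R 0 u)))).
      apply: (event_le_level gauss (@arm_supported R d _ _)); first exact: arm_decreasing.
      by rewrite lerDl ltW.
    apply: pr_le.
    - exact: (measurable_event gauss _ (@arm_supported R d _ _)).
    - exact: (measurable_event gauss _ (@good_supported R d _)).
    - by move=> w; exact: arm_bad.
  rewrite (bad_translate gff); apply: (le_trans bad0).
  rewrite expr1n invr1 mulr1 lef_pV2 ?posrE ?exprn_gt0//.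
  apply: (@le_trans _ _ (M ^+ 2)); last by rewrite ler_weXn2l.
  by apply: le_trans M2; lra.
set n := trunc_log _ _.
apply: (@le_trans _ _ (pr P (event phi (h + eps / 2 ^+ n) (arm R (m ^ (11 * n)) u)))).
  apply: (event_le_level gauss (@arm_supported R d _ _)); first exact: arm_decreasing.
  by rewrite lerDl divr_ge0 ?(ltW eps0)// exprn_ge0.
apply: (le_trans (arm_bound n u)).
rewrite ler_wpM2l ?invr_ge0// -invfM lef_pV2 ?posrE ?mulr_gt0 ?exprn_gt0//.
have m2 : (1 < m)%N.
  by rewrite -(ltr_nat R); apply: lt_le_trans M12; rewrite ltr1n.
have kn : (k.+1 <= (m ^ 11) ^ n.+1)%N by rewrite trunc_log_ltn// -(exp1n 11) ltn_exp2r.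
apply: (@le_trans _ _ ((((m ^ 11) ^ n.+1)%N%:R : R) ^+ 2)).
  by apply: lerXn2r; rewrite ?nnegrE// ler_nat.
rewrite !natrX -!exprM -exprD ler_weXn2l//.
by clear; lia.
Qed.

Lemma perc_pos : 0 < pr P [set w | perc_from_origin h (phi w)].
Proof.
have p0 : 0 < 2 ^+ d :> R by rewrite exprn_gt0.
apply: (@lt_le_trans _ _ (2^-1 / 2 ^+ d)); first by rewrite divr_gt0// invr_gt0.
apply: (perc_prob gff) => N N0.
have m1 : (1 < m ^ 11)%N.
  by rewrite -(exp1n 11) ltn_exp2r// -(ltr_nat R); apply: lt_le_trans M12; rewrite ltr1n.
have scale_le k : (arm_scale k <= k)%N.
  rewrite /arm_scale; case: eqP => // /eqP k0.
  by rewrite expnM; apply: trunc_logP; rewrite ?lt0n.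
rewrite ler_pdivrMr// mulrC.
apply: le_trans (far_lower_bound gff d4 (q := 2^-1) N0 scale_le _).
  by lra.
(* All arms together have probability at most 2/20, below the chosen q = 1/2. *)
apply: (@le_trans _ _ (\sum_(k < N.+1) 20^-1 * (k.+1%:R ^- 2 : R))).
  by apply: ler_sum => k _; exact: arm_scale_bound.
rewrite -mulr_sumr; have := @sum_inv_sqr_le2 R N.
by move: (\sum_(_ < _) _) => S hS; lra.
Qed.

End renormalization.

Lemma perc_from_origin_le {R : realType} d (h h' : R) (phi : pt d -> R) : h' <= h ->
  perc_from_origin h phi -> perc_from_origin h' phi.
Proof.
move=> hh [h0 inf].
have sub : level_set phi h `<=` level_set phi h' by move=> x; exact: le_trans.
split; first exact: sub.
by apply: contra_not inf; apply: sub_finite_set => y; exact: path_in_sub.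
Qed.

Lemma limn_esup_eq0_lt1 {R : realType} (u : nat -> \bar R) : limn_esup u = 0%E ->
  exists N, forall n, (N <= n)%N -> (u n < 1)%E.
Proof.
move=> u0; have : (limn_esup u < 1)%E by rewrite u0 lte01.
move=> /ereal_inf_lt[_ [V [N _ NV] <-]] hV.
exists N => n Nn; apply: le_lt_trans hV; apply: ereal_sup_ubound.
by exists n => //; exact: NV.
Qed.

Theorem theorem4p1 (R : realType) (eps : R) (heps : 0 < eps)
    (dsp : nat -> measure_display) (Omega : forall d : nat, measurableType (dsp d))
    (P : forall d : nat, probability (Omega d) R)
    (phi : forall d : nat, Omega d -> pt d -> R)
    (hGFF : forall d : nat, (3 <= d)%N -> is_GFF (P d) (phi d))
    (h : nat -> R) :
  let a : R := 1 / 10 in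
  limn_esup (fun d : nat =>
      ((d%:R `^ (2 + 3 * a))%:E *
       P d (~` [set w | G_event (h d + eps) (0%R, 0%R) (phi d w)]))%E) = 0%E ->
  exists d0 : nat, forall d : nat, (d0 <= d)%N -> (3 <= d)%N ->
    ((h d)%:E <= h_star (P d) (phi d))%E.
Proof.
move=> a /limn_esup_eq0_lt1[d1 hd1].
have [d2 hd2] := @green_n_bound R 23 isT.
(* Below, m is the integer part of the 20th root of d, so d < (m + 1)^20 <= (2m)^20 = c m^20. *)
pose c : R := 2 ^+ 20.
have c1 : 1 <= c by rewrite exprn_ege1// ler1n.
pose K : R := 12 + 9 * 25 * 4 * 40 + c + 4 * c ^+ 24 / eps ^+ 2.
pose m0 := (Num.truncn K).+1.
exists (maxn (maxn d1 d2) (maxn 4 (m0 ^ 20))) => d.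
rewrite !geq_max => /andP[/andP[dd1 dd2] /andP[d4 dm0]] d3.
have gff := hGFF d d3.
have [m md mmax] : exists2 m, (m ^ 20 <= d)%N & forall k, (k ^ 20 <= d)%N -> (k <= m)%N.
  have P0 : exists k, (k ^ 20 <= d)%N by exists 0%N.
  have Pb k : (k ^ 20 <= d)%N -> (k <= d)%N.
    by apply: leq_trans; case: k => // k; rewrite -[leqLHS]expn1 leq_pexp2l.
  by case: (ex_maxnP P0 Pb) => m h1 h2; exists m.
have m0m := mmax _ dm0.
have Km : K <= m%:R.
  by apply: le_trans (ltW (truncnS_gt K)) _; rewrite ler_nat.
have k1 : 0 <= 4 * c ^+ 24 / eps ^+ 2.
  by rewrite divr_ge0 ?sqr_ge0// mulr_ge0// exprn_ge0// (le_trans _ c1).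
have k2 : 0 <= 9 * 25 * 4 * 40 :> R by rewrite !mulr_ge0.
have k3 : 0 <= c by rewrite (le_trans _ c1).
have le4 (x y z t : R) : 0 <= x -> 0 <= y -> 0 <= z -> 0 <= t ->
    [/\ x <= x + y + z + t, y <= x + y + z + t, z <= x + y + z + t & t <= x + y + z + t].
  by move=> *; split; lra.
have [K1 K2 K3 K4] := le4 12 _ _ _ (ler0n _ _) k2 k3 k1.
have M12 : 12 <= m%:R :> R by exact: le_trans K1 Km.
have M1 : 1 <= m%:R :> R by apply: le_trans M12; rewrite ler1n.
have M2 : 9 * 25 * 4 * 40 <= m%:R ^+ 2 :> R.
  apply: (@le_trans _ _ m%:R); last by rewrite expr2 ler_peMr// ler0n.
  exact: le_trans K2 Km.
have cM : c <= m%:R by exact: le_trans K3 Km.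
have epsM : 4 * c ^+ 24 / eps ^+ 2 <= m%:R by exact: le_trans K4 Km.
have dM : d%:R <= c * m%:R ^+ 20 :> R.
  have h1 : (d < m.+1 ^ 20)%N.
    by rewrite ltnNge; apply/negP => /mmax; rewrite ltnn.
  rewrite /c -exprMn -natrM -natrX ler_nat; apply: (leq_trans (ltnW h1)).
  rewrite leq_exp2r// mul2n -addnn -addn1 leq_add2l -(ler_nat R) //.
have bad0 : pr (P d) (event (phi d) (h d + eps) (fun E => ~ good R E 0)) <= m%:R ^- 46.
  have mb := measurable_event (gff_gaussian gff) (h d + eps) (@good_supported R d 0).
  have := hd1 d dd1.
  have -> : ~` [set w | G_event (h d + eps) (0, 0) (phi d w)] =
      event (phi d) (h d + eps) (fun E => ~ good R E 0).
    by apply/seteqP; split => w; apply: contra_not => hw; apply/G_eventE.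
  rewrite prE// -EFinM lte_fin => hlt.
  (* 2 + 3a = 2.3 = 46/20, and m^20 <= d. *)
  have big : m%:R ^+ 46 <= d%:R `^ (2 + 3 * a).
    have -> : m%:R ^+ 46 = (m%:R ^+ 20) `^ (2 + 3 * a) :> R.
      rewrite -!powR_mulrn// -powRrM; congr (_ `^ _); rewrite /a; by field.
    apply: ge0_ler_powR; rewrite ?nnegrE ?exprn_ge0//.
      by rewrite /a addr_ge0// mulr_ge0// divr_ge0.
    by rewrite -natrX ler_nat.
  rewrite -[leRHS]div1r ler_pdivlMr ?exprn_gt0 ?(lt_le_trans _ M1)// mulrC.
  by apply: le_trans (ltW hlt); rewrite ler_wpM2r ?pr_ge0.
have pos := perc_pos gff d4 (hd2 d dd2) heps c1 M12 M2 cM dM epsM bad0.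
(* A level h' < h without percolation would contradict positivity at h by monotonicity, so h is a
   lower bound of the set defining [h_star]. *)
apply: le_ereal_inf_tmp => _ [h' /= h'0 <-]; rewrite lee_fin leNgt; apply/negP => hh'.
move: pos; apply/negP; rewrite -leNgt.
have -> : 0 = pr (P d) [set w | perc_from_origin h' (phi d w)] by rewrite /pr h'0.
apply: pr_le; try exact: (measurable_perc gff).
by move=> w; apply: perc_from_origin_le; exact: ltW.
Qed.
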